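(* Let $V\subset\mathbb{R}^n$ be an $n$-dimensional simplex and write $\boldsymbol{x}=(x_1,\dots,x_n)$. Let $f_1(\boldsymbol{x}),\dots,f_k(\boldsymbol{x})$ be linear polynomials over $\mathbb{R}$ (not necessarily homogeneous) that are non-zero on the interior of $V$, and let $E_s(\boldsymbol{x})$ be an analytic function on a neighbourhood of $(s,\boldsymbol{x})\in\mathbb{C}\times V\subset\mathbb{C}^{n+1}$. Then the integral $$\int_V\big(f_1(\boldsymbol{x})\cdots f_k(\boldsymbol{x})\big)^sE_s(\boldsymbol{x})\,dx_1\cdots dx_n,\qquad \Re(s)>0,$$ (1) admits a meromorphic extension to $s\in\mathbb{C}$; (2) has all its poles at points $s\in\mathbb{Q}$; (3) has poles of order at most $n$ at any point.
   Context: Simplices are closed. The product $f_1\cdots f_k$ has constant sign on the interior of $V$; for a negative real number $a$ the power is taken as $a^s=|a|^se^{-\pi i s}$. *)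

(* Defs.v *)
From HB Require Import structures.
From mathcomp Require Import all_boot all_order all_algebra.
From mathcomp Require Import finmap.
From mathcomp Require Import complex.
From mathcomp Require Import all_classical all_reals all_analysis.
From mathcomp.analysis.showcase Require Import summability.

Set Implicit Arguments.
Unset Strict Implicit.
Unset Printing Implicit Defensive.

Import Order.TTheory GRing.Theory Num.Theory.
Import numFieldNormedType.Exports.

Local Open Scope classical_set_scope.
Local Open Scope ring_scope.
Local Open Scope complex_scope.

(* R[i] has no topology of its own; packaged as a numFieldType, it gets (as do
   row vectors over it) the topology of its norm. That norm is R[i]-valued but
   induces the usual topology of the complex plane. *)
Definition cplx (R : realType) : numFieldType := R[i].

Section LebesgueMeasure.
Context {R : realType}.
Local Notation mR := (measurableTypeR R).

Definition tuple_cons (n : nat) (p : mR * n.-tuple mR) : n.+1.-tuple mR :=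
  [tuple of p.1 :: p.2].

Lemma measurable_tuple_cons (n : nat) :
  measurable_fun [set: mR * n.-tuple mR] (@tuple_cons n).
Proof. exact: measurable_cons. Qed.

HB.instance Definition _ (n : nat) :=
  isMeasurableFun.Build _ _ _ _ (@tuple_cons n) (@measurable_tuple_cons n).

Section Step.
Variables (n : nat) (m : {sigma_finite_measure set (n.-tuple mR) -> \bar R}).

Definition lebesgue_step : set (n.+1.-tuple mR) -> \bar R :=
  pushforward (@lebesgue_measure R \x m)%E (@tuple_cons n).

Let lebesgue_step0 : lebesgue_step set0 = 0%E.
Proof. exact: measure0. Qed.

Let lebesgue_step_ge0 A : (0 <= lebesgue_step A)%E.
Proof. exact: measure_ge0. Qed.

Let lebesgue_step_sigma_additive : semi_sigma_additive lebesgue_step.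
Proof. exact: measure_semi_sigma_additive. Qed.

HB.instance Definition _ := isMeasure.Build _ _ _ lebesgue_step
  lebesgue_step0 lebesgue_step_ge0 lebesgue_step_sigma_additive.

Let lebesgue_step_sigma_finite : sigma_finite setT lebesgue_step.
Proof.
have /sigma_finiteP[F [TF ndF Foo]] := sigma_finiteT (@lebesgue_measure R).
have /sigma_finiteP[G [TG ndG Goo]] := sigma_finiteT m.
pose uncons (t : n.+1.-tuple mR) : mR * n.-tuple mR :=
  (thead t, [tuple of behead t]).
have unconsK : cancel uncons (@tuple_cons n).
  by move=> t; rewrite /tuple_cons /= [RHS]tuple_eta.
have consK : cancel (@tuple_cons n) uncons.
  by case=> x t; congr pair; exact/val_inj.
have muncons : measurable_fun setT uncons.
  apply: measurable_fun_pair; [exact: measurable_tnth|].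
  exact: measurable_behead.
exists (fun i => uncons @^-1` (F i `*` G i)).
  rewrite -preimage_bigcup (_ : \bigcup_i _ = setT) ?preimage_setT//.
  apply/seteqP; split => // -[x y] _.
  have [i _ Fix] : (\bigcup_k F k) x by rewrite -TF.
  have [j _ Gjy] : (\bigcup_k G k) y by rewrite -TG.
  exists (maxn i j) => //; split => /=.
  - by move: x Fix; exact/subsetPset/ndF/leq_maxl.
  - by move: y Gjy; exact/subsetPset/ndG/leq_maxr.
move=> i; have [mF Fi] := Foo i; have [mG Gi] := Goo i; split.
  by rewrite -[X in measurable X]setTI; apply: muncons => //; exact: measurableX.
rewrite /lebesgue_step /pushforward -comp_preimage.
rewrite (_ : uncons \o _ = id); last by apply/funext => p /=; rewrite consK.
by rewrite preimage_id product_measure1E// lte_mul_pinfty// ge0_fin_numE.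
Qed.

HB.instance Definition _ := Measure_isSigmaFinite.Build _ _ _ lebesgue_step
  lebesgue_step_sigma_finite.

End Step.

(* Lebesgue measure on R^n: the n-fold product of the Lebesgue measure on the
   line, transported to n-tuples. *)
Fixpoint lebesgueT (n : nat) :
    {sigma_finite_measure set (n.-tuple mR) -> \bar R} :=
  match n with
  | 0 => dirac [tuple]
  | n'.+1 => lebesgue_step (lebesgueT n')
  end.

End LebesgueMeasure.

Section Analytic.
Context {R : realType}.
Local Notation C := (cplx R).

Definition monomial (N : nat) (al : {ffun 'I_N -> nat}) (w : 'rV[C]_N) : C :=
  \prod_i w 0 i ^+ al i.

(* Summation over multi-indices is unordered: the limit is taken along the
   directed set of finite sets of multi-indices. *)
Definition analytic_at (N : nat) (f : 'rV[C]_N -> C) (p : 'rV[C]_N) : Prop :=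
  exists a : {ffun 'I_N -> nat} -> C,
    \forall z \near p,
      partial_sum (fun al => a al * monomial al (z - p)) @ totally --> f z.

Definition analytic1_at (f : C -> C) (p : C) : Prop :=
  exists a : nat -> C,
    \forall z \near p, series (fun k => a k * (z - p) ^+ k) @ \oo --> f z.

Definition pole_of_order (m : nat) (f : C -> C) (p : C) : Prop :=
  (0 < m)%N /\
  exists g : C -> C, [/\ analytic1_at g p, g p != 0 &
    \forall z \near p^', f z = g z / (z - p) ^+ m].

Definition meromorphic (f : C -> C) : Prop :=
  forall p, analytic1_at f p \/ exists m, pole_of_order m f p.

Definition cexp (z : C) : C :=
  (expR (complex.Re z))%:C * (cos (complex.Im z) +i* sin (complex.Im z)).

(* The power a ^ s of a real number: a ^ s = |a| ^ s * exp (- pi i s) when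
   a < 0; the value 0 at a = 0 is a convention. *)
Definition real_cpow (a : R) (s : C) : C :=
  if a == 0 then 0
  else if 0 < a then cexp (s * (ln a)%:C)
  else cexp (s * (ln `|a|)%:C) * cexp (- (pi%:C * 'i * s)).

End Analytic.

Section Geometry.
Context {R : realType} (n : nat).

Definition affinely_independent (v : 'I_n.+1 -> 'rV[R]_n) : Prop :=
  row_free (\matrix_(i < n) (v (lift ord0 i) - v ord0)).

Definition simplex (v : 'I_n.+1 -> 'rV[R]_n) : set 'rV[R]_n :=
  [set x | exists t : 'I_n.+1 -> R,
    [/\ forall i, 0 <= t i, \sum_i t i = 1 & x = \sum_i t i *: v i]].

Definition linear_poly (c : R) (l : 'rV[R]_n) (x : 'rV[R]_n) : R :=
  c + \sum_i l 0 i * x 0 i.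

Definition row_of_tuple (t : n.-tuple (measurableTypeR R)) : 'rV[R]_n :=
  \row_i tnth t i.

(* The integral over D of g with respect to dx_1 ... dx_n. *)
Definition cintegrable (D : set 'rV[R]_n) (g : 'rV[R]_n -> cplx R) : Prop :=
  (lebesgueT n).-integrable (row_of_tuple @^-1` D)
    (fun t => (complex.Re (g (row_of_tuple t)))%:E) /\
  (lebesgueT n).-integrable (row_of_tuple @^-1` D)
    (fun t => (complex.Im (g (row_of_tuple t)))%:E).

Definition cintegral (D : set 'rV[R]_n) (g : 'rV[R]_n -> cplx R) : cplx R :=
  Rintegral (lebesgueT n) (row_of_tuple @^-1` D)
    (fun t => complex.Re (g (row_of_tuple t))) +i*
  Rintegral (lebesgueT n) (row_of_tuple @^-1` D)
    (fun t => complex.Im (g (row_of_tuple t))).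

(* The point (s, x) of C^(1 + n). *)
Definition complex_point (s : cplx R) (x : 'rV[R]_n) : 'rV[cplx R]_(1 + n) :=
  row_mx s%:M (map_mx (fun r => r%:C) x).

End Geometry.

(* Main.v *)
From HB Require Import structures.
Require Import Defs.
From mathcomp Require Import all_boot all_order all_algebra.
From mathcomp Require Import finmap.
From mathcomp Require Import complex.
From mathcomp Require Import all_classical all_reals all_analysis.
From mathcomp Require Import measurable_realfun ring lra.
From mathcomp.analysis.showcase Require Import summability.

Set Implicit Arguments.
Unset Strict Implicit.
Unset Printing Implicit Defensive.

Import Order.TTheory GRing.Theory Num.Theory.
Import numFieldNormedType.Exports.

Local Open Scope classical_set_scope.
Local Open Scope ring_scope.
Local Open Scope complex_scope.

(** The idea is a local normal form for the product of the forms, followed by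
    integration by parts.

    Normal form. After changing the signs of some forms, which only multiplies the
    integral by an entire function of s, every form is nonnegative at the vertices
    and nonzero at one of them: otherwise a suitable interior point would be a zero
    (vertex_signs). If some form vanishes at a vertex a and not at b while another
    vanishes at b and not at a, cutting the edge ab at its midpoint gives two
    simplices whose vertices carry strictly fewer zeros of forms. Hence finitely
    many bisections lead to simplices on which the sets of forms vanishing at the
    vertices form a chain (simplex_continuable). Listing the vertices with the most
    zeros first, use the coordinates y of the cube given by
      X_0 = w_0,  X_(k+1)(y) = (1 - y_k) w_0 + y_k X_k(w_1, w_2, ...)(y).
    There each form is a product of some of the y_i times a polynomial that is
    positive on the whole closed cube (duffyR_monomial), and the Lebesgue measure of
    the simplex becomes a constant times prod_i y_i^i dy_i (simplex_integral). So the
    integral is, up to a constant,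
      int_(cube) prod_i y_i^(m_i s + i) G(s, y) dy
    with m_i <= k and with G smooth in y and entire in s.

    Continuation. Integrating by parts in y_i replaces y_i^(m_i s + i) by a higher
    power at the price of one of the factors m_i s + i + j + 1, and commutes with the
    other integrations. Thus the integral times finitely many such linear factors is
    holomorphic on any prescribed half-plane (regularized_integral). For each of the
    n variables the zeros of these factors are simple and are negative rationals, so
    the n-th power of one product over a finite set of rationals clears all
    denominators, for all pieces of the subdivision at once (sorted_continuable).

    Gluing. The quotients obtained on different half-planes agree by the identity
    theorem, and a quotient H(z) / (z - p)^m0 with H holomorphic at p is analytic at p
    or has there a pole of order at most m0, where m0 <= n and m0 = 0 unless p is
    rational (continuation_meromorphic, pole_order_le).

    Smoothness in y is only ever used through first order expansions with a quadratic
    remainder that is uniform on the cube, and holomorphy in s through power series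
    whose coefficients obey Cauchy bounds with a common radius; both are preserved by
    sums, products and integration in a variable. *)

(** * The l1 modulus on the complex numbers *)

Section Modulus.
Context {R : realType}.
Local Notation C := (cplx R).
Implicit Types (z w : C) (x : R).

(** The square root in the usual modulus is avoided; as the topology is the same and nm
    is submultiplicative, nothing is lost. *)
Definition nm z : R := `|complex.Re z| + `|complex.Im z|.

Lemma ReD z w : complex.Re (z + w) = complex.Re z + complex.Re w.
Proof. by case: z w => [a b] [c d]. Qed.
Lemma ImD z w : complex.Im (z + w) = complex.Im z + complex.Im w.
Proof. by case: z w => [a b] [c d]. Qed.
Lemma ReN z : complex.Re (- z) = - complex.Re z.
Proof. by case: z. Qed.
Lemma ImN z : complex.Im (- z) = - complex.Im z.
Proof. by case: z. Qed.
Lemma ReB z w : complex.Re (z - w) = complex.Re z - complex.Re w.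
Proof. by rewrite ReD ReN. Qed.
Lemma ImB z w : complex.Im (z - w) = complex.Im z - complex.Im w.
Proof. by rewrite ImD ImN. Qed.
Lemma ReM z w : complex.Re (z * w) =
  complex.Re z * complex.Re w - complex.Im z * complex.Im w.
Proof. by case: z w => [a b] [c d]. Qed.
Lemma ImM z w : complex.Im (z * w) =
  complex.Re z * complex.Im w + complex.Im z * complex.Re w.
Proof. by case: z w => [a b] [c d]. Qed.
Lemma Re0 : complex.Re (0 : C) = 0. Proof. by []. Qed.
Lemma Im0 : complex.Im (0 : C) = 0. Proof. by []. Qed.
Lemma ReMr x z : complex.Re ((x%:C : C) * z) = x * complex.Re z.
Proof. by rewrite ReM /= mul0r subr0. Qed.
Lemma ImMr x z : complex.Im ((x%:C : C) * z) = x * complex.Im z.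
Proof. by rewrite ImM /= mul0r addr0. Qed.
Lemma Re_sum (I : Type) (r : seq I) (P : pred I) (F : I -> C) :
  complex.Re (\sum_(i <- r | P i) F i) = \sum_(i <- r | P i) complex.Re (F i).
Proof. exact: (big_morph _ ReD Re0). Qed.
Lemma Im_sum (I : Type) (r : seq I) (P : pred I) (F : I -> C) :
  complex.Im (\sum_(i <- r | P i) F i) = \sum_(i <- r | P i) complex.Im (F i).
Proof. exact: (big_morph _ ImD Im0). Qed.

Lemma cplxP z w : complex.Re z = complex.Re w -> complex.Im z = complex.Im w ->
  z = w.
Proof. by case: z w => [a b] [c d] /= -> ->. Qed.

Lemma nm0 : nm 0 = 0. Proof. by rewrite /nm /= normr0 addr0. Qed.
Lemma nm1 : nm 1 = 1. Proof. by rewrite /nm /= normr0 normr1 addr0. Qed.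
Lemma nm_ge0 z : 0 <= nm z. Proof. exact: addr_ge0. Qed.
Lemma nm_real x : nm (x%:C) = `|x|. Proof. by rewrite /nm /= normr0 addr0. Qed.
Lemma nm_eq0 z : nm z = 0 -> z = 0.
Proof.
move/eqP; rewrite paddr_eq0// !normr_eq0 => /andP[/eqP a /eqP b].
exact: cplxP.
Qed.
Lemma nm_gt0 z : z != 0 -> 0 < nm z.
Proof. by move=> z0; rewrite lt_neqAle nm_ge0 andbT eq_sym; apply: contra z0 => /eqP/nm_eq0/eqP. Qed.
Lemma nmN z : nm (- z) = nm z.
Proof. by rewrite /nm ReN ImN !normrN. Qed.
Lemma nmD z w : nm (z + w) <= nm z + nm w.
Proof.
rewrite /nm ReD ImD addrACA.
by apply: lerD; exact: ler_normD.
Qed.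
Lemma nmB z w : nm (z - w) <= nm z + nm w.
Proof. by rewrite -[X in _ <= _ + X]nmN; exact: nmD. Qed.
Lemma nmBC z w : nm (z - w) = nm (w - z).
Proof. by rewrite -nmN opprB. Qed.
Lemma nmM z w : nm (z * w) <= nm z * nm w.
Proof.
rewrite /nm ReM ImM mulrDl !mulrDr -!normrM.
apply: le_trans (lerD (ler_normB _ _) (ler_normD _ _)) _.
lra.
Qed.
Lemma nmMr x z : nm ((x%:C : C) * z) = `|x| * nm z.
Proof. by rewrite /nm ReMr ImMr !normrM mulrDr. Qed.
Lemma nmX z n : nm (z ^+ n) <= nm z ^+ n.
Proof.
elim: n => [|n IH]; first by rewrite !expr0 nm1.
rewrite !exprS; apply: le_trans (nmM _ _) _.
by apply: ler_wpM2l => //; exact: nm_ge0.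
Qed.
Lemma nm_sum (I : Type) (r : seq I) (P : pred I) (F : I -> C) :
  nm (\sum_(i <- r | P i) F i) <= \sum_(i <- r | P i) nm (F i).
Proof.
elim/big_ind2: _ => //; first by rewrite nm0.
by move=> a b c d ab cd; apply: le_trans (nmD _ _) _; exact: lerD.
Qed.
Lemma Re_le_nm z : `|complex.Re z| <= nm z.
Proof. by rewrite lerDl. Qed.
Lemma Im_le_nm z : `|complex.Im z| <= nm z.
Proof. by rewrite lerDr. Qed.
(** The norm of cplx is complex-valued; this expresses its topology through nm. *)
Lemma nbhsCP (p : C) (P : set C) :
  nbhs p P <-> exists2 e : R, 0 < e & forall z, nm (z - p) < e -> P z.
Proof.
split.
  move=> /nbhs_ballP[e /= e0 H].
  have eI : complex.Im e = 0 by apply: ger0_Im; exact: ltW.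
  have eE : e = (complex.Re e)%:C :> C by apply: cplxP.
  exists (complex.Re e); first by rewrite -ltcR -eE.
  move=> z zp; apply: H; rewrite /ball /= /ball_ distrC normc_def eE ltcR.
  apply: le_lt_trans zp; rewrite /nm.
  set a := complex.Re _; set b := complex.Im _.
  have -> : `|a| + `|b| = Num.sqrt ((`|a| + `|b|) ^+ 2).
    by rewrite sqrtr_sqr (ger0_norm (addr_ge0 _ _)).
  apply: ler_wsqrtr; rewrite sqrrD !real_normK ?num_real//.
  by rewrite -addrA lerD2l lerDr mulrn_wge0// mulr_ge0.
move=> [e e0 H]; apply/nbhs_ballP; exists ((e / 2)%:C : C).
  by rewrite /= ltcR divr_gt0.
move=> z; rewrite /ball /= /ball_ distrC normc_def ltcR => h.
apply: H; rewrite /nm [ltRHS](splitr e); apply: ltrD.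
  by apply: le_lt_trans h; rewrite -sqrtr_sqr; apply: ler_wsqrtr; rewrite lerDl sqr_ge0.
by apply: le_lt_trans h; rewrite -sqrtr_sqr; apply: ler_wsqrtr; rewrite lerDr sqr_ge0.
Qed.

Lemma cvgCP (T : Type) (F : set_system T) (FF : Filter F) (f : T -> C) (l : C) :
  f @ F --> l <-> forall e : R, 0 < e -> \forall t \near F, nm (f t - l) < e.
Proof.
split=> [H e e0|H].
  have := H [set z | nm (z - l) < e]; apply.
  by apply/nbhsCP; exists e.
move=> P /nbhsCP[e e0 eP].
by apply: filterS (H _ e0) => t /eP.
Qed.

End Modulus.

(** * Limits and series of complex numbers *)

Section ComplexSeries.
Context {R : realType}.
Local Notation C := (cplx R).
Implicit Types (z w l : C) (u : nat -> C).

Lemma cvgC_Re u l : u @ \oo --> l -> @complex.Re R \o u @ \oo --> complex.Re l.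
Proof.
move/cvgCP => H; apply/cvgrPdist_lt => e /H; apply: filterS => n /=.
by apply: le_lt_trans; rewrite -ReB (le_trans (Re_le_nm _))// nmBC.
Qed.

Lemma cvgC_Im u l : u @ \oo --> l -> @complex.Im R \o u @ \oo --> complex.Im l.
Proof.
move/cvgCP => H; apply/cvgrPdist_lt => e /H; apply: filterS => n /=.
by apply: le_lt_trans; rewrite -ImB (le_trans (Im_le_nm _))// nmBC.
Qed.

Lemma cvgC_ReIm u l : @complex.Re R \o u @ \oo --> complex.Re l ->
  @complex.Im R \o u @ \oo --> complex.Im l -> u @ \oo --> l.
Proof.
move=> /cvgrPdist_lt H1 /cvgrPdist_lt H2; apply/cvgCP => e e0.
have e20 : 0 < e / 2 by rewrite divr_gt0.
apply: filterS2 (H1 _ e20) (H2 _ e20) => n /= h1 h2.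
by rewrite nmBC [ltRHS](splitr e) /nm ReB ImB ltrD.
Qed.

Lemma cvgC_nm0 u l (v : nat -> R) : (forall n, nm (u n - l) <= v n) ->
  v @ \oo --> 0 -> u @ \oo --> l.
Proof.
move=> uv /cvgrPdist_lt H; apply/cvgCP => e /H; apply: filterS => n /=.
rewrite sub0r normrN => /ltr_normlW; apply: le_lt_trans; exact: uv.
Qed.

Lemma cvgC_nm_le u l (B : R) : u @ \oo --> l -> (forall n, nm (u n) <= B) -> nm l <= B.
Proof.
move=> /cvgCP H uB; apply/ler_addgt0Pr => e e0.
have [n _ /(_ n (leqnn n)) /= hn] := H _ e0.
rewrite -[l](subKr (u n)); apply: le_trans (nmB _ _) _.
by rewrite lerD// ltW.
Qed.

Lemma series_Re u : @complex.Re R \o series u = series (@complex.Re R \o u).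
Proof. by apply/funext => n; rewrite /series /= Re_sum. Qed.
Lemma series_Im u : @complex.Im R \o series u = series (@complex.Im R \o u).
Proof. by apply/funext => n; rewrite /series /= Im_sum. Qed.

Lemma sum_geo_le (q : R) n : 0 <= q <= 2^-1 -> \sum_(0 <= k < n) q ^+ k <= 2.
Proof.
move=> /andP[q0 q1]; apply: le_trans (_ : \sum_(0 <= k < n) 2^-1 ^+ k <= _).
  by apply: ler_sum => k _; rewrite lerXn2r// nnegrE.
have -> : \sum_(0 <= k < n) 2^-1 ^+ k = 2 - 2 * 2^-1 ^+ n :> R.
  elim: n => [|n IH]; first by rewrite big_nil expr0 mulr1 subrr.
  by rewrite big_nat_recr//= IH exprS; field.
by rewrite lerBlDr lerDl mulr_ge0// exprn_ge0.
Qed.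

Lemma half_pow_cvg0 (A : R) : (fun n => A * 2^-1 ^+ n) @ \oo --> 0.
Proof.
rewrite -[X in _ --> X](mulr0 A); apply: cvgM; first exact: cvg_cst.
by apply: cvg_expr; rewrite ger0_norm// invf_lt1// ltr1n.
Qed.

(** Viewing partial sums as values at 1 of polynomials, the product of two of them
    exceeds the partial sum of the Cauchy product by n coefficients of degree at least
    n, in total O(n^2 q^n); as n^2 <= 4^n, the ratio 1/8 makes this at most O(2^-n). *)
Lemma cauchy_product (a b : nat -> C) (A B q : R) (la lb : C) :
  0 <= q <= 8^-1 ->
  (forall k, nm (a k) <= A * q ^+ k) -> (forall k, nm (b k) <= B * q ^+ k) ->
  series a @ \oo --> la -> series b @ \oo --> lb ->
  series (fun k => \sum_(i < k.+1) a i * b (k - i)%N) @ \oo --> la * lb.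
Proof.
move=> /andP[q0 q1] aA bB ca cb.
set c := fun k => _.
have A0 : 0 <= A by have := le_trans (nm_ge0 _) (aA 0%N); rewrite mulr1.
have B0 : 0 <= B by have := le_trans (nm_ge0 _) (bB 0%N); rewrite mulr1.
have key n : nm (series a n * series b n - series c n) <= (A * B * 2) * 2^-1 ^+ n.
  pose p := \poly_(i < n) a i; pose r := \poly_(i < n) b i.
  have pa : series a n = p.[1].
    rewrite horner_poly /series /= big_mkord; apply: eq_bigr => i _.
    by rewrite expr1n mulr1.
  have rb : series b n = r.[1].
    rewrite horner_poly /series /= big_mkord; apply: eq_bigr => i _.
    by rewrite expr1n mulr1.
  have nmp i : nm p`_i <= A * q ^+ i.
    by rewrite coef_poly; case: ifP => _ //; rewrite nm0 mulr_ge0// exprn_ge0.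
  have nmr i : nm r`_i <= B * q ^+ i.
    by rewrite coef_poly; case: ifP => _ //; rewrite nm0 mulr_ge0// exprn_ge0.
  have nmpr k : nm (p * r)`_k <= k.+1%:R * (A * B * q ^+ k).
    rewrite coefM; apply: le_trans (nm_sum _ _ _) _.
    rewrite mulr_natl -[X in _ *+ X]card_ord -sumr_const; apply: ler_sum => i _.
    apply: le_trans (nmM _ _) _.
    apply: le_trans (ler_pM (nm_ge0 _) (nm_ge0 _) (nmp _) (nmr _)) _.
    by rewrite mulrACA -exprD subnKC// leq_ord.
  have szpr : (size (p * r)%R <= n + n)%N.
    apply: leq_trans (size_polyMleq _ _) _; apply: leq_trans (leq_pred _) _.
    by apply: leq_add; exact: size_poly.
  rewrite pa rb -hornerM (horner_coef_wide 1 szpr).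
  rewrite -(big_mkord xpredT (fun i => (p * r)`_i * 1 ^+ i)) /=.
  rewrite (big_cat_nat (n:=n)) ?leq_addr//= addrC.
  have -> : \sum_(0 <= i < n) (p * r)`_i * 1 ^+ i = series c n.
    rewrite /series /=; apply: eq_big_nat => k /andP[_ kn].
    rewrite expr1n mulr1 coefM; apply: eq_bigr => i _.
    rewrite !coef_poly (leq_ltn_trans (leq_ord i) kn).
    by rewrite (leq_ltn_trans (leq_subr _ _) kn).
  rewrite addrK; apply: le_trans (nm_sum _ _ _) _.
  apply: le_trans (_ : \sum_(n <= i < n + n) (n + n)%:R * (A * B * q ^+ n) <= _).
    rewrite !big_nat; apply: ler_sum => i /andP[ni inn].
    rewrite expr1n mulr1; apply: le_trans (nmpr i) _.
    apply: ler_pM => //.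
    - by rewrite !mulr_ge0// exprn_ge0.
    - by rewrite ler_nat.
    - apply: ler_wpM2l; first exact: mulr_ge0.
      by rewrite -(subnK ni) exprD ler_piMl ?exprn_ge0 ?exprn_ile1//; lra.
  rewrite big_const_nat iter_addr_0 addnK -[_ *+ n]mulr_natl.
  have -> : n%:R * ((n + n)%:R * (A * B * q ^+ n)) =
    A * B * 2 * (n%:R * n%:R * q ^+ n) by rewrite natrD; ring.
  apply: ler_wpM2l; first by rewrite !mulr_ge0.
  apply: le_trans (_ : (2 ^+ n * 2 ^+ n) * 8^-1 ^+ n <= _).
    have n2 : n%:R <= 2 ^+ n :> R by rewrite -natrX ler_nat ltnW// ltn_expl.
    apply: ler_pM => //; [exact: exprn_ge0|exact: ler_pM|].
    by rewrite lerXn2r// nnegrE.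
  by rewrite -!exprMn le_eqVlt; apply/orP; left; apply/eqP; congr (_ ^+ n); field.
have key0 : (fun n => series a n * series b n - series c n) @ \oo --> (0 : C).
  by apply: (cvgC_nm0 (v := fun n => (A * B * 2) * 2^-1 ^+ n));
    [move=> n; rewrite subr0; exact: key|exact: half_pow_cvg0].
rewrite (_ : series c = fun n =>
  series a n * series b n - (series a n * series b n - series c n)); last first.
  by apply/funext => n; rewrite subKr.
rewrite -[la * lb]subr0.
exact: (cvgB (cvgM ca cb) key0).
Qed.

End ComplexSeries.

(** * The exponential series *)

Section ComplexExponential.
Context {R : realType}.
Local Notation C := (cplx R).
Implicit Types (z w : C) (x y : R).

Lemma exp_coeff_le x k : 0 <= x -> x ^+ k / k`!%:R <= expR x.
Proof.
move=> x0.
have := @nondecreasing_cvgn_le _ (series (exp_coeff x)) _ (is_cvg_series_exp_coeff x) k.+1.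
rewrite -/(expR x) /series /= big_nat_recr//= => H.
apply: le_trans (H _); last first.
  apply/nondecreasing_seqP => n; rewrite /series/= big_nat_recr//= lerDl.
  exact: exp_coeff_ge0.
by rewrite lerDr; apply: sumr_ge0 => i _; exact: exp_coeff_ge0.
Qed.

(** One term of the exponential series of r x bounds the coefficient, which is Cauchy's
    estimate on the circle of radius r. *)
Lemma exp_coeff_le_geo x (r : R) k : 0 <= x -> 0 < r ->
  x ^+ k / k`!%:R <= expR (r * x) * r^-1 ^+ k.
Proof.
move=> x0 r0; have := @exp_coeff_le (r * x) k (mulr_ge0 (ltW r0) x0).
rewrite exprMn exprVn ler_pdivlMr ?exprn_gt0//; apply: le_trans.
by rewrite le_eqVlt; apply/orP; left; apply/eqP; ring.
Qed.

Lemma nm_fact_inv k : nm ((k`!%:R : C)^-1) = k`!%:R^-1.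
Proof.
rewrite (_ : (k`!%:R : C)^-1 = (k`!%:R^-1)%:C) ?nm_real ?ger0_norm//.
by rewrite rmorphV ?unitfE ?pnatr_eq0 -?lt0n ?fact_gt0// rmorph_nat.
Qed.

Lemma nm_exp_coeff_le w (r : R) k : 0 < r ->
  nm (w ^+ k / k`!%:R) <= expR (r * nm w) * r^-1 ^+ k.
Proof.
move=> r0; apply: le_trans (exp_coeff_le_geo k (nm_ge0 w) r0).
apply: le_trans (nmM _ _) _; rewrite nm_fact_inv.
by apply: ler_wpM2r => //; exact: nmX.
Qed.

Lemma cexp_series_real x :
  series (fun k => (x%:C : C) ^+ k / k`!%:R) @ \oo --> ((expR x)%:C : C).
Proof.
have E k : (x%:C : C) ^+ k / k`!%:R = (exp_coeff x k)%:C.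
  by rewrite /exp_coeff /= rmorphM rmorphXn rmorphV ?unitfE ?pnatr_eq0 -?lt0n ?fact_gt0// rmorph_nat.
apply: cvgC_ReIm.
  rewrite series_Re (_ : _ \o _ = exp_coeff x); first exact: is_cvg_series_exp_coeff.
  by apply/funext => k /=; rewrite E.
rewrite series_Im (_ : series _ = fun=> 0); first exact: cvg_cst.
by apply/funext => n; rewrite /series /= big1// => k _; rewrite E.
Qed.

Lemma iy_pow y k : ((0 +i* y) : C) ^+ k =
  (if odd k then 0 +i* ((-1) ^+ k.-1./2 * y ^+ k) else ((-1) ^+ k./2 * y ^+ k)%:C).
Proof.
elim: k => [|k IH]; first by rewrite !expr0 mulr1.
rewrite exprSr IH /=; case: ifP => ok /=; apply: cplxP; rewrite ?ReM ?ImM /=.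
- have -> : uphalf k = (k.-1./2).+1 by case: k ok {IH}.
  by rewrite exprS exprSr; ring.
- by ring.
- by ring.
- by rewrite exprSr; ring.
Qed.

Lemma cexp_series_imag y :
  series (fun k => ((0 +i* y) : C) ^+ k / k`!%:R) @ \oo --> ((cos y +i* sin y) : C).
Proof.
have E k : ((0 +i* y) : C) ^+ k / k`!%:R = ((k`!%:R^-1)%:C : C) * (0 +i* y) ^+ k.
  by rewrite mulrC rmorphV ?unitfE ?pnatr_eq0 -?lt0n ?fact_gt0// rmorph_nat.
apply: cvgC_ReIm; rewrite ?series_Re ?series_Im.
  rewrite (_ : _ \o _ = cos_coeff y).
    by rewrite /= unlock; exact: is_cvg_series_cos_coeff.
  apply/funext => k /=; rewrite E ReMr iy_pow /cos_coeff/=.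
  by case: ifP => ok /=; rewrite -?exprnP; ring.
rewrite (_ : _ \o _ = sin_coeff y).
  by rewrite /= unlock; exact: is_cvg_series_sin_coeff.
apply/funext => k /=; rewrite E ImMr iy_pow /sin_coeff/=.
by case: ifP => ok /=; rewrite -?exprnP; ring.
Qed.

Lemma cexp_series w : series (fun k => w ^+ k / k`!%:R) @ \oo --> cexp w.
Proof.
have wE : w = (complex.Re w)%:C + (0 +i* complex.Im w) by apply: cplxP; rewrite ?ReD ?ImD /= ?addr0 ?add0r.
have h8 : 0 <= (8^-1 : R) <= 8^-1 by rewrite lexx andbT.
have := cauchy_product h8 (fun k => nm_exp_coeff_le (complex.Re w)%:C k (ltr0n R 8))
   (fun k => nm_exp_coeff_le (0 +i* complex.Im w) k (ltr0n R 8))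
   (@cexp_series_real (complex.Re w)) (@cexp_series_imag (complex.Im w)).
rewrite -/(cexp w); apply: cvg_trans; rewrite (_ : (fun k => _) = (fun k => w ^+ k / k`!%:R)) //.
apply/funext => k; rewrite {3}wE [_ + _]addrC exprDn mulr_suml; apply: eq_bigr => i _.
have ik : (i <= k)%N by rewrite -ltnS.
rewrite -[_ *+ 'C(k, i)]mulr_natr.
have E : ('C(k, i)%:R : C) = k`!%:R / (i`!%:R * (k - i)`!%:R).
  rewrite -(bin_fact ik) natrM natrM mulfK// mulf_neq0// pnatr_eq0 -lt0n fact_gt0//.
rewrite E.
have f0 m : (m`!%:R : C) != 0 by rewrite pnatr_eq0 -lt0n fact_gt0.
by field; rewrite !f0.
Qed.

Lemma cexpD z w : cexp (z + w) = cexp z * cexp w.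
Proof.
rewrite /cexp ReD ImD expRD cosD sinD; apply: cplxP;
  rewrite !(ReM, ImM, ReMr, ImMr) /=; ring.
Qed.

Lemma cexp0 : cexp (0 : C) = 1.
Proof. by rewrite /cexp /= expR0 cos0 sin0 mul1r. Qed.

Lemma cexpN z : cexp (- z) = (cexp z)^-1.
Proof.
have h : cexp (- z) * cexp z = 1 by rewrite -cexpD addNr cexp0.
have h0 : cexp z != 0 by apply: contra_eq_neq h => ->; rewrite mulr0 eq_sym oner_eq0.
by apply: (mulIf h0); rewrite h mulVf.
Qed.

Lemma nm_cexp_le z : nm (cexp z) <= 2 * expR (complex.Re z).
Proof.
rewrite /cexp nmMr ger0_norm ?expR_ge0// mulrC; apply: ler_wpM2r; first exact: expR_ge0.
rewrite /nm /= (_ : 2 = 1 + 1)//; apply: lerD; rewrite ler_norml.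
  by rewrite cos_geN1 cos_le1.
by rewrite sin_geN1 sin_le1.
Qed.

Lemma cexp_real x : cexp (x%:C : C) = (expR x)%:C.
Proof. by rewrite /cexp /= cos0 sin0 mulr1. Qed.

End ComplexExponential.

(** * Holomorphy with Cauchy bounds *)

Section Holomorphic.
Context {R : realType}.
Local Notation C := (cplx R).
Implicit Types (s z w : C) (e : R) (g h : C -> C).

Lemma cvgC_ext (u v : nat -> C) (l : C) : (forall n, u n = v n) -> u @ \oo --> l -> v @ \oo --> l.
Proof. by move=> /funext ->. Qed.

Lemma cvgC_Ml (u : nat -> C) (a l : C) : u @ \oo --> l -> (fun n => a * u n) @ \oo --> a * l.
Proof. by move=> ul; exact: (cvgM (cvg_cst a) ul). Qed.

Lemma cvgC_Br (u : nat -> C) (a l : C) : u @ \oo --> l -> (fun n => u n - a) @ \oo --> l - a.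
Proof. by move=> ul; exact: (cvgB ul (cvg_cst a)). Qed.

Lemma cvgC_shift (k : nat) (u : nat -> C) (l : C) :
  u @ \oo --> l -> (fun n => u (n + k)%N) @ \oo --> l.
Proof. by move=> ul; have := ul; rewrite -(cvg_shiftn k). Qed.

(** One number controls both the disc of convergence and all coefficients. A family of
    functions sharing e can then be integrated coefficient by coefficient. *)
Definition hol e s0 g := 0 < e /\ exists c : nat -> C,
  (forall k, nm (c k) <= e^-1 * e^-1 ^+ k) /\
  (forall s, nm (s - s0) < e -> series (fun k => c k * (s - s0) ^+ k) @ \oo --> g s).

Lemma series0_cvg (c : nat -> C) l :
  series (fun k => c k * 0 ^+ k) @ \oo --> l -> l = c 0%N.
Proof.
move/cvgCP => H; apply/eqP; rewrite -subr_eq0; apply/eqP/nm_eq0.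
apply/eqP; rewrite eq_le nm_ge0 andbT; apply/ler_addgt0Pr => e e0; rewrite add0r.
have [n _ /(_ n.+1 (leqnSn n)) /=] := H _ e0.
rewrite /series /= big_nat_recl//= big1 => [|i _]; last by rewrite exprS mul0r mulr0.
by rewrite expr0 mulr1 addr0 nmBC => /ltW.
Qed.

Lemma hol_eq e s0 g h : (forall s, nm (s - s0) < e -> g s = h s) -> hol e s0 g ->
  hol e s0 h.
Proof.
move=> gh [e0 [c [cb cs]]]; split; first exact: e0.
by exists c; split; [exact: cb|move=> s hs; rewrite -(gh s hs); exact: cs].
Qed.

Lemma hol_le e e' s0 g : 0 < e' -> e' <= e -> hol e s0 g -> hol e' s0 g.
Proof.
move=> e'0 ee [e0 [c [cb cs]]]; split => //; exists c; split => [k|s hs]; last first.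
  by apply: cs; exact: lt_le_trans ee.
have ei : e^-1 <= e'^-1 by rewrite lef_pV2.
apply: le_trans (cb k) _; apply: ler_pM => //.
- by rewrite invr_ge0 ltW.
- by rewrite exprn_ge0// invr_ge0 ltW.
- by rewrite lerXn2r// nnegrE invr_ge0 ltW.
Qed.

Lemma hol_gt0 e s0 g : hol e s0 g -> 0 < e. Proof. by case. Qed.

Lemma hol_val e s0 g : hol e s0 g -> nm (g s0) <= e^-1.
Proof.
move=> [e0 [c [cb cs]]]; have := cs s0; rewrite subrr nm0 => /(_ e0) /series0_cvg ->.
by apply: le_trans (cb 0%N) _; rewrite mulr1.
Qed.

Lemma hol_cst e s0 a : 0 < e -> nm a <= e^-1 -> hol e s0 (fun=> a).
Proof.
move=> e0 ae; split => //; exists (fun k => if k is 0%N then a else 0); split.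
  case=> [|k]; first by rewrite mulr1.
  by rewrite nm0 mulr_ge0 ?exprn_ge0 ?invr_ge0 ?ltW.
move=> s _; rewrite -(cvg_shiftS _).
rewrite (_ : (fun n => _) = fun=> a); first exact: cvg_cst.
apply/funext => n; rewrite /series /= big_nat_recl//= expr0 mulr1 big1 ?addr0//.
by move=> i _; rewrite mul0r.
Qed.

Lemma hol_id e s0 : 0 < e -> e <= 1 -> nm s0 <= e^-1 -> hol e s0 id.
Proof.
move=> e0 e1 se; split => //.
have ei1 : 1 <= e^-1 by rewrite invf_ge1.
exists (fun k => if k is 0%N then s0 else if k is 1%N then 1 else 0); split.
  case=> [|[|k]]; first by rewrite mulr1.
    by rewrite nm1 mulr_ege1.
  by rewrite nm0 mulr_ge0 ?exprn_ge0 ?invr_ge0 ?ltW.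
move=> s _; rewrite -(cvg_shiftn 2).
rewrite (_ : (fun n => _) = fun=> s); first exact: cvg_cst.
apply/funext => n; rewrite /series /= addn2 big_nat_recl//= big_nat_recl//= expr0 mulr1 big1 ?addr0//.
  by rewrite mul1r addrC subrK.
by move=> i _; rewrite mul0r.
Qed.

Lemma hol_add e s0 g h : hol e s0 g -> hol e s0 h ->
  hol (e / 2) s0 (fun s => g s + h s).
Proof.
move=> [e0 [c [cb cs]]] [_ [d [db ds]]].
have e20 : 0 < e / 2 by rewrite divr_gt0.
split => //; exists (fun k => c k + d k); split => [k|s hs].
  apply: le_trans (nmD _ _) _; apply: le_trans (lerD (cb k) (db k)) _.
  have -> : (e / 2)^-1 * (e / 2)^-1 ^+ k = 2 * (e^-1 * e^-1 ^+ k) * 2 ^+ k.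
    by rewrite invfM invrK exprMn; ring.
  set x := e^-1 * _.
  have x0 : 0 <= x by rewrite mulr_ge0 ?exprn_ge0 ?invr_ge0 ?ltW.
  have p1 : 1 <= 2 ^+ k :> R by rewrite exprn_ege1// ler1n.
  by nra.
rewrite (_ : series _ = fun n => series (fun k => c k * (s - s0) ^+ k) n +
   series (fun k => d k * (s - s0) ^+ k) n); last first.
  apply/funext => n; rewrite /series /= -big_split; apply: eq_bigr => i _ /=.
  by rewrite mulrDl.
have hs' : nm (s - s0) < e by apply: lt_le_trans hs _; rewrite ler_pdivrMr// ler_peMr ?ler1n ?(ltW e0).
exact: (cvgD (cs s hs') (ds s hs')).
Qed.

Definition mul_radius e := Num.min (e ^+ 2) (e / 8).

(** The k-th coefficient of the product is at most (k + 1) e^(-k - 2); shrinking e to at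
    most e / 8 pays for k + 1 <= 2^k and for the ratio required by the Cauchy product. *)
Lemma hol_mul e s0 g h : hol e s0 g -> hol e s0 h ->
  hol (mul_radius e) s0 (fun s => g s * h s).
Proof.
move=> [e0 [c [cb cs]]] [_ [d [db ds]]]; set e' := mul_radius e.
have e'0 : 0 < e' by rewrite lt_min exprn_gt0//= divr_gt0.
have e'2 : e' <= e ^+ 2 by rewrite ge_min lexx.
have e'8 : e' <= e / 8 by rewrite ge_min lexx orbT.
have ei0 : 0 <= e^-1 by rewrite invr_ge0 ltW.
split => //; exists (fun k => \sum_(i < k.+1) c i * d (k - i)%N); split => [k|s hs].
  apply: le_trans (nm_sum _ _ _) _.
  apply: le_trans (_ : \sum_(i < k.+1) (e^-1 * e^-1 * e^-1 ^+ k) <= _).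
    apply: ler_sum => i _; apply: le_trans (nmM _ _) _.
    apply: le_trans (ler_pM (nm_ge0 _) (nm_ge0 _) (cb _) (db _)) _.
    by rewrite mulrACA -exprD subnKC// leq_ord.
  rewrite sumr_const card_ord -mulr_natr -mulrA; apply: ler_pM.
  - exact: mulr_ge0.
  - by rewrite mulr_ge0// exprn_ge0.
  - by rewrite -expr2 exprVn lef_pV2// posrE exprn_gt0.
  apply: le_trans (_ : e^-1 ^+ k * 2 ^+ k <= _).
    apply: ler_wpM2l; first exact: exprn_ge0.
    by rewrite -natrX ler_nat ltn_expl.
  have h2 : e^-1 * 2 <= e'^-1.
    rewrite -[e'^-1]mul1r ler_pdivlMr//.
    apply: le_trans (ler_wpM2l _ e'8) _; first by rewrite mulr_ge0.
    have -> : e^-1 * 2 * (e / 8) = 4^-1 by field; rewrite gt_eqF.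
    by lra.
  rewrite -exprMn; apply: lerXn2r => //; rewrite nnegrE ?mulr_ge0// invr_ge0.
  exact: ltW.
set q := nm (s - s0) / e.
have q8 : 0 <= q <= 8^-1.
  rewrite divr_ge0 ?nm_ge0 ?(ltW e0)//= ler_pdivrMr// mulrC; apply: le_trans (ltW hs) e'8.
have hs' : nm (s - s0) < e.
  by apply: lt_le_trans hs _; apply: le_trans e'8 _; rewrite ler_pdivrMr// ler_peMr ?ler1n ?(ltW e0).
have bnd (a : nat -> C) : (forall k, nm (a k) <= e^-1 * e^-1 ^+ k) ->
    forall k, nm (a k * (s - s0) ^+ k) <= e^-1 * q ^+ k.
  move=> ab k; apply: le_trans (nmM _ _) _.
  apply: le_trans (ler_pM (nm_ge0 _) (nm_ge0 _) (ab k) (nmX _ _)) _.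
  by rewrite -mulrA -exprMn /q [e^-1 * nm _]mulrC.
have := cauchy_product q8 (bnd _ cb) (bnd _ db) (cs s hs') (ds s hs').
rewrite (_ : (fun k => _) = (fun k => (\sum_(i < k.+1) c i * d (k - i)%N) * (s - s0) ^+ k))//.
apply/funext => k; rewrite mulr_suml; apply: eq_bigr => i _.
by rewrite mulrACA -exprD subnKC// leq_ord.
Qed.

Lemma hol_cexpC e s0 (A L : C) : 0 < e ->
  2 * nm A * expR (complex.Re (s0 * L) + e * nm L) <= e^-1 ->
  hol e s0 (fun s => A * cexp (s * L)).
Proof.
move=> e0 H; split => //.
exists (fun k => A * cexp (s0 * L) * (L ^+ k / k`!%:R)); split => [k|s hs].
  apply: le_trans (nmM _ _) _.
  apply: le_trans (_ : (nm A * (2 * expR (complex.Re (s0 * L)))) * (expR (e * nm L) * e^-1 ^+ k) <= _).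
    apply: ler_pM; [exact: nm_ge0|exact: nm_ge0| |exact: nm_exp_coeff_le].
    by apply: le_trans (nmM _ _) _; apply: ler_wpM2l; [exact: nm_ge0|exact: nm_cexp_le].
  rewrite mulrA; apply: ler_wpM2r; first by rewrite exprn_ge0// invr_ge0 ltW.
  apply: le_trans H; rewrite expRD le_eqVlt; apply/orP; left; apply/eqP; ring.
have -> : A * cexp (s * L) = (A * cexp (s0 * L)) * cexp ((s - s0) * L).
  by rewrite -mulrA -cexpD -mulrDl addrC subrK.
apply: cvgC_ext (cvgC_Ml (a := A * cexp (s0 * L)) (@cexp_series R ((s - s0) * L))) => n.
rewrite /series /= mulr_sumr; apply: eq_bigr => i _; rewrite exprMn; ring.
Qed.

Lemma hol_cexp e s0 (A : C) (L : R) : 0 < e ->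
  2 * nm A * expR (complex.Re s0 * L + e * `|L|) <= e^-1 ->
  hol e s0 (fun s => A * cexp (s * (L%:C : C))).
Proof. by move=> e0 H; apply: hol_cexpC => //; rewrite nm_real ReM /= mulr0 subr0. Qed.

Lemma nm_expr_cvg0 (A r : C) : nm r <= 2^-1 -> (fun n => A * r ^+ n) @ \oo --> (0 : C).
Proof.
move=> r2; apply: (cvgC_nm0 (v := fun n => nm A * 2^-1 ^+ n)); last exact: half_pow_cvg0.
move=> n; rewrite subr0; apply: le_trans (nmM _ _) _; apply: ler_wpM2l; first exact: nm_ge0.
apply: le_trans (nmX _ _) _; rewrite lerXn2r// nnegrE// ?nm_ge0//.
Qed.

(** Geometric series. *)
Lemma hol_inv s0 q : s0 != q -> exists e, hol e s0 (fun s => (s - q)^-1).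
Proof.
move=> sq; set d := (s0 - q)^-1; have d0 : s0 - q != 0 by rewrite subr_eq0.
set r := nm d; have r0 : 0 < r by apply: nm_gt0; rewrite invr_eq0.
exists (2 * r)^-1; have e0 : 0 < (2 * r)^-1 by rewrite invr_gt0 mulr_gt0.
split => //; exists (fun k => (-1) ^+ k * d ^+ k.+1); split => [k|s hs].
  apply: le_trans (nmM _ _) _; rewrite invrK -exprS.
  apply: le_trans (_ : 1 * r ^+ k.+1 <= _).
    apply: ler_pM; rewrite ?nm_ge0//; last exact: nmX.
    by apply: le_trans (nmX _ _) _; rewrite nmN nm1 expr1n.
  by rewrite mul1r lerXn2r// ?nnegrE ?mulr_ge0// ?(ltW r0)// ler_peMl ?(ltW r0)// ler1n.
set x := - (s - s0) * d.
have x2 : nm x <= 2^-1.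
  apply: le_trans (nmM _ _) _; rewrite nmN -/r.
  apply: le_trans (ler_wpM2r (ltW r0) (ltW hs)) _.
  by rewrite invfM -mulrA mulVf ?mulr1// gt_eqF.
have x1 : 1 - x != 0.
  rewrite subr_eq0; apply/negP => /eqP x1; move: x2; rewrite -x1 nm1.
  by apply/negP; rewrite -ltNge invf_lt1// ltr1n.
have xE : (1 - x) * (s0 - q) = s - q.
  rewrite /x mulNr opprK mulrDl mul1r -mulrA mulVf// mulr1; ring.
have sq0 : s - q != 0 by rewrite -xE mulf_neq0.
have psum n : series (fun k => (-1) ^+ k * d ^+ k.+1 * (s - s0) ^+ k) n =
    (s - q)^-1 - (s - q)^-1 * x ^+ n.
  elim: n => [|n IH]; first by rewrite /series /= big_nil expr0 mulr1 subrr.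
  rewrite [LHS](_ : _ = series (fun k => (-1) ^+ k * d ^+ k.+1 * (s - s0) ^+ k) n +
    (-1) ^+ n * d ^+ n.+1 * (s - s0) ^+ n); last by rewrite /series /= big_nat_recr.
  rewrite IH [x ^+ n.+1]exprS.
  have -> : (-1) ^+ n * d ^+ n.+1 * (s - s0) ^+ n = d * x ^+ n.
    by rewrite (_ : x = (-1) * (d * (s - s0))) ?exprMn ?exprS; rewrite /x; ring.
  have -> : d = (s - q)^-1 * (1 - x) by rewrite -xE invfM [in RHS]mulrC mulrA mulfV// mul1r.
  by ring.
rewrite -[X in _ --> X]subr0 (_ : series _ = fun n => (s - q)^-1 - (s - q)^-1 * x ^+ n); last exact/funext.
exact: (cvgB (cvg_cst _) (nm_expr_cvg0 _ x2)).
Qed.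

Lemma hol_lip e s0 g s : hol e s0 g -> nm (s - s0) <= e / 2 ->
  nm (g s - g s0) <= 2 * e^-1 ^+ 2 * nm (s - s0).
Proof.
move=> [e0 [c [cb cs]]] hs; have ei0 : 0 <= e^-1 by rewrite invr_ge0 ltW.
have hs' : nm (s - s0) < e.
  by apply: le_lt_trans hs _; rewrite ltr_pdivrMr// ltr_pMr// ltr1n.
have g0 : g s0 = c 0%N by have := cs s0; rewrite subrr nm0 => /(_ e0) /series0_cvg.
have cv := cvgC_Br (a := g s0) (@cvgC_shift 1 _ _ (cs s hs')).
apply: (cvgC_nm_le cv) => n.
rewrite addn1 /series /= big_nat_recl//= expr0 mulr1 g0 addrAC subrr add0r.
apply: le_trans (nm_sum _ _ _) _.
set q := nm (s - s0) / e.
have q2 : 0 <= q <= 2^-1.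
  by rewrite divr_ge0 ?nm_ge0 ?(ltW e0)//= ler_pdivrMr// mulrC.
apply: le_trans (_ : \sum_(0 <= i < n) (e^-1 * q) * q ^+ i <= _).
  apply: ler_sum => i _; apply: le_trans (nmM _ _) _.
  apply: le_trans (ler_pM (nm_ge0 _) (nm_ge0 _) (cb _) (nmX _ _)) _.
  by rewrite -2!mulrA -exprMn -exprS /q [e^-1 * nm _]mulrC.
rewrite -mulr_sumr.
apply: le_trans (ler_wpM2l _ (sum_geo_le n q2)) _.
  by case/andP: q2 => ? _; exact: mulr_ge0.
by rewrite /q le_eqVlt; apply/orP; left; apply/eqP; ring.
Qed.

(** The first nonzero coefficient is the order of vanishing. *)
Lemma hol_factor e s0 h : hol e s0 h ->
  (forall s, nm (s - s0) < e -> h s = 0) \/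
  exists k g e', [/\ hol e' s0 g, g s0 != 0 &
    forall s, nm (s - s0) < e -> h s = (s - s0) ^+ k * g s].
Proof.
move=> [e0 [c [cb cs]]].
have [[k ck]|nk] := pselect (exists k, c k != 0); last first.
  left => s hs; apply/esym; have := cs s hs.
  rewrite (_ : series _ = fun=> 0).
    by move=> H; apply: (cvg_unique _ (cvg_cst (0 : C)) H).
  apply/funext => n; rewrite /series /= big1// => i _.
  have [->|ci] := eqVneq (c i) 0; first by rewrite mul0r.
  by case: nk; exists i.
right; have ex : exists k, c k != 0 by exists k.
case: (ex_minnP ex) => {}k {}ck kmin {ex}.
exists k; pose g s := if s == s0 then c k else h s / (s - s0) ^+ k; exists g.
exists (Num.min e (e ^+ k.+1)).
have e'0 : 0 < Num.min e (e ^+ k.+1) by rewrite lt_min e0 exprn_gt0.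
split; last 2 first.
- by rewrite /g eqxx.
- move=> s hs; rewrite /g; case: eqVneq => [->|ss0]; last first.
    by rewrite mulrC divfK// expf_neq0// subr_eq0.
  rewrite subrr; have := cs s0; rewrite subrr nm0 => /(_ e0) /series0_cvg ->.
  case: k {e'0 g} ck kmin => [_ _|k ck kmin]; first by rewrite expr0 mul1r.
  rewrite exprS mul0r mul0r; apply/eqP; apply: contraT => /kmin.
  by rewrite ltn0.
split => //; exists (fun j => c (j + k)%N); split => [j|s].
  apply: le_trans (cb _) _; rewrite addnC exprD mulrA -exprS.
  apply: ler_pM.
  - by rewrite exprn_ge0// invr_ge0 ltW.
  - by rewrite exprn_ge0// invr_ge0 ltW.
  - rewrite exprVn lef_pV2// ?posrE ?exprn_gt0//.
    by rewrite ge_min lexx orbT.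
  - rewrite lerXn2r ?nnegrE ?invr_ge0 ?(ltW e0) ?(ltW e'0)// lef_pV2//.
    by rewrite ge_min lexx.
rewrite lt_min => /andP[hs _]; rewrite /g; case: eqVneq => [->|ss0].
  rewrite subrr -(cvg_shiftS _).
  rewrite (_ : (fun n => _) = fun=> c k); first exact: cvg_cst.
  apply/funext => n; rewrite /series /= big_nat_recl//= expr0 mulr1 big1 ?addr0//.
  by move=> i _; rewrite exprS mul0r mulr0.
have sk0 : (s - s0) ^+ k != 0 by rewrite expf_neq0// subr_eq0.
have cv := @cvgC_shift k _ _ (cs s hs).
rewrite mulrC; apply: cvgC_ext (cvgC_Ml (a := ((s - s0) ^+ k)^-1) cv) => n; rewrite mulrC /series /=.
rewrite addnC (big_cat_nat (n:=k)) ?leq_addr//= big_nat big1 ?add0r.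
  rewrite -{1}[k]add0n big_addn addnC addnK mulr_suml; apply: eq_bigr => i _.
  by rewrite exprD mulrA mulfK.
move=> i /andP[_ ik].
have [->|/kmin] := eqVneq (c i) 0; first by rewrite mul0r.
by rewrite leqNgt ik.
Qed.

Lemma hol_analytic1 e s0 g : hol e s0 g -> analytic1_at g s0.
Proof.
move=> [e0 [c [cb cs]]]; exists c; apply/nbhsCP; exists e; [exact: e0|exact: cs].
Qed.

(** Convergence at one point of the disc bounds the terms of the series there, hence
    gives Cauchy bounds for a smaller radius. *)
Lemma analytic1_hol s0 g : analytic1_at g s0 -> exists e, hol e s0 g.
Proof.
move=> [a /nbhsCP[r r0 H]].
pose d := r / 2; have d0 : 0 < d by rewrite divr_gt0.
have dr : d < r by rewrite ltr_pdivrMr// ltr_pMr// ltr1n.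
have [B BP] : exists B : R, forall k, nm (a k) <= B * d^-1 ^+ k.
  have nd : nm ((s0 + d%:C) - s0) < r by rewrite addrAC subrr add0r nm_real gtr0_norm.
  have := H _ nd; rewrite addrAC subrr add0r => cv.
  have /cvgCP/(_ 1 ltr01)[N _ NP] := cv.
  have t1 k : (N <= k)%N -> nm (a k) * d ^+ k <= 2.
    move=> Nk; have h1 := NP k Nk; have h2 := NP k.+1 (leqW Nk).
    have -> : nm (a k) * d ^+ k = nm (a k * d%:C ^+ k).
      by rewrite -rmorphXn mulrC [in RHS]mulrC nmMr ger0_norm// exprn_ge0// ltW.
    move: h2; rewrite /= /series /= big_nat_recr//= => h2.
    set x := \sum_(0 <= k0 < k) _ in h1 h2 *; set y := a k * _ in h2 *.
    rewrite (_ : y = (x + y - g (s0 + d%:C)) - (x - g (s0 + d%:C))); last by ring.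
    by apply: le_trans (nmB _ _) _; rewrite (_ : 2 = 1 + 1)// lerD// ltW.
  exists (2 + \sum_(0 <= i < N) nm (a i) * d ^+ i) => k.
  rewrite exprVn ler_pdivlMr ?exprn_gt0//.
  have [kN|Nk] := ltnP k N; last first.
    apply: le_trans (t1 _ Nk) _; rewrite lerDl sumr_ge0// => i _.
    by rewrite mulr_ge0 ?nm_ge0// exprn_ge0// ltW.
  apply: le_trans (_ : \sum_(0 <= i < N) nm (a i) * d ^+ i <= _); last by rewrite lerDr.
  rewrite big_mkord (bigD1 (Ordinal kN))//= lerDl sumr_ge0// => i _.
  by rewrite mulr_ge0 ?nm_ge0// exprn_ge0// ltW.
have B0 : 0 <= B by have := le_trans (nm_ge0 _) (BP 0%N); rewrite mulr1.
exists (Num.min d (B + 1)^-1).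
have e0 : 0 < Num.min d (B + 1)^-1 by rewrite lt_min d0 invr_gt0 ltr_pwDr.
split => //; exists a; split => [k|s hs]; last first.
  by apply: H; apply: lt_trans dr; move: hs; rewrite lt_min => /andP[].
apply: le_trans (BP k) _; apply: ler_pM => //.
- by rewrite exprn_ge0// invr_ge0 ltW.
- apply: (@le_trans _ _ (B + 1)); first by rewrite lerDl.
  by rewrite -{1}[B + 1]invrK lef_pV2 ?posrE ?invr_gt0 ?ltr_pwDr// ge_min lexx orbT.
- rewrite lerXn2r ?nnegrE ?invr_ge0 ?(ltW d0) ?(ltW e0)// lef_pV2//.
  by rewrite ge_min lexx.
Qed.

End Holomorphic.

(** * Complex integrals of bounded measurable functions *)

Section ComplexIntegral.
Context {R : realType} d (T : measurableType d) (mu : {measure set T -> \bar R})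
  (D : set T).
Local Notation C := (cplx R).
Implicit Types (f g : T -> C) (h : T -> R).

Definition cint f : C :=
  Rintegral mu D (fun t => complex.Re (f t)) +i* Rintegral mu D (fun t => complex.Im (f t)).

(** Bounded measurable functions. The complex numbers carry no measurable structure
    here, hence the two parts. *)
Definition bmf f := [/\ measurable_fun D (fun t => complex.Re (f t)),
  measurable_fun D (fun t => complex.Im (f t)) &
  exists B, forall t, D t -> nm (f t) <= B].

Lemma eq_bmf f g : (forall t, D t -> f t = g t) -> bmf f -> bmf g.
Proof.
move=> fg [m1 m2 [B fB]]; split.
- by apply: eq_measurable_fun m1 => t; rewrite inE => /fg ->.
- by apply: eq_measurable_fun m2 => t; rewrite inE => /fg ->.
- by exists B => t Dt; rewrite -fg//; exact: fB.
Qed.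

Lemma eq_cint f g : (forall t, D t -> f t = g t) -> cint f = cint g.
Proof.
move=> fg; apply: cplxP => /=; apply: eq_Rintegral => t; rewrite inE => /fg ->//.
Qed.

Lemma bmf_cst a : bmf (fun=> a).
Proof. by split; [exact: measurable_cst|exact: measurable_cst|exists (nm a)]. Qed.

Lemma bmfD f g : bmf f -> bmf g -> bmf (fun t => f t + g t).
Proof.
move=> [f1 f2 [B fB]] [g1 g2 [B' gB]]; split.
- by under eq_fun do rewrite ReD; exact: measurable_funD.
- by under eq_fun do rewrite ImD; exact: measurable_funD.
- by exists (B + B') => t Dt; apply: le_trans (nmD _ _) _; rewrite lerD ?fB ?gB.
Qed.

Lemma bmfM f g : bmf f -> bmf g -> bmf (fun t => f t * g t).
Proof.
move=> [f1 f2 [B fB]] [g1 g2 [B' gB]]; split.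
- by under eq_fun do rewrite ReM; apply: measurable_funB; exact: measurable_funM.
- by under eq_fun do rewrite ImM; apply: measurable_funD; exact: measurable_funM.
- exists (B * B') => t Dt; apply: le_trans (nmM _ _) _.
  by apply: ler_pM; rewrite ?nm_ge0 ?fB ?gB.
Qed.

Lemma bmfMl a f : bmf f -> bmf (fun t => a * f t).
Proof. by apply: bmfM; exact: bmf_cst. Qed.

Lemma bmfN f : bmf f -> bmf (fun t => - f t).
Proof. by move=> /(bmfMl (-1)); apply: eq_bmf => t _; rewrite mulN1r. Qed.

Lemma bmfB f g : bmf f -> bmf g -> bmf (fun t => f t - g t).
Proof. by move=> bf /bmfN; exact: bmfD. Qed.

Lemma bmf_sum (I : Type) (r : seq I) (F : I -> T -> C) :
  (forall i, bmf (F i)) -> bmf (fun t => \sum_(i <- r) F i t).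
Proof.
move=> bF; elim: r => [|i r IH].
  by under eq_fun do rewrite big_nil; exact: bmf_cst.
by under eq_fun do rewrite big_cons; exact: bmfD.
Qed.

Hypotheses (mD : measurable D) (muD : (mu D < +oo)%E).

Lemma bounded_integrable h (B : R) : measurable_fun D h ->
  (forall t, D t -> `|h t| <= B) -> mu.-integrable D (EFin \o h).
Proof.
move=> mh hB; apply: measurable_bounded_integrable => //.
exists B; split; first by rewrite num_real.
by move=> x Bx t Dt; apply: le_trans (hB _ Dt) _; exact: ltW.
Qed.

Lemma bmf_Re f : bmf f -> mu.-integrable D (EFin \o (fun t => complex.Re (f t))).
Proof.
by case=> m1 _ [B fB]; apply: (bounded_integrable m1 (B := B)) => t Dt; apply: le_trans (Re_le_nm _) (fB _ Dt).
Qed.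

Lemma bmf_Im f : bmf f -> mu.-integrable D (EFin \o (fun t => complex.Im (f t))).
Proof.
by case=> _ m1 [B fB]; apply: (bounded_integrable m1 (B := B)) => t Dt; apply: le_trans (Im_le_nm _) (fB _ Dt).
Qed.

Lemma cintD f g : bmf f -> bmf g -> cint (fun t => f t + g t) = cint f + cint g.
Proof.
move=> bf bg; apply: cplxP; rewrite ?ReD ?ImD /=.
- under eq_Rintegral do rewrite ReD.
  by apply: RintegralD => //; exact: bmf_Re.
- under eq_Rintegral do rewrite ImD.
  by apply: RintegralD => //; exact: bmf_Im.
Qed.

Lemma RintegralMl h (r : R) : mu.-integrable D (EFin \o h) ->
  Rintegral mu D (fun t => r * h t) = r * Rintegral mu D h.
Proof. by move=> ih; rewrite RintegralZl. Qed.

Lemma integrableMl h (r : R) : mu.-integrable D (EFin \o h) ->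
  mu.-integrable D (EFin \o (fun t => r * h t)).
Proof. by move=> /(integrableZl mD r); apply: eq_integrable => // t _; rewrite /= EFinM. Qed.

Lemma cintMl a f : bmf f -> cint (fun t => a * f t) = a * cint f.
Proof.
move=> bf; have bR := bmf_Re bf; have bI := bmf_Im bf.
apply: cplxP; rewrite ?ReM ?ImM /=.
- under eq_Rintegral do rewrite ReM.
  by rewrite RintegralB ?RintegralMl//; exact: integrableMl.
- under eq_Rintegral do rewrite ImM.
  by rewrite RintegralD ?RintegralMl//; exact: integrableMl.
Qed.

Lemma cintB f g : bmf f -> bmf g -> cint (fun t => f t - g t) = cint f - cint g.
Proof.
move=> bf bg; rewrite -[- cint g]mulN1r -cintMl// -cintD//; last exact: bmfMl.
by apply: eq_cint => t _; rewrite mulN1r.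
Qed.

Lemma cint_sum (I : Type) (r : seq I) (F : I -> T -> C) :
  (forall i, bmf (F i)) -> cint (fun t => \sum_(i <- r) F i t) = \sum_(i <- r) cint (F i).
Proof.
move=> bF; elim: r => [|i r IH].
  rewrite big_nil -[RHS](mul0r (cint (fun=> 0))) -cintMl; last exact: bmf_cst.
  by apply: eq_cint => t _; rewrite big_nil mul0r.
rewrite big_cons -IH -cintD//; last exact: bmf_sum.
by apply: eq_cint => t _; rewrite big_cons.
Qed.

Lemma nm_cint_le f (B : R) : bmf f -> (forall t, D t -> nm (f t) <= B) ->
  nm (cint f) <= B * fine (mu D).
Proof.
move=> bf fB; rewrite -Rintegral_cst// /nm /=.
have bR := bmf_Re bf; have bI := bmf_Im bf.
have iN h : mu.-integrable D (EFin \o h) -> mu.-integrable D (EFin \o (fun t => `|h t|)).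
  by move=> ih; have := integrable_abse ih; apply: eq_integrable.
apply: le_trans (lerD (le_normr_Rintegral mD bR) (le_normr_Rintegral mD bI)) _.
rewrite -RintegralD//; [|exact: iN|exact: iN].
apply: le_Rintegral => //.
- apply: (@bounded_integrable _ B).
    by apply: measurable_funD; apply: measurableT_comp => //; case: bf.
  by move=> t Dt; rewrite ger0_norm ?addr_ge0//; exact: fB.
- by apply: (@bounded_integrable _ `|B|) => //.
Qed.

End ComplexIntegral.

Section HolomorphicIntegral.
Context {R : realType} d (T : measurableType d) (mu : {measure set T -> \bar R})
  (D : set T).
Local Notation C := (cplx R).
Hypotheses (mD : measurable D) (muD : (mu D < +oo)%E) (muD1 : fine (mu D) <= 1).

Lemma hol_tail (e : R) (s0 : C) (g : C -> C) (c : nat -> C) : 0 < e ->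
  (forall k, nm (c k) <= e^-1 * e^-1 ^+ k) ->
  (forall s, nm (s - s0) < e -> series (fun k => c k * (s - s0) ^+ k) @ \oo --> g s) ->
  forall s k, nm (s - s0) <= e / 2 ->
  nm (g s - series (fun j => c j * (s - s0) ^+ j) k) <= 2 * e^-1 * (nm (s - s0) / e) ^+ k.
Proof.
move=> e0 cb cs s k hs; have ei0 : 0 <= e^-1 by rewrite invr_ge0 ltW.
have hs' : nm (s - s0) < e.
  by apply: le_lt_trans hs _; rewrite ltr_pdivrMr// ltr_pMr// ltr1n.
set x := series _ k.
have cv := cvgC_Br (a := x) (@cvgC_shift _ k _ _ (cs s hs')).
apply: (cvgC_nm_le cv) => n.
rewrite /x /series /= addnC (big_cat_nat (n := k)) ?leq_addr//= addrAC subrr add0r.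
apply: le_trans (nm_sum _ _ _) _.
set q := nm (s - s0) / e.
have q2 : 0 <= q <= 2^-1.
  by rewrite divr_ge0 ?nm_ge0 ?(ltW e0)//= ler_pdivrMr// mulrC.
rewrite -{1}[k]add0n big_addn addnC addnK.
apply: le_trans (_ : \sum_(0 <= i < n) (e^-1 * q ^+ k) * q ^+ i <= _).
  apply: ler_sum => i _; apply: le_trans (nmM _ _) _.
  apply: le_trans (ler_pM (nm_ge0 _) (nm_ge0 _) (cb _) (nmX _ _)) _.
  by rewrite -2!mulrA -exprMn -exprD addnC /q [e^-1 * nm _]mulrC.
rewrite -mulr_sumr.
apply: le_trans (ler_wpM2l _ (sum_geo_le n q2)) _.
  by case/andP: q2 => ? _; rewrite mulr_ge0// exprn_ge0.
by rewrite le_eqVlt; apply/orP; left; apply/eqP; ring.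
Qed.

Lemma bmf_lim (F : nat -> T -> C) (f : T -> C) (B : R) :
  (forall n, bmf D (F n)) -> (forall t, D t -> nm (f t) <= B) ->
  (forall t, D t -> (fun n => F n t) @ \oo --> f t) -> bmf D f.
Proof.
move=> bF fB Ff; split; last by exists B.
- apply: (measurable_fun_cvg (h := fun n t => complex.Re (F n t))).
    by move=> n; case: (bF n).
  by move=> t Dt; exact: cvgC_Re (Ff t Dt).
- apply: (measurable_fun_cvg (h := fun n t => complex.Im (F n t))).
    by move=> n; case: (bF n).
  by move=> t Dt; exact: cvgC_Im (Ff t Dt).
Qed.

(** The series may be integrated term by term. That its coefficients are measurable in t
    is seen by recovering the k-th one as a limit of divided remainders, knowing the
    previous ones. *)
Lemma hol_cint (e : R) (s0 : C) (g : C -> T -> C) : 0 < e ->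
  (forall t, D t -> hol e s0 (fun s => g s t)) ->
  (forall s, nm (s - s0) < e -> bmf D (g s)) ->
  hol (e / 2) s0 (fun s => cint mu D (g s)).
Proof.
move=> e0 gh gm; have ei0 : 0 <= e^-1 by rewrite invr_ge0 ltW.
have [c cP] : exists c : T -> nat -> C, forall t, D t ->
    (forall k, nm (c t k) <= e^-1 * e^-1 ^+ k) /\
    (forall s, nm (s - s0) < e -> series (fun k => c t k * (s - s0) ^+ k) @ \oo --> g s t).
  have ch t : exists c : nat -> C, D t -> (forall k, nm (c k) <= e^-1 * e^-1 ^+ k) /\
    (forall s, nm (s - s0) < e -> series (fun k => c k * (s - s0) ^+ k) @ \oo --> g s t).
    have [Dt|nDt] := pselect (D t); last by exists (fun=> 0).
    by have [_ [c cP]] := gh t Dt; exists c.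
  have [c cP] := choice ch; exists c; exact: cP.
(* the k-th coefficient is recovered from the values at s0 + h n as n grows *)
pose h n : R := e / 2 * 2^-1 ^+ n.
have h0 n : 0 < h n by rewrite mulr_gt0 ?divr_gt0// exprn_gt0.
have he n : h n <= e / 2.
  by rewrite /h ler_piMr ?divr_ge0 ?(ltW e0)// exprn_ile1// invf_le1// ler1n.
have e2e : e / 2 < e by rewrite ltr_pdivrMr// ltr_pMr// ltr1n.
have bc k : bmf D (fun t => c t k).
  elim/ltn_ind: k => k IH.
  pose F n t := (((h n)^-1 ^+ k)%:C : C) *
    (g (s0 + (h n)%:C) t - \sum_(0 <= j < k) (((h n) ^+ j)%:C : C) * c t j).
  apply: (@bmf_lim F _ (e^-1 * e^-1 ^+ k)).
  - move=> n; apply: bmfMl; apply: bmfB.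
      apply: gm; rewrite addrAC subrr add0r nm_real gtr0_norm//.
      exact: le_lt_trans (he n) e2e.
    pose G (j : nat) t : C := if (j < k)%N then (((h n) ^+ j)%:C : C) * c t j else 0.
    apply: (@eq_bmf _ _ _ _ (fun t => \sum_(j <- index_iota 0 k) G j t)).
      by move=> t _; apply: eq_big_nat => j /andP[_ jk]; rewrite /G jk.
    apply: (@bmf_sum _ _ _ _ _ _ G) => j; rewrite /G; case jk: (j < k)%N; last exact: bmf_cst.
    by apply: bmfMl; exact: IH.
  - by move=> t Dt; case: (cP t Dt).
  - move=> t Dt; have [cb cs] := cP t Dt.
    apply: (cvgC_nm0 (v := fun n => (2 * e^-1 * e^-1 ^+ k.+1 * (e / 2)) * 2^-1 ^+ n)); last first.
      exact: half_pow_cvg0.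
    move=> n; have hn : nm ((s0 + (h n)%:C) - s0) <= e / 2.
      by rewrite addrAC subrr add0r nm_real gtr0_norm.
    have := hol_tail e0 cb cs k.+1 hn.
    rewrite addrAC subrr add0r nm_real gtr0_norm//.
    rewrite [series _ _]/series /= big_nat_recr//= => H.
    rewrite (_ : F n t - c t k = (((h n)^-1 ^+ k)%:C : C) * (g (s0 + (h n)%:C) t -
      (\sum_(0 <= j < k) c t j * (h n)%:C ^+ j + c t k * (h n)%:C ^+ k))); last first.
      rewrite /F opprD addrA [in RHS]mulrBr; congr (_ * (_ - _) - _).
        by apply: eq_bigr => j _; rewrite rmorphXn mulrC.
      rewrite mulrCA -rmorphXn -rmorphM -exprMn mulVf ?gt_eqF// expr1n mulr1//.
    rewrite nmMr ger0_norm; last by rewrite exprn_ge0// invr_ge0 ltW.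
    apply: le_trans (ler_wpM2l _ H) _; first by rewrite exprn_ge0// invr_ge0 ltW.
    rewrite exprMn exprVn -[X in _ <= X * _]mulrA /h -/(h n) le_eqVlt; apply/orP; left; apply/eqP.
    have hk : h n ^+ k != 0 by rewrite expf_neq0// gt_eqF.
    rewrite (_ : h n ^+ k.+1 = h n ^+ k * (e / 2 * 2^-1 ^+ n)); last by rewrite exprSr.
    set u := e^-1 ^+ _; set v := 2^-1 ^+ n; set w := h n ^+ k.
    transitivity ((w^-1 * w) * (2 / e * (u * (e / 2)) * v)); first by ring.
    by rewrite mulVf// mul1r.
split; first by rewrite divr_gt0.
exists (fun k => cint mu D (fun t => c t k)); split => [k|s hs].
  apply: le_trans (_ : e^-1 * e^-1 ^+ k <= _).
    have cb t : D t -> nm (c t k) <= e^-1 * e^-1 ^+ k by move=> Dt; case: (cP t Dt).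
    apply: le_trans (nm_cint_le mD muD (bc k) cb) _.
    by rewrite ler_piMr// mulr_ge0 ?exprn_ge0.
  have i2 : e^-1 <= (e / 2)^-1 by rewrite lef_pV2 ?posrE ?divr_gt0// ltW.
  have i20 : 0 <= (e / 2)^-1 by rewrite invr_ge0 divr_ge0// ltW.
  by apply: ler_pM; rewrite ?exprn_ge0// lerXn2r// nnegrE.
have hs' : nm (s - s0) < e by exact: lt_trans e2e.
apply: (cvgC_nm0 (v := fun n => (2 * e^-1) * 2^-1 ^+ n)); last exact: half_pow_cvg0.
move=> n; rewrite nmBC.
have -> : series (fun k => cint mu D (c^~ k) * (s - s0) ^+ k) n =
    cint mu D (fun t => series (fun k => c t k * (s - s0) ^+ k) n).
  rewrite /series /= cint_sum//; last by move=> i; apply: bmfM; [exact: bc|exact: bmf_cst].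
  by apply: eq_bigr => i _; rewrite mulrC -cintMl//; apply: eq_cint => t _; rewrite mulrC.
rewrite -cintB//; last 2 first.
- exact: gm.
- by rewrite /series /=; apply: bmf_sum => i; apply: bmfM; [exact: bc|exact: bmf_cst].
apply: (@le_trans _ _ ((2 * e^-1 * 2^-1 ^+ n) * fine (mu D))).
apply: nm_cint_le => //.
- by apply: bmfB; [exact: gm|rewrite /series /=; apply: bmf_sum => i; apply: bmfM; [exact: bc|exact: bmf_cst]].
- move=> t Dt; have [cb cs] := cP t Dt.
  apply: le_trans (hol_tail e0 cb cs n (ltW hs)) _.
  apply: ler_wpM2l; first exact: mulr_ge0.
  apply: lerXn2r; rewrite ?nnegrE ?divr_ge0 ?nm_ge0 ?(ltW e0)//.
  by rewrite ler_pdivrMr// mulrC ltW.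
- by rewrite ler_piMr// mulr_ge0 ?exprn_ge0 ?mulr_ge0.
Qed.

End HolomorphicIntegral.

(** * Smooth families on the cube *)

Section SmoothFamilies.
Context {R : realType}.
Local Notation C := (cplx R).
Local Notation fam := (C -> (nat -> R) -> C).
Implicit Types (G H : fam) (y : nat -> R) (s : C) (i N : nat) (t u : R).

Definition cube y := forall i, 0 <= y i <= 1.
Definition upd y i u : nat -> R := fun j => if j == i then u else y j.
Definition scons t y : nat -> R := fun j => if j is j'.+1 then y j' else t.

Lemma cube_upd y i u : cube y -> 0 <= u <= 1 -> cube (upd y i u).
Proof. by move=> cy u01 j; rewrite /upd; case: ifP. Qed.

Lemma cube_scons y t : cube y -> 0 <= t <= 1 -> cube (scons t y).
Proof. by move=> cy t01 [|j] /=. Qed.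

Lemma scons_upd t y i u : scons t (upd y i u) = upd (scons t y) i.+1 u.
Proof. by apply/funext => -[|j]. Qed.

Lemma upd_scons0 t y u : upd (scons t y) 0 u = scons u y.
Proof. by apply/funext => -[|j]. Qed.

Variable Om : set C.

(** One radius for all points of the cube is what integration over a variable needs. *)
Definition hol_unif G := forall s0, Om s0 -> exists e, forall y, cube y -> hol e s0 (G^~ y).

(** G' is the partial derivative in the i-th variable, but only the expansion is
    recorded: a quadratic remainder uniform on the cube passes through integrals and
    makes sense on the boundary. *)
Definition quad_diff i G G' := forall s, Om s -> exists K : R, forall y u, cube y -> 0 <= u <= 1 ->
  nm (G s (upd y i u) - G s y - (u - y i)%:C * G' s y) <= K * (u - y i) ^+ 2.

(** Each integration by parts in a variable uses up one of the N derivatives. *)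
Fixpoint smooth N G : Prop := match N with
  | 0 => hol_unif G
  | N'.+1 => hol_unif G /\ forall i, exists G', smooth N' G' /\ quad_diff i G G'
  end.

Let cube0 : cube (fun=> 0). Proof. by move=> i; rewrite lexx ler01. Qed.

Lemma smooth_hol_unif N G : smooth N G -> hol_unif G.
Proof. by case: N => // N []. Qed.

Lemma smooth_der N G i : smooth N.+1 G -> exists G', smooth N G' /\ quad_diff i G G'.
Proof. by case. Qed.

Lemma smooth_pred N G : smooth N.+1 G -> smooth N G.
Proof.
elim: N G => [|N IH] G; first by case.
move=> [hG dG]; split; first exact: hG.
by move=> i; have [G' [sG' dqG]] := dG i; exists G'; split => //; exact: IH.
Qed.

Lemma smooth_le N N' G : (N' <= N)%N -> smooth N G -> smooth N' G.
Proof.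
elim: N => [|N IH]; first by rewrite leqn0 => /eqP ->.
rewrite leq_eqVlt => /predU1P[->//|]; rewrite ltnS => /IH H /smooth_pred; exact: H.
Qed.

Lemma hol_unif_ext G H : (forall s y, cube y -> G s y = H s y) -> hol_unif G -> hol_unif H.
Proof.
move=> GH hG s0 Os; have [e eP] := hG s0 Os; exists e => y cy.
by apply: hol_eq (eP y cy) => s _; rewrite GH.
Qed.

Lemma smooth_ext N G H : (forall s y, cube y -> G s y = H s y) -> smooth N G -> smooth N H.
Proof.
case: N => [|N] GH; first exact: hol_unif_ext.
move=> [hG dG]; split; first exact: hol_unif_ext hG.
move=> i; have [G' [sG' dqG]] := dG i; exists G'; split => // s Os.
have [K KP] := dqG s Os; exists K => y u cy u01.
by rewrite -!GH//; [exact: KP|exact: cube_upd].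
Qed.

Lemma hol_unif_bound G s : hol_unif G -> Om s -> exists2 B : R, 0 <= B & forall y, cube y -> nm (G s y) <= B.
Proof.
move=> hG Os; have [e eP] := hG s Os; exists e^-1 => [|y cy]; last exact: hol_val (eP y cy).
by rewrite invr_ge0 ltW// (hol_gt0 (eP _ cube0)).
Qed.

Lemma quad_diff_ge0 i G G' s : quad_diff i G G' -> Om s -> exists2 K : R, 0 <= K & forall y u, cube y -> 0 <= u <= 1 ->
  nm (G s (upd y i u) - G s y - (u - y i)%:C * G' s y) <= K * (u - y i) ^+ 2.
Proof.
move=> dG Os; have [K KP] := dG s Os; exists `|K| => // y u cy u01.
by apply: le_trans (KP y u cy u01) _; rewrite ler_wpM2r ?sqr_ge0 ?ler_norm.
Qed.

Lemma quad_diff_lip i G G' s : hol_unif G' -> quad_diff i G G' -> Om s ->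
  exists2 K : R, 0 <= K & forall y u, cube y -> 0 <= u <= 1 ->
  nm (G s (upd y i u) - G s y) <= K * `|u - y i|.
Proof.
move=> hG' dG Os; have [B B0 BP] := hol_unif_bound hG' Os; have [K K0 KP] := quad_diff_ge0 dG Os.
exists (K + B) => [|y u cy u01]; first exact: addr_ge0.
set x := _ - _; rewrite -[x](subrK ((u - y i)%:C * G' s y)).
apply: le_trans (nmD _ _) _; rewrite nmMr mulrDl; apply: lerD; last first.
  by rewrite mulrC; apply: ler_wpM2r => //; exact: BP.
apply: le_trans (KP y u cy u01) _; apply: ler_wpM2l => //.
rewrite -real_normK ?num_real// expr2 ler_piMr//.
by rewrite ler_norml; have /andP[] := cy i; case/andP: u01; lra.
Qed.

Lemma hol_unif_sfun (g : C -> C) : (forall s, Om s -> exists e, hol e s g) -> hol_unif (fun s _ => g s).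
Proof. by move=> hg s0 /hg[e eP]; exists e => y _. Qed.

Lemma hol_unif_cst (a : C) : hol_unif (fun _ _ => a).
Proof.
apply: hol_unif_sfun => s _; exists (nm a + 1)^-1; apply: hol_cst; last by rewrite invrK lerDl.
by rewrite invr_gt0 ltr_wpDl ?nm_ge0.
Qed.

Lemma smooth_sfun N (g : C -> C) : (forall s, Om s -> exists e, hol e s g) -> smooth N (fun s _ => g s).
Proof.
move=> hg; case: N => [|N]; first exact: hol_unif_sfun.
split=> [|i]; first exact: hol_unif_sfun.
exists (fun _ _ => 0); split; last by exists 0 => y u _ _; rewrite mulr0 subr0 subrr nm0 mul0r.
elim: N => [|N IH]; first exact: hol_unif_cst.
split=> [|j]; first exact: hol_unif_cst.
exists (fun _ _ => 0); split; first exact: IH.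
by exists 0 => y u _ _; rewrite mulr0 subr0 subrr nm0 mul0r.
Qed.

Lemma smooth_cst N (a : C) : smooth N (fun _ _ => a).
Proof.
apply: smooth_sfun => s _; exists (nm a + 1)^-1; apply: hol_cst; last by rewrite invrK lerDl.
by rewrite invr_gt0 ltr_wpDl ?nm_ge0.
Qed.

Lemma smooth_id N : smooth N (fun s _ => s).
Proof.
apply: smooth_sfun => s _; exists (nm s + 1)^-1; apply: hol_id.
- by rewrite invr_gt0 ltr_wpDl ?nm_ge0.
- by rewrite invf_le1 ?lerDr ?nm_ge0// ltr_wpDl ?nm_ge0.
- by rewrite invrK lerDl.
Qed.

Lemma smooth_coord N i : smooth N (fun _ y => (y i)%:C).
Proof.
have hc : hol_unif (fun _ y => (y i)%:C).
  move=> s0 _; exists 1 => y cy; apply: hol_cst => //; rewrite invr1 nm_real.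
  by have /andP[y0 y1] := cy i; rewrite ger0_norm.
case: N => [|N] //; split => // j; exists (fun _ _ => (j == i)%:R); split; first exact: smooth_cst.
move=> s _; exists 0 => y u cy _; rewrite mul0r /upd eq_sym; case: eqP => [->|_].
  by rewrite mulr1 rmorphB subrr nm0.
by rewrite mulr0 !subr0 subrr nm0.
Qed.

Lemma hol_unif_add G H : hol_unif G -> hol_unif H -> hol_unif (fun s y => G s y + H s y).
Proof.
move=> hG hH s0 Os; have [e eP] := hG s0 Os; have [f fP] := hH s0 Os.
have e0 := hol_gt0 (eP _ cube0); have f0 := hol_gt0 (fP _ cube0).
have m0 : 0 < Num.min e f by rewrite lt_min e0.
exists (Num.min e f / 2) => y cy; apply: (@hol_add _ (Num.min e f)).
- by apply: hol_le (eP y cy) => //; rewrite ge_min lexx.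
- by apply: hol_le (fP y cy) => //; rewrite ge_min lexx orbT.
Qed.

Lemma hol_unif_mul G H : hol_unif G -> hol_unif H -> hol_unif (fun s y => G s y * H s y).
Proof.
move=> hG hH s0 Os; have [e eP] := hG s0 Os; have [f fP] := hH s0 Os.
have e0 := hol_gt0 (eP _ cube0); have f0 := hol_gt0 (fP _ cube0).
have m0 : 0 < Num.min e f by rewrite lt_min e0.
exists (mul_radius (Num.min e f)) => y cy; apply: hol_mul.
- by apply: hol_le (eP y cy) => //; rewrite ge_min lexx.
- by apply: hol_le (fP y cy) => //; rewrite ge_min lexx orbT.
Qed.

Lemma smooth_add N G H : smooth N G -> smooth N H -> smooth N (fun s y => G s y + H s y).
Proof.
elim: N G H => [|N IH] G H; first exact: hol_unif_add.
move=> [hG dG] [hH dH]; split; first exact: hol_unif_add.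
move=> i; have [G' [sG' dqG]] := dG i; have [H' [sH' dqH]] := dH i.
exists (fun s y => G' s y + H' s y); split; first exact: IH.
move=> s Os; have [K KP] := dqG s Os; have [L LP] := dqH s Os.
exists (K + L) => y u cy u01; rewrite mulrDl.
apply: le_trans (lerD (KP y u cy u01) (LP y u cy u01)).
by apply: le_trans (nmD _ _); rewrite le_eqVlt; apply/orP; left; apply/eqP; congr nm; ring.
Qed.

Lemma smooth_mul N G H : smooth N G -> smooth N H -> smooth N (fun s y => G s y * H s y).
Proof.
elim: N G H => [|N IH] G H; first exact: hol_unif_mul.
move=> sG sH; have [hG dG] := sG; have [hH dH] := sH; split; first exact: hol_unif_mul.
move=> i; have [G' [sG' dqG]] := dG i; have [H' [sH' dqH]] := dH i.
exists (fun s y => G' s y * H s y + G s y * H' s y); split.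
  by apply: smooth_add; apply: IH => //; exact: smooth_pred.
move=> s Os; have [K K0 KP] := quad_diff_ge0 dqG Os; have [L L0 LP] := quad_diff_ge0 dqH Os.
have [M M0 MP] := quad_diff_lip (smooth_hol_unif sH') dqH Os.
have [B B0 BP] := hol_unif_bound hG Os; have [B1 B10 B1P] := hol_unif_bound (smooth_hol_unif sG') Os.
have [B2 B20 B2P] := hol_unif_bound hH Os.
exists (K * B2 + B1 * M + B * L) => y u cy u01.
have cu := cube_upd i cy u01.
set x := (u - y i)%:C; set g := G s y; set gu := G s (upd y i u); set g' := G' s y.
set h := H s y; set hu := H s (upd y i u); set h' := H' s y.
rewrite (_ : _ - _ = (gu - g - x * g') * hu + x * (g' * (hu - h)) + g * (hu - h - x * h')); last by ring.
have k1 := KP y u cy u01; have k2 := LP y u cy u01; have k3 := MP y u cy u01.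
rewrite -/g -/gu -/g' -/h -/hu -/h' -/x in k1 k2 k3.
have q0 := sqr_ge0 (u - y i).
apply: le_trans (nmD _ _) _; rewrite [X in _ <= X]mulrDl; apply: lerD.
  apply: le_trans (nmD _ _) _; rewrite [X in _ <= X]mulrDl; apply: lerD.
    apply: le_trans (nmM _ _) _; rewrite mulrAC; apply: ler_pM; rewrite ?nm_ge0//.
    exact: B2P.
  rewrite nmMr; apply: le_trans (ler_wpM2l _ (nmM _ _)) _ => //.
  apply: le_trans (_ : `|u - y i| * (B1 * (M * `|u - y i|)) <= _).
    by apply: ler_wpM2l => //; apply: ler_pM; rewrite ?nm_ge0 ?B1P.
  by rewrite -[(u - y i) ^+ 2]real_normK ?num_real// le_eqVlt; apply/orP; left; apply/eqP; ring.
apply: le_trans (nmM _ _) _; rewrite -mulrA; apply: ler_pM; rewrite ?nm_ge0//.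
exact: BP.
Qed.

Lemma smooth_scale N (a : C) G : smooth N G -> smooth N (fun s y => a * G s y).
Proof. by apply: smooth_mul; exact: smooth_cst. Qed.

Lemma smooth_opp N G : smooth N G -> smooth N (fun s y => - G s y).
Proof. by move=> /(smooth_scale (-1)); apply: smooth_ext => s y _; rewrite mulN1r. Qed.

Lemma smooth_sub N G H : smooth N G -> smooth N H -> smooth N (fun s y => G s y - H s y).
Proof. by move=> sG /smooth_opp; exact: smooth_add. Qed.

Lemma smooth_sum N (I : Type) (r : seq I) (G : I -> fam) :
  (forall j : I, smooth N (G j)) -> smooth N (fun s y => \sum_(j <- r) G j s y).
Proof.
move=> sG; elim: r => [|i r IH].
  by apply: smooth_ext (smooth_cst N 0) => s y _; rewrite big_nil.
by apply: smooth_ext (smooth_add (sG i) IH) => s y _; rewrite big_cons.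
Qed.

Lemma smooth_restrict N G t : 0 <= t <= 1 -> smooth N G -> smooth N (fun s y => G s (scons t y)).
Proof.
move=> t01; elim: N G => [|N IH] G.
  by move=> hG s0 /hG[e eP]; exists e => y cy; apply: eP; exact: cube_scons.
move=> [hG dG]; split; first by move=> s0 /hG[e eP]; exists e => y cy; apply: eP; exact: cube_scons.
move=> i; have [G' [sG' dqG]] := dG i.+1; exists (fun s y => G' s (scons t y)).
split; first exact: IH.
move=> s /dqG[K KP]; exists K => y u cy u01; rewrite scons_upd.
by have := KP (scons t y) u (cube_scons cy t01) u01.
Qed.

End SmoothFamilies.

Section IntegrateVariable.
Context {R : realType}.
Local Notation C := (cplx R).
Local Notation fam := (C -> (nat -> R) -> C).
Implicit Types (G H : fam) (y : nat -> R) (s : C) (i N : nat) (t u : R).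

Definition I01 : set R := `[0, 1]%classic.

Lemma I01E t : I01 t <-> 0 <= t <= 1.
Proof. by rewrite /I01 /= in_itv. Qed.

Lemma measurable_I01 : measurable I01. Proof. exact: measurable_itv. Qed.

Lemma lebesgue_I01 : (@lebesgue_measure R) I01 = 1%E.
Proof. by rewrite lebesgue_measure_itv /= lte_fin ltr01 oppr0 adde0. Qed.

Lemma lebesgue_I01_fin : ((@lebesgue_measure R) I01 < +oo)%E.
Proof. by rewrite lebesgue_I01 ltry. Qed.

Lemma fine_lebesgue_I01 : fine ((@lebesgue_measure R) I01) = 1.
Proof. by rewrite lebesgue_I01. Qed.

(** Composing with the retraction onto the interval makes f continuous on the line. *)
Lemma lipschitz_measurable_I01 (f : R -> R) (K : R) :
  (forall t u, I01 t -> I01 u -> `|f u - f t| <= K * `|u - t|) -> measurable_fun I01 f.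
Proof.
move=> fK; have K0 : 0 <= K.
  have J0 : I01 0 by apply/I01E; rewrite lexx ler01.
  have J1 : I01 1 by apply/I01E; rewrite lexx ler01.
  by have := fK 0 1 J0 J1; rewrite subr0 normr1 mulr1; apply: le_trans.
(* the retraction of the line onto the interval *)
pose cl (t : R) := Num.max 0 (Num.min 1 t).
have cl01 t : I01 (cl t) by apply/I01E; rewrite /cl le_max lexx /= ge_max ler01 /= ge_min lexx.
have clE t : I01 t -> cl t = t.
  by move=> /I01E/andP[t0 t1]; rewrite /cl (min_idPr t1) (max_idPr t0).
have clL t u : `|cl u - cl t| <= `|u - t|.
  rewrite /cl !maxEle !minEle; case: (leP 1 u) => ?; case: (leP 1 t) => ?;
  rewrite ?ler01; repeat (case: ifP => //); rewrite ?subrr ?normr0//; move=> *;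
  rewrite ler_norml; have := ler_norm (u - t); have := ler_norm (- (u - t)); rewrite normrN; lra.
apply: (@eq_measurable_fun _ _ _ _ _ (f \o cl)).
  by move=> t; rewrite inE => It /=; rewrite clE.
apply: measurable_funS (_ : measurable_fun setT (f \o cl)) => //.
apply: continuous_measurable_fun => t; apply/cvgrPdist_lt => e e0.
have K1 : 0 < K + 1 by rewrite ltr_wpDl.
near=> u; rewrite /= distrC; apply: le_lt_trans (fK _ _ (cl01 t) (cl01 u)) _.
apply: le_lt_trans (ler_wpM2l K0 (clL _ _)) _.
apply: le_lt_trans (_ : (K + 1) * `|u - t| < _); first by rewrite ler_wpM2r// lerDl.
rewrite mulrC -ltr_pdivlMr// distrC; near: u.
by apply: cvgr_dist_lt; [exact: cvg_id|rewrite divr_gt0].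
Unshelve. all: by end_near. Qed.

Lemma lipschitz_bmf (f : R -> C) (K : R) :
  (forall t u, I01 t -> I01 u -> nm (f u - f t) <= K * `|u - t|) -> bmf I01 f.
Proof.
move=> fK; split.
- apply: (@lipschitz_measurable_I01 _ K) => t u It Iu.
  by rewrite -ReB; apply: le_trans (Re_le_nm _) (fK _ _ It Iu).
- apply: (@lipschitz_measurable_I01 _ K) => t u It Iu.
  by rewrite -ImB; apply: le_trans (Im_le_nm _) (fK _ _ It Iu).
have I0 : I01 0 by apply/I01E; rewrite lexx ler01.
exists (nm (f 0) + `|K|) => t It.
rewrite -[f t](subrK (f 0)) addrC; apply: le_trans (nmD _ _) _; rewrite lerD2l.
apply: le_trans (fK _ _ I0 It) _; rewrite subr0.
move/I01E: It => /andP[t0 t1]; rewrite ger0_norm//.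
by apply: le_trans (_ : `|K| * t <= _); [rewrite ler_wpM2r// ler_norm|rewrite ler_piMr].
Qed.

Variable Om : set C.
Hypothesis Om_open : forall s, Om s -> exists2 e : R, 0 < e & forall z, nm (z - s) < e -> Om z.

Lemma smooth_slice_bmf G s y : smooth Om 1 G -> Om s -> cube y -> bmf I01 (fun t => G s (scons t y)).
Proof.
move=> [hG dG] Os cy; have [G' [hG' dqG]] := dG 0%N.
have [K K0 KP] := quad_diff_lip hG' dqG Os.
apply: (@lipschitz_bmf _ K) => t u /I01E It /I01E Iu.
by have := KP (scons t y) u (cube_scons cy It) Iu; rewrite upd_scons0.
Qed.

Variable w : C -> R -> C.
Hypothesis w_hol : forall s0, Om s0 -> exists e, forall t, I01 t -> hol e s0 (w^~ t).
Hypothesis w_bmf : forall s, Om s -> bmf I01 (w s).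

Definition int0 G : fam := fun s y =>
  cint (@lebesgue_measure R) I01 (fun t => w s t * G s (scons t y)).

Lemma hol_unif_int0 G : smooth Om 1 G -> hol_unif Om (int0 G).
Proof.
move=> sG s0 Os; have [e eP] := smooth_hol_unif sG Os; have [f fP] := w_hol Os.
have [r r0 rP] := Om_open Os.
have I0 : I01 0 by apply/I01E; rewrite lexx ler01.
have cube0 : cube (fun=> 0 : R) by move=> i; rewrite lexx ler01.
have e0 := hol_gt0 (eP _ cube0); have f0 := hol_gt0 (fP _ I0).
have m0 : 0 < Num.min e f by rewrite lt_min e0.
pose q := Num.min (mul_radius (Num.min e f)) r.
have q0 : 0 < q by rewrite lt_min r0 andbT lt_min exprn_gt0//= divr_gt0.
exists (q / 2) => y cy; apply: hol_cint => //.
- exact: measurable_I01.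
- exact: lebesgue_I01_fin.
- by rewrite fine_lebesgue_I01.
- move=> t It; apply: (@hol_le _ (mul_radius (Num.min e f))) => //; first by rewrite ge_min lexx.
  apply: (@hol_mul _ _ _ (w^~ t) (fun s => G s (scons t y))).
    by apply: hol_le (fP t It) => //; rewrite ge_min lexx orbT.
  have cs : cube (scons t y) by apply: cube_scons => //; exact/I01E.
  by apply: hol_le (eP _ cs) => //; rewrite ge_min lexx.
- move=> s; rewrite lt_min => /andP[_ /rP Os']; apply: bmfM; first exact: w_bmf.
  exact: smooth_slice_bmf.
Qed.

(** The quadratic remainder is uniform, so it can be integrated: differentiation goes
    under the integral sign. *)
Lemma smooth_int0 N G : smooth Om N.+1 G -> smooth Om N (int0 G).
Proof.
elim: N G => [|N IH] G sG; first exact: hol_unif_int0.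
split; first by apply: hol_unif_int0; exact: smooth_le sG.
move=> i; have [_ dG] := sG; have [G' [sG' dqG]] := dG i.+1.
exists (int0 G'); split; first exact: IH.
move=> s Os; have [K K0 KP] := quad_diff_ge0 dqG Os; have [_ _ [B BP]] := w_bmf Os.
have I0 : I01 0 by apply/I01E; rewrite lexx ler01.
have B0 : 0 <= B := le_trans (nm_ge0 _) (BP 0 I0).
exists (B * K) => y u cy u01.
have b1 z : cube z -> bmf I01 (fun t => w s t * G s (scons t z)).
  move=> cz; apply: bmfM; first exact: w_bmf.
  by apply: smooth_slice_bmf => //; exact: smooth_le sG.
have b2 : bmf I01 (fun t => w s t * G' s (scons t y)).
  by apply: bmfM; [exact: w_bmf|apply: smooth_slice_bmf => //; exact: (@smooth_le _ Om N.+1 1 G' isT sG')].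
have mI := measurable_I01; have fI := lebesgue_I01_fin.
have cu := cube_upd i cy u01.
rewrite /int0 -cintMl// -cintB//; [|exact: b1|exact: b1].
rewrite -cintB//; [|by apply: bmfB; exact: b1|exact: bmfMl].
rewrite -[X in _ <= X]mulr1 -fine_lebesgue_I01.
apply: nm_cint_le => //.
  by apply: bmfB; [apply: bmfB; exact: b1|exact: bmfMl].
move=> t It; rewrite scons_upd.
have ct : cube (scons t y) by apply: cube_scons => //; exact/I01E.
have := KP (scons t y) u ct u01 => /=.
set g1 := G s (upd _ _ _); set g := G s _; set g' := G' s _ => H.
rewrite (_ : _ - _ = w s t * (g1 - g - (u - y i)%:C * g')); last by ring.
apply: le_trans (nmM _ _) _; rewrite -mulrA.
by apply: ler_pM; rewrite ?nm_ge0 ?BP.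
Qed.

End IntegrateVariable.

(** * Complex powers on the unit interval *)

Section PowerWeights.
Context {R : realType}.
Local Notation C := (cplx R).
Implicit Types (a s : C) (t u : R).

Lemma cpow_pos t a : 0 < t -> real_cpow t a = cexp (a * (ln t)%:C).
Proof. by move=> t0; rewrite /real_cpow t0 gt_eqF. Qed.

Lemma cpow0 a : real_cpow 0 a = 0.
Proof. by rewrite /real_cpow eqxx. Qed.

Lemma cpow1 a : real_cpow 1 a = 1.
Proof. by rewrite cpow_pos// ln1 mulr0 cexp0. Qed.

Lemma cpowS t a : 0 <= t -> real_cpow t (a + 1) = t%:C * real_cpow t a.
Proof.
rewrite le_eqVlt => /predU1P[<-|t0]; first by rewrite !cpow0 mulr0.
by rewrite !cpow_pos// mulrDl mul1r cexpD cexp_real lnK// mulrC.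
Qed.

Lemma cpow_natr t a (n : nat) : 0 <= t -> real_cpow t (a + n%:R) = (t ^+ n)%:C * real_cpow t a.
Proof.
move=> t0; elim: n => [|n IH]; first by rewrite addr0 expr0 mul1r.
by rewrite -natr1 addrA cpowS// IH exprS rmorphM mulrA.
Qed.

Lemma cpowM t u a : 0 <= t -> 0 < u -> real_cpow (t * u) a = real_cpow t a * real_cpow u a.
Proof.
rewrite le_eqVlt => /predU1P[<-|t0] u0; first by rewrite mul0r !cpow0 mul0r.
by rewrite !cpow_pos ?mulr_gt0// lnM// rmorphD mulrDr cexpD.
Qed.

Lemma cpow_ReE t a : 0 < t ->
  complex.Re (real_cpow t a) = expR (complex.Re a * ln t) * cos (complex.Im a * ln t).
Proof. by move=> t0; rewrite cpow_pos// /cexp ReMr ReM ImM /= mulr0 subr0 mulr0 add0r. Qed.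

Lemma cpow_ImE t a : 0 < t ->
  complex.Im (real_cpow t a) = expR (complex.Re a * ln t) * sin (complex.Im a * ln t).
Proof. by move=> t0; rewrite cpow_pos// /cexp ImMr ReM ImM /= mulr0 subr0 mulr0 add0r. Qed.

Lemma nm_cpow_le t a : 0 < t -> nm (real_cpow t a) <= 2 * expR (complex.Re a * ln t).
Proof.
by move=> t0; rewrite cpow_pos//; apply: le_trans (nm_cexp_le _) _; rewrite ReM /= mulr0 subr0.
Qed.

Lemma nm_cpow_le2 t a : I01 t -> 0 <= complex.Re a -> nm (real_cpow t a) <= 2.
Proof.
move=> /I01E/andP[]; rewrite le_eqVlt => /predU1P[<-|t0] t1 a0; first by rewrite cpow0 nm0.
apply: le_trans (nm_cpow_le a t0) _; rewrite -[X in _ <= X]mulr1 ler_wpM2l//.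
by rewrite -expR0 ler_expR mulr_ge0_le0// ln_le0.
Qed.

Lemma measurable_cpow a :
  measurable_fun [set: R] (fun t => complex.Re (real_cpow t a)) /\
  measurable_fun [set: R] (fun t => complex.Im (real_cpow t a)).
Proof.
have mz : measurable_fun [set: R] (fun t : R => t == 0).
  by apply: measurable_fun_eqr; [exact: measurable_id|exact: measurable_cst].
have mp : measurable_fun [set: R] (fun t : R => 0 < t).
  by apply: measurable_fun_ltr; [exact: measurable_cst|exact: measurable_id].
have mln : measurable_fun [set: R] (@ln R) by exact: measurable_ln.
have mabs : measurable_fun [set: R] (fun t : R => ln `|t|).
  by apply: (measurableT_comp mln); exact: normr_measurable.
have mexp (h : R -> R) c : measurable_fun setT h -> measurable_fun setT (fun t => expR (c * h t)).
  move=> mh; apply: (measurableT_comp (@measurable_expR R)).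
  by apply: measurable_funM => //; exact: measurable_cst.
have mcos (h : R -> R) c : measurable_fun setT h -> measurable_fun setT (fun t => cos (c * h t)).
  move=> mh; apply: (@measurableT_comp _ _ _ _ _ _ (@cos R)).
    by apply: continuous_measurable_fun; exact: continuous_cos.
  by apply: measurable_funM => //; exact: measurable_cst.
have msin (h : R -> R) c : measurable_fun setT h -> measurable_fun setT (fun t => sin (c * h t)).
  move=> mh; apply: (@measurableT_comp _ _ _ _ _ _ (@sin R)).
    by apply: continuous_measurable_fun; exact: continuous_sin.
  by apply: measurable_funM => //; exact: measurable_cst.
have rE (x : R) : complex.Re (cexp (a * (x%:C : C))) = expR (complex.Re a * x) * cos (complex.Im a * x).
  by rewrite /cexp ReMr ReM ImM /= mulr0 subr0 mulr0 add0r.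
have iE (x : R) : complex.Im (cexp (a * (x%:C : C))) = expR (complex.Re a * x) * sin (complex.Im a * x).
  by rewrite /cexp ImMr ReM ImM /= mulr0 subr0 mulr0 add0r.
set z := cexp (- (pi%:C * 'i * a)).
split.
  rewrite (_ : (fun t => _) = fun t => if t == 0 then 0 else if 0 < t then
     expR (complex.Re a * ln t) * cos (complex.Im a * ln t) else
     (expR (complex.Re a * ln `|t|) * cos (complex.Im a * ln `|t|)) * complex.Re z -
     (expR (complex.Re a * ln `|t|) * sin (complex.Im a * ln `|t|)) * complex.Im z); last first.
    apply/funext => t; rewrite /real_cpow; case: ifP => // _; case: ifP => // _.
    by rewrite -/z ReM rE iE.
  apply: measurable_fun_ifT => //.
  apply: measurable_fun_ifT => //.
    by apply: measurable_funM; [exact: mexp|exact: mcos].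
  by apply: measurable_funB; apply: measurable_funM; rewrite ?mulr0//;
    try exact: measurable_cst; apply: measurable_funM; [exact: mexp|exact: mcos|exact: mexp|exact: msin].
rewrite (_ : (fun t => _) = fun t => if t == 0 then 0 else if 0 < t then
     expR (complex.Re a * ln t) * sin (complex.Im a * ln t) else
     (expR (complex.Re a * ln `|t|) * cos (complex.Im a * ln `|t|)) * complex.Im z +
     (expR (complex.Re a * ln `|t|) * sin (complex.Im a * ln `|t|)) * complex.Re z); last first.
  apply/funext => t; rewrite /real_cpow; case: ifP => // _; case: ifP => // _.
  by rewrite -/z ImM rE iE.
apply: measurable_fun_ifT => //.
apply: measurable_fun_ifT => //.
  by apply: measurable_funM; [exact: mexp|exact: msin].
by apply: measurable_funD; apply: measurable_funM;
    try exact: measurable_cst; apply: measurable_funM; [exact: mexp|exact: mcos|exact: mexp|exact: msin].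
Qed.

Lemma bmf_cpow a : 0 <= complex.Re a -> bmf I01 (fun t => real_cpow t a).
Proof.
move=> a0; have [m1 m2] := measurable_cpow a; split.
- exact: measurable_funS m1.
- exact: measurable_funS m2.
- by exists 2 => t It; exact: nm_cpow_le2.
Qed.

Lemma is_derive_cpow_Re t a : 0 < t ->
  is_derive t 1 (fun u => complex.Re (real_cpow u (a + 1))) (complex.Re ((a + 1) * real_cpow t a)).
Proof.
move=> t0; set al := complex.Re a; set be := complex.Im a.
pose f (u : R) := expR ((al + 1) * ln u) * cos (be * ln u).
apply: (@near_eq_is_derive _ _ _ f).
  near=> u; have u0 : 0 < u by near: u; exact: lt_nbhsr.
  by rewrite cpow_ReE// ReD ImD /= addr0.
have dl : is_derive t 1 (@ln R) t^-1 by exact: is_derive1_ln.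
have d1 c : is_derive t 1 (fun u : R => c * ln u) (c * t^-1).
  exact: (is_derive_eq (is_deriveZ c dl)).
have d2 : is_derive t 1 (fun u : R => expR ((al + 1) * ln u)) (expR ((al + 1) * ln t) * ((al + 1) * t^-1)).
  exact: (@is_derive1_comp _ expR _ _ _ _ (is_derive_expR _) (d1 _)).
have d3 : is_derive t 1 (fun u : R => cos (be * ln u)) (- sin (be * ln t) * (be * t^-1)).
  exact: (@is_derive1_comp _ (@cos R) _ _ _ _ (is_derive_cos _) (d1 _)).
apply: (is_derive_eq (is_deriveM d2 d3)).
rewrite ReM ReD ImD /= addr0 cpow_ReE// cpow_ImE// -/al -/be /GRing.scale /=.
rewrite [(al + 1) * ln t]mulrDl mul1r expRD lnK//.
by field; rewrite gt_eqF.
Unshelve. all: by end_near. Qed.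

Lemma is_derive_cpow_Im t a : 0 < t ->
  is_derive t 1 (fun u => complex.Im (real_cpow u (a + 1))) (complex.Im ((a + 1) * real_cpow t a)).
Proof.
move=> t0; set al := complex.Re a; set be := complex.Im a.
pose f (u : R) := expR ((al + 1) * ln u) * sin (be * ln u).
apply: (@near_eq_is_derive _ _ _ f).
  near=> u; have u0 : 0 < u by near: u; exact: lt_nbhsr.
  by rewrite cpow_ImE// ReD ImD /= addr0.
have dl : is_derive t 1 (@ln R) t^-1 by exact: is_derive1_ln.
have d1 c : is_derive t 1 (fun u : R => c * ln u) (c * t^-1).
  exact: (is_derive_eq (is_deriveZ c dl)).
have d2 : is_derive t 1 (fun u : R => expR ((al + 1) * ln u)) (expR ((al + 1) * ln t) * ((al + 1) * t^-1)).
  exact: (@is_derive1_comp _ expR _ _ _ _ (is_derive_expR _) (d1 _)).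
have d3 : is_derive t 1 (fun u : R => sin (be * ln u)) (cos (be * ln t) * (be * t^-1)).
  exact: (@is_derive1_comp _ (@sin R) _ _ _ _ (is_derive_sin _) (d1 _)).
apply: (is_derive_eq (is_deriveM d2 d3)).
rewrite ImM ReD ImD /= addr0 cpow_ReE// cpow_ImE// -/al -/be /GRing.scale /=.
rewrite [(al + 1) * ln t]mulrDl mul1r expRD lnK//.
by field; rewrite gt_eqF.
Unshelve. all: by end_near. Qed.

(** Continuity along [0, 1], in the form suited to functions given only there. *)
Definition cont01 (f : R -> R) := forall z, I01 z -> f x @[x --> within I01 (nbhs z)] --> f z.

Lemma cont01_D f g : cont01 f -> cont01 g -> cont01 (fun x => f x + g x).
Proof. by move=> cf cg z Iz; apply: cvgD; [exact: cf|exact: cg]. Qed.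
Lemma cont01_B f g : cont01 f -> cont01 g -> cont01 (fun x => f x - g x).
Proof. by move=> cf cg z Iz; apply: cvgB; [exact: cf|exact: cg]. Qed.
Lemma cont01_M f g : cont01 f -> cont01 g -> cont01 (fun x => f x * g x).
Proof. by move=> cf cg z Iz; apply: cvgM; [exact: cf|exact: cg]. Qed.
Lemma cont01_cst c : cont01 (fun=> c).
Proof. by move=> z Iz; exact: cvg_cst. Qed.

Lemma cont01_lipschitz (f : R -> R) (K : R) :
  (forall t u, I01 t -> I01 u -> `|f u - f t| <= K * `|u - t|) -> cont01 f.
Proof.
move=> fK z Iz; apply/cvgrPdist_lt => e e0.
have K1 : 0 < `|K| + 1 by rewrite ltr_wpDl.
near=> u; have Iu : I01 u by near: u; exact: withinT.
rewrite distrC; apply: le_lt_trans (fK _ _ Iz Iu) _.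
apply: le_lt_trans (_ : (`|K| + 1) * `|u - z| < _).
  by rewrite ler_wpM2r// (le_trans (ler_norm K))// lerDl.
rewrite mulrC -ltr_pdivlMr// distrC; near: u; apply: cvg_within.
by apply: (@nbhsx_ballx _ _ z); rewrite divr_gt0.
Unshelve. all: by end_near. Qed.

(** At 0 the power tends to its conventional value 0 because the real part of the
    exponent is positive. *)
Lemma cont01_cpow a : 0 < complex.Re a ->
  cont01 (fun t => complex.Re (real_cpow t a)) /\ cont01 (fun t => complex.Im (real_cpow t a)).
Proof.
move=> a0.
have at0 (e : R) : 0 < e -> \forall u \near within I01 (nbhs (0 : R)), nm (real_cpow u a) < e.
  move=> e0; pose d := expR (ln (2^-1 * e) / complex.Re a).
  near=> u; have /I01E/andP[] : I01 u by near: u; exact: withinT.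
  rewrite le_eqVlt => /predU1P[<-|u0] u1; first by rewrite cpow0 nm0.
  have ud : u < d.
    near: u; apply: cvg_within; exact: (lt_nbhsl (expR_gt0 _)).
  apply: le_lt_trans (nm_cpow_le a u0) _; rewrite -ltr_pdivlMl//.
  have e2 : 0 < 2^-1 * e by rewrite mulr_gt0.
  rewrite -[X in _ < X]lnK ?posrE// ltr_expR [complex.Re a * _]mulrC -ltr_pdivlMr//.
  by rewrite -[X in _ < X]expRK ltr_ln// posrE expR_gt0.
have aE : a = (a - 1) + 1 by rewrite subrK.
split=> z Iz; have /I01E/andP[] := Iz; rewrite le_eqVlt => /predU1P[<-|z0] z1.
- rewrite cpow0 /=; apply/cvgrPdist_lt => e /at0; apply: filterS => u.
  by rewrite sub0r normrN; apply: le_lt_trans (Re_le_nm _).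
- apply: cvg_within_filter; apply: differentiable_continuous; apply/derivable1_diffP.
  by rewrite aE; apply: ex_derive; exact: is_derive_cpow_Re.
- rewrite cpow0 /=; apply/cvgrPdist_lt => e /at0; apply: filterS => u.
  by rewrite sub0r normrN; apply: le_lt_trans (Im_le_nm _).
- apply: cvg_within_filter; apply: differentiable_continuous; apply/derivable1_diffP.
  by rewrite aE; apply: ex_derive; exact: is_derive_cpow_Im.
Unshelve. all: by end_near. Qed.

Lemma quad_is_derive (g g' : R -> R) (K : R) t : 0 < t < 1 ->
  (forall t u, I01 t -> I01 u -> `|g u - g t - (u - t) * g' t| <= K * (u - t) ^+ 2) ->
  is_derive t 1 g (g' t).
Proof.
move=> /andP[t0 t1] gK.
have It : I01 t by apply/I01E; rewrite !ltW.
have cv : (fun h => h^-1 *: ((g \o shift t) (h *: 1) - g t)) @ 0^' --> g' t.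
  apply/cvgrPdist_lt => e e0.
  have K1 : 0 < `|K| + 1 by rewrite ltr_wpDl.
  near=> h.
  have h0 : h != 0 by near: h; exact: nbhs_dnbhs_neq.
  have hK : `|h| < e / (`|K| + 1).
    by near: h; apply: dnbhs0_lt; rewrite divr_gt0.
  have ht : `|h| < Num.min t (1 - t).
    by near: h; apply: dnbhs0_lt; rewrite lt_min t0 subr_gt0.
  have Iu : I01 (h + t).
    move: ht; rewrite lt_min !ltr_norml => /andP[/andP[h1 _] /andP[_ h2]].
    by apply/I01E; apply/andP; split; lra.
  have := gK t (h + t) It Iu; rewrite addrK => H.
  rewrite /= /GRing.scale /= mulr1 distrC.
  rewrite (_ : _ - _ = h^-1 * (g (h + t) - g t - h * g' t)); last by field.
  rewrite normrM normfV mulrC ltr_pdivrMr ?normr_gt0//.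
  apply: le_lt_trans H _; rewrite -real_normK ?num_real// expr2 mulrA ltr_pM2r ?normr_gt0//.
  apply: le_lt_trans (_ : (`|K| + 1) * `|h| < _); last by rewrite mulrC -ltr_pdivlMr.
  by rewrite ler_wpM2r// (le_trans (ler_norm K))// lerDl.
apply: DeriveDef; first by apply/cvg_ex; exists (g' t).
by rewrite /derive; apply/cvg_lim.
Unshelve. all: by end_near. Qed.

Lemma FTC01 (f F : R -> R) : cont01 f -> cont01 F ->
  (forall t, 0 < t < 1 -> is_derive t 1 F (f t)) ->
  Rintegral (@lebesgue_measure R) I01 f = F 1 - F 0.
Proof.
move=> cf cF dF; rewrite /Rintegral /I01 (@continuous_FTC2 _ f F) ?ltr01//.
- by apply/subspace_continuousP => x Ix; exact: cf.
- have wF : {within `[0, 1], continuous F}.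
    by apply/subspace_continuousP => x Ix; exact: cF.
  have [_ F0 F1] := (continuous_within_itvP _ ltr01).1 wF.
  split => //; move=> x; rewrite in_itv /= => /dF dx; exact: ex_derive.
- by move=> x; rewrite in_itv /= => /dF dx; rewrite derive1E derive_val.
Qed.

(** The fundamental theorem of calculus for t^(a+1) g(t), whose value at 0 vanishes;
    since the derivative is needed in the open interval only, the singularity of t^a at
    0 does no harm. *)
Lemma cpow_ibp (g g' : R -> C) (K K' : R) a : 0 < complex.Re a ->
  (forall t u, I01 t -> I01 u -> nm (g u - g t - (u - t)%:C * g' t) <= K * (u - t) ^+ 2) ->
  (forall t u, I01 t -> I01 u -> nm (g u - g t) <= K' * `|u - t|) ->
  (forall t u, I01 t -> I01 u -> nm (g' u - g' t) <= K' * `|u - t|) ->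
  (a + 1) * cint (@lebesgue_measure R) I01 (fun t => real_cpow t a * g t) =
  g 1 - cint (@lebesgue_measure R) I01 (fun t => real_cpow t (a + 1) * g' t).
Proof.
move=> a0 gK gL gL'.
have a10 : 0 < complex.Re (a + 1) by rewrite ReD /= ltr_wpDr.
have mI := @measurable_I01 R; have fI := @lebesgue_I01_fin R.
have bg : bmf I01 g by exact: lipschitz_bmf gL.
have bg' : bmf I01 g' by exact: lipschitz_bmf gL'.
have b1 : bmf I01 (fun t => real_cpow t a * g t) by apply: bmfM => //; apply: bmf_cpow; exact: ltW.
have b2 : bmf I01 (fun t => real_cpow t (a + 1) * g' t) by apply: bmfM => //; apply: bmf_cpow; exact: ltW.
apply/eqP; rewrite eq_sym subr_eq; apply/eqP.
rewrite -cintMl// -cintD//; last exact: bmfMl.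
have [c1 c2] := cont01_cpow a0; have [d1 d2] := cont01_cpow a10.
have g1 : cont01 (fun t => complex.Re (g t)).
  by apply: (@cont01_lipschitz _ K') => t u It Iu; rewrite -ReB; exact: le_trans (Re_le_nm _) (gL _ _ It Iu).
have g2 : cont01 (fun t => complex.Im (g t)).
  by apply: (@cont01_lipschitz _ K') => t u It Iu; rewrite -ImB; exact: le_trans (Im_le_nm _) (gL _ _ It Iu).
have g1' : cont01 (fun t => complex.Re (g' t)).
  by apply: (@cont01_lipschitz _ K') => t u It Iu; rewrite -ReB; exact: le_trans (Re_le_nm _) (gL' _ _ It Iu).
have g2' : cont01 (fun t => complex.Im (g' t)).
  by apply: (@cont01_lipschitz _ K') => t u It Iu; rewrite -ImB; exact: le_trans (Im_le_nm _) (gL' _ _ It Iu).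
have dg1 t : 0 < t < 1 -> is_derive t 1 (fun t => complex.Re (g t)) (complex.Re (g' t)).
  move=> t01; apply: (@quad_is_derive _ (fun t => complex.Re (g' t)) K) => // u v Iu Iv.
  by apply: le_trans (gK u v Iu Iv); rewrite -ReMr -!ReB; exact: Re_le_nm.
have dg2 t : 0 < t < 1 -> is_derive t 1 (fun t => complex.Im (g t)) (complex.Im (g' t)).
  move=> t01; apply: (@quad_is_derive _ (fun t => complex.Im (g' t)) K) => // u v Iu Iv.
  by apply: le_trans (gK u v Iu Iv); rewrite -ImMr -!ImB; exact: Im_le_nm.
have E0 : real_cpow 0 (a + 1) * g 0 = 0 by rewrite cpow0 mul0r.
have E1 : real_cpow 1 (a + 1) * g 1 = g 1 by rewrite cpow1 mul1r.
apply: cplxP => /=.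
- rewrite (_ : (fun t => _) = (fun t => (complex.Re (a + 1) * (complex.Re (real_cpow t a) * complex.Re (g t) -
      complex.Im (real_cpow t a) * complex.Im (g t)) -
      complex.Im (a + 1) * (complex.Re (real_cpow t a) * complex.Im (g t) +
      complex.Im (real_cpow t a) * complex.Re (g t))) +
      (complex.Re (real_cpow t (a + 1)) * complex.Re (g' t) -
       complex.Im (real_cpow t (a + 1)) * complex.Im (g' t)))); last first.
    by apply/funext => t; rewrite [LHS]ReD [complex.Re (_ * (_ * _))]ReM [complex.Re (real_cpow t a * _)]ReM
      [complex.Im (real_cpow t a * _)]ImM [complex.Re (real_cpow t (a + 1) * _)]ReM.
  pose F t := complex.Re (real_cpow t (a + 1)) * complex.Re (g t) -
     complex.Im (real_cpow t (a + 1)) * complex.Im (g t).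
  transitivity (F 1 - F 0); first by rewrite /F -!ReM E0 E1 subr0.
  apply/esym; apply: FTC01.
  + by apply: cont01_D; [apply: cont01_B; apply: cont01_M; try exact: cont01_cst; [apply: cont01_B|apply: cont01_D]|apply: cont01_B]; apply: cont01_M.
  + by apply: cont01_B; apply: cont01_M.
  + move=> t t01; have t0 : 0 < t by case/andP: t01.
    apply: (is_derive_eq (is_deriveB (is_deriveM (is_derive_cpow_Re a t0) (dg1 _ t01))
      (is_deriveM (is_derive_cpow_Im a t0) (dg2 _ t01)))).
    rewrite /GRing.scale /= !ReM !ImM; ring.
- rewrite (_ : (fun t => _) = (fun t => (complex.Re (a + 1) * (complex.Re (real_cpow t a) * complex.Im (g t) +
      complex.Im (real_cpow t a) * complex.Re (g t)) +
      complex.Im (a + 1) * (complex.Re (real_cpow t a) * complex.Re (g t) -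
      complex.Im (real_cpow t a) * complex.Im (g t))) +
      (complex.Re (real_cpow t (a + 1)) * complex.Im (g' t) +
       complex.Im (real_cpow t (a + 1)) * complex.Re (g' t)))); last first.
    by apply/funext => t; rewrite [LHS]ImD [complex.Im (_ * (_ * _))]ImM [complex.Re (real_cpow t a * _)]ReM
      [complex.Im (real_cpow t a * _)]ImM [complex.Im (real_cpow t (a + 1) * _)]ImM.
  pose F t := complex.Re (real_cpow t (a + 1)) * complex.Im (g t) +
     complex.Im (real_cpow t (a + 1)) * complex.Re (g t).
  transitivity (F 1 - F 0); first by rewrite /F -!ImM E0 E1 subr0.
  apply/esym; apply: FTC01.
  + by apply: cont01_D; [apply: cont01_D; apply: cont01_M; try exact: cont01_cst; [apply: cont01_D|apply: cont01_B]|apply: cont01_D]; apply: cont01_M.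
  + by apply: cont01_D; apply: cont01_M.
  + move=> t t01; have t0 : 0 < t by case/andP: t01.
    apply: (is_derive_eq (is_deriveD (is_deriveM (is_derive_cpow_Re a t0) (dg2 _ t01))
      (is_deriveM (is_derive_cpow_Im a t0) (dg1 _ t01)))).
    rewrite /GRing.scale /= !ReM !ImM; ring.
Qed.

End PowerWeights.

(** * Continuation by parts, one variable after the other *)

Section Regularization.
Context {R : realType}.
Local Notation C := (cplx R).
Local Notation fam := (C -> (nat -> R) -> C).
Local Notation leb := (@lebesgue_measure R).
Implicit Types (G H : fam) (y : nat -> R) (s : C) (i N m nu K : nat) (t u M : R).

Definition half_plane M : set C := [set s | - M < complex.Re s].

Lemma half_plane_open M s : half_plane M s ->
  exists2 e : R, 0 < e & forall z, nm (z - s) < e -> half_plane M z.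
Proof.
rewrite /half_plane /= => Ms; exists (complex.Re s + M); first by rewrite -subr_lt0 in Ms *; lra.
move=> z zs; have := le_lt_trans (Re_le_nm _) zs; rewrite ReB ltr_norml => /andP[]; lra.
Qed.

(** The weight y^(m s + nu) of one variable; the case m = 0 is separate because 0^0 = 1
    while the complex power 0^0 is 0. *)
Definition var_weight m nu s t : C := if m == 0 then (t ^+ nu)%:C
  else real_cpow t (m%:R * s + nu%:R).

(** The factors picked up by N integrations by parts against the weight y^(m s + nu). *)
Definition pole_factor m nu N s : C := if m == 0 then 1
  else \prod_(j < N) (m%:R * s + nu%:R + j.+1%:R).

Lemma Re_natM m s : complex.Re (m%:R * s) = m%:R * complex.Re s.
Proof. by rewrite -(rmorph_nat (real_complex R)) ReMr. Qed.

Lemma Re_nat n : complex.Re (n%:R : C) = n%:R.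
Proof. by rewrite -(rmorph_nat (real_complex R)). Qed.

Lemma Re_lin m nu s : complex.Re (m%:R * s + nu%:R : C) = m%:R * complex.Re s + nu%:R.
Proof. by rewrite ReD Re_natM Re_nat. Qed.

Lemma var_weight_hol m nu s0 : (0 < m)%N -> 0 < complex.Re (m%:R * s0 + nu%:R : C) ->
  exists e, forall t, I01 t -> hol e s0 (fun s => real_cpow t (m%:R * s + nu%:R)).
Proof.
move=> m0 a0; have m0' : 0 < m%:R :> R by rewrite ltr0n.
set e := Num.min 4^-1 (complex.Re (m%:R * s0 + nu%:R) / m%:R).
have e0 : 0 < e by rewrite lt_min invr_gt0 ltr0n /= divr_gt0.
exists e => t /I01E/andP[]; rewrite le_eqVlt => /predU1P[<-|t0] t1.
  apply: (@hol_eq _ _ _ (fun=> 0)); first by move=> s _; rewrite cpow0.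
  by apply: hol_cst => //; rewrite nm0 invr_ge0 ltW.
apply: (@hol_eq _ _ _ (fun s => (t ^+ nu)%:C * cexp (s * ((m%:R * ln t)%:C : C)))).
  move=> s _; rewrite cpow_pos// mulrDl cexpD mulrC; congr (_ * _).
    by congr cexp; rewrite rmorphM rmorph_nat; ring.
  by rewrite -(rmorph_nat (real_complex R)) -rmorphM cexp_real mulrC expRM_natr lnK.
apply: hol_cexp => //; rewrite nm_real ger0_norm ?exprn_ge0 ?(ltW t0)//.
have l0 : ln t <= 0 by apply: ln_le0.
have -> : t ^+ nu = expR (nu%:R * ln t) by rewrite mulrC expRM_natr lnK.
rewrite -mulrA -expRD; apply: le_trans (_ : 2 * 1 <= _).
  rewrite ler_wpM2l// -[X in _ <= X]expR0 ler_expR.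
  rewrite ler0_norm; last by rewrite mulr_ge0_le0// ltW.
  have em : e * m%:R <= complex.Re (m%:R * s0 + nu%:R : C).
    by rewrite -ler_pdivlMr// ge_min lexx orbT.
  have -> : nu%:R * ln t + (complex.Re s0 * (m%:R * ln t) + e * - (m%:R * ln t)) =
      (complex.Re (m%:R * s0 + nu%:R : C) - e * m%:R) * ln t by rewrite Re_lin; ring.
  by rewrite mulr_ge0_le0// subr_ge0.
rewrite mulr1; apply: le_trans (_ : 4 <= _); first by rewrite ler_nat.
by rewrite -[4]invrK lef_pV2 ?posrE ?invr_gt0// ge_min lexx.
Qed.

Lemma hol_real_cst (x : R) s0 : `|x| <= 1 -> hol 1 s0 (fun=> x%:C).
Proof. by move=> x1; apply: hol_cst => //; rewrite invr1 nm_real. Qed.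

Lemma bmf_pow nu : bmf (I01 : set (measurableTypeR R)) (fun t : R => ((t ^+ nu)%:C : C)).
Proof.
split.
- by apply: measurable_funX; exact: measurable_id.
- exact: measurable_cst.
- exists 1 => t /I01E/andP[t0 t1]; rewrite nm_real ger0_norm ?exprn_ge0//.
  exact: exprn_ile1.
Qed.

Lemma var_weight_hol_at m nu s0 : (m == 0) || (0 < complex.Re (m%:R * s0 + nu%:R : C)) ->
  exists e, forall t, I01 t -> hol e s0 (fun s => var_weight m nu s t).
Proof.
rewrite /var_weight; case: eqP => [_ _|/eqP m0 /= a0]; last by apply: var_weight_hol => //; rewrite lt0n.
exists 1 => t /I01E/andP[t0 t1]; apply: hol_real_cst.
by rewrite ger0_norm ?exprn_ge0// exprn_ile1.
Qed.

Lemma var_weight_bmf m nu s : (m == 0) || (0 < complex.Re (m%:R * s + nu%:R : C)) -> bmf I01 (var_weight m nu s).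
Proof.
rewrite /var_weight; case: eqP => [_ _|/eqP m0 /= a0]; first exact: bmf_pow.
by apply: bmf_cpow; exact: ltW.
Qed.

Definition integrate_out m nu G : fam := int0 (var_weight m nu) G.

Lemma smooth_integrate_out (Om : set C) m nu K G :
  (forall s, Om s -> exists2 e : R, 0 < e & forall z, nm (z - s) < e -> Om z) ->
  (forall s, Om s -> (m == 0) || (0 < complex.Re (m%:R * s + nu%:R : C))) ->
  smooth Om K.+1 G -> smooth Om K (integrate_out m nu G).
Proof.
move=> Oop OK; apply: smooth_int0 => // s Os; first exact: var_weight_hol_at (OK s Os).
exact: var_weight_bmf (OK s Os).
Qed.

(** Induction on N: an integration by parts trades the factor a + 1 for the weight
    y^(a+1), integrable one unit further to the left, and the boundary term at y = 1 no
    longer involves y. *)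
Lemma regularize_pos (Om : set C) m nu N K G : (0 < m)%N ->
  (forall s, Om s -> exists2 e : R, 0 < e & forall z, nm (z - s) < e -> Om z) ->
  (forall s, Om s -> 0 < complex.Re (m%:R * s + (nu + N)%:R : C)) ->
  smooth Om (N + K).+1 G ->
  exists H, smooth Om K H /\ forall s y, Om s -> 0 < complex.Re s -> cube y ->
    H s y = (\prod_(j < N) (m%:R * s + nu%:R + j.+1%:R)) *
      cint leb I01 (fun t => real_cpow t (m%:R * s + nu%:R) * G s (scons t y)).
Proof.
move=> m0 Oop; elim: N nu G => [|N IH] nu G OK sG.
  exists (integrate_out m nu G); split.
    apply: smooth_integrate_out => // s /OK; rewrite addn0 => ->; exact: orbT.
  move=> s y Os s0 cy; rewrite big_ord0 mul1r /integrate_out /int0 /var_weight.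
  by rewrite (gtn_eqF m0).
have [G' [sG' dqG]] := smooth_der 0 (sG : smooth Om (N + K).+2 G).
have [|H' [sH' HE]] := IH nu.+1 G' _ sG'; first by move=> s /OK; rewrite addnS addSn.
exists (fun s y => (\prod_(j < N) (m%:R * s + nu%:R + j.+2%:R)) * G s (scons 1 y) - H' s y); split.
  apply: smooth_sub => //; apply: smooth_mul.
    elim: (N) => [|N' IHN]; first by apply: smooth_ext (smooth_cst _ _ 1) => s y _; rewrite big_ord0.
    apply: smooth_ext (smooth_mul IHN (_ : smooth Om K (fun s y => m%:R * s + nu%:R + N'.+2%:R))) => [s y _|].
      by rewrite big_ord_recr.
    by apply: smooth_add; [apply: smooth_add; [apply: smooth_scale; exact: smooth_id|]|]; exact: smooth_cst.
  by apply: smooth_restrict; [rewrite ler01 lexx|apply: smooth_le sG; rewrite leqW// leq_addl].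
move=> s y Os s0 cy; rewrite HE//.
set a := m%:R * s + nu%:R.
have a0 : 0 < complex.Re a by rewrite Re_lin ltr_wpDr// mulr_gt0// ltr0n.
have [L L0 LP] := quad_diff_lip (smooth_hol_unif sG') dqG Os.
have s1G' : smooth Om 1 G' by exact: (@smooth_le _ Om (N + K).+1 1 G' isT sG').
have [G'' [sG'' dqG']] := smooth_der 0 s1G'.
have [L' L'0 LP'] := quad_diff_lip (smooth_hol_unif sG'') dqG' Os.
have [Q Q0 QP] := quad_diff_ge0 dqG Os.
have c01 t : I01 t -> cube (scons t y) by move=> /I01E It; exact: cube_scons.
have up t u : upd (scons t y) 0 u = scons u y by exact: upd_scons0.
have ibp := @cpow_ibp _ (fun t => G s (scons t y)) (fun t => G' s (scons t y)) Q (L + L') a a0.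
have -> : \prod_(j < N.+1) (a + j.+1%:R) = (\prod_(j < N) (a + j.+2%:R)) * (a + 1).
  by rewrite big_ord_recl mulrC; congr (_ * _).
rewrite -mulrA ibp.
- rewrite mulrBr; congr (_ - _).
  have -> : m%:R * s + nu.+1%:R = a + 1 by rewrite -natr1 addrA.
  congr (_ * _); apply: eq_bigr => j _; rewrite -addrA.
  by congr (_ + _).
- move=> t u It Iu; have := QP (scons t y) u (c01 t It); rewrite up; apply; exact/I01E.
- move=> t u It Iu; have := LP (scons t y) u (c01 t It); rewrite up => H.
  apply: le_trans (H _) _; first exact/I01E.
  by rewrite ler_wpM2r// lerDl.
- move=> t u It Iu; have := LP' (scons t y) u (c01 t It); rewrite up => H.
  apply: le_trans (H _) _; first exact/I01E.
  by rewrite ler_wpM2r// lerDr.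
Qed.

Lemma regularize M m nu N K G : 0 <= M -> M * m%:R < N%:R ->
  smooth (half_plane M) (N + K).+1 G ->
  exists H, smooth (half_plane M) K H /\ forall s y, 0 < complex.Re s -> cube y ->
    H s y = pole_factor m nu N s * integrate_out m nu G s y.
Proof.
move=> M0 MmN sG; have [m0|m0] := posnP m.
  exists (integrate_out m nu G); split.
    apply: smooth_integrate_out => [|s _|]; first exact: half_plane_open.
      by rewrite m0.
    by apply: smooth_le sG; rewrite ltnS leq_addl.
  by move=> s y _ _; rewrite /pole_factor m0 eqxx mul1r.
have [|H [sH HE]] := regularize_pos (nu := nu) m0 (@half_plane_open M) _ sG.
  move=> s; rewrite /half_plane /= Re_lin => Ms.
  have m0' : 0 < m%:R :> R by rewrite ltr0n.
  have nu0 : 0 <= nu%:R :> R by rewrite ler0n.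
  rewrite natrD; nra.
exists H; split => // s y s0 cy; rewrite HE//.
  by rewrite /pole_factor /integrate_out /int0 /var_weight (gtn_eqF m0).
by rewrite /half_plane /=; apply: le_lt_trans s0; rewrite oppr_le0.
Qed.

Fixpoint iterated (W : seq (R -> C)) (F : (nat -> R) -> C) y : C :=
  if W is w :: W' then
    iterated W' (fun y => cint leb I01 (fun t => w t * F (scons t y))) y
  else F y.

Lemma iterated_ext W F F' y : cube y -> (forall z, cube z -> F z = F' z) ->
  iterated W F y = iterated W F' y.
Proof.
move=> cy; elim: W F F' => [|w W IH] F F' FF /=; first exact: FF.
apply: IH => z cz; apply: eq_cint => t /I01E It; rewrite FF//.
exact: cube_scons.
Qed.

Implicit Types (e : seq (nat * nat)).

Definition weights e s : seq (R -> C) := [seq var_weight p.1 p.2 s | p <- e].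

Lemma Re_pos_lin m nu s : 0 < complex.Re s ->
  (m == 0) || (0 < complex.Re (m%:R * s + nu%:R : C)).
Proof.
move=> s0; case: eqP => //= /eqP; rewrite -lt0n => m0.
by rewrite Re_lin ltr_wpDr// mulr_gt0// ltr0n.
Qed.

Let right_plane : set C := half_plane 0.

Lemma smooth_integrate_out_right m nu K G : smooth right_plane K.+1 G ->
  smooth right_plane K (integrate_out m nu G).
Proof.
apply: smooth_integrate_out; first exact: half_plane_open.
by move=> s; rewrite /right_plane /half_plane /= oppr0; exact: Re_pos_lin.
Qed.

Lemma integrand_bmf m nu G s y : smooth right_plane 1 G -> 0 < complex.Re s -> cube y ->
  bmf I01 (fun t => var_weight m nu s t * G s (scons t y)).
Proof.
move=> sG s0 cy; apply: bmfM; first by apply: var_weight_bmf; exact: Re_pos_lin.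
by apply: smooth_slice_bmf sG _ cy; rewrite /right_plane /half_plane /= oppr0.
Qed.

Lemma iterated_scale e G s y (c : C) : smooth right_plane (size e) G ->
  0 < complex.Re s -> cube y ->
  iterated (weights e s) (fun y => c * G s y) y = c * iterated (weights e s) (G s) y.
Proof.
move=> sG s0 cy; elim: e G sG => [|[m nu] e IH] G sG //=.
rewrite -(IH (integrate_out m nu G)); last exact: smooth_integrate_out_right.
apply: iterated_ext => // z cz; rewrite -cintMl.
- by apply: eq_cint => t _; rewrite mulrCA.
- exact: measurable_I01.
- exact: lebesgue_I01_fin.
- by apply: integrand_bmf => //; exact: (@smooth_le _ right_plane (size e).+1 1 G isT sG).
Qed.

Lemma half_plane_right M K G : 0 <= M -> smooth (half_plane M) K G -> smooth right_plane K G.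
Proof.
move=> M0; have sub s : right_plane s -> half_plane M s.
  by rewrite /right_plane /half_plane /= oppr0 => s0; apply: le_lt_trans s0; rewrite oppr_le0.
elim: K G => [|K IH] G; first by move=> h s /sub; exact: h.
move=> [hG dG]; split; first by move=> s /sub; exact: hG.
move=> i; have [G' [sG' dqG]] := dG i; exists G'; split; first exact: IH.
by move=> s /sub; exact: dqG.
Qed.

(** Regularizing in one variable leaves a smooth family in the others, with N fewer
    derivatives. *)
Lemma iterated_regularize M N K e G : 0 <= M ->
  (forall p, p \in e -> M * p.1%:R < N%:R) ->
  smooth (half_plane M) (K + size e * N.+1) G ->
  exists H, smooth (half_plane M) K H /\ forall s y, 0 < complex.Re s -> cube y ->
    H s y = (\prod_(p <- e) pole_factor p.1 p.2 N s) * iterated (weights e s) (G s) y.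
Proof.
move=> M0; elim: e G => [|[m nu] e IH] G eN sG.
  by exists G; split; [move: sG; rewrite addn0|move=> s y _ _; rewrite big_nil mul1r].
have mN : M * m%:R < N%:R by apply: (eN (m, nu)); rewrite inE eqxx.
have sG' : smooth (half_plane M) (N + (K + size e * N.+1)).+1 G.
  by rewrite -addSn addnCA; move: sG; rewrite /= mulSn.
have [H1 [sH1 H1E]] := regularize nu M0 mN sG'.
have [|H [sH HE]] := IH H1 _ sH1; first by move=> p pe; apply: eN; rewrite inE pe orbT.
exists H; split => // s y s0 cy; rewrite HE// big_cons /= [pole_factor m nu N s * _]mulrC -mulrA.
congr (_ * _).
rewrite -[RHS](iterated_scale (G := integrate_out m nu G))//.
  by apply: iterated_ext => // z cz; rewrite H1E.
apply: smooth_integrate_out_right; apply: half_plane_right M0 _; apply: smooth_le sG'.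
rewrite !ltnS (leq_trans _ (leq_addl _ _))// (leq_trans _ (leq_addl _ _))//.
by rewrite leq_pmulr.
Qed.

(** The order of integration in which the coordinates of a simplex come out. *)
Fixpoint outer_iterated n (w : nat -> R -> C) (F : (nat -> R) -> C) : C :=
  if n is n'.+1 then
    cint leb I01 (fun t => w n' t * outer_iterated n' w (fun y => F (upd y n' t)))
  else F (fun=> 0).

Lemma outer_iteratedS n w F : outer_iterated n.+1 w F =
  outer_iterated n (fun i => w i.+1) (fun y => cint leb I01 (fun t => w 0 t * F (scons t y))).
Proof.
elim: n F => [|n IH] F.
  rewrite /=; congr cint; apply/funext => t; congr (_ * F _).
  by apply/funext => -[|i].
rewrite [LHS]/= [RHS]/=; congr cint; apply/funext => t; congr (_ * _).
rewrite -/(outer_iterated n.+1 w (fun y => F (upd y n.+1 t))) IH.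
by congr outer_iterated; apply/funext => y; congr cint; apply/funext => u; rewrite scons_upd.
Qed.

Lemma outer_iteratedE n w F : outer_iterated n w F = iterated (mkseq w n) F (fun=> 0).
Proof.
elim: n w F => [|n IH] w F //; rewrite outer_iteratedS IH /mkseq /=.
by rewrite -[1%N]/(1 + 0)%N iotaDl -map_comp.
Qed.

Definition pow_factor m s t : C := if m == 0 then 1 else real_cpow t (m%:R * s).

Lemma var_weightE m nu s t : 0 <= t -> var_weight m nu s t = (t ^+ nu)%:C * pow_factor m s t.
Proof.
by move=> t0; rewrite /var_weight /pow_factor; case: eqP => _; rewrite ?mulr1// cpow_natr.
Qed.

(** Each power of a variable moves from the integrand to the weight of that variable. *)
Lemma iterated_pull (m nu : nat -> nat) n G s y : smooth right_plane n G ->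
  0 < complex.Re s -> cube y ->
  iterated (mkseq (fun i t => (t ^+ nu i)%:C : C) n)
    (fun y => (\prod_(i < n) pow_factor (m i) s (y i)) * G s y) y =
  iterated (weights (mkseq (fun i => (m i, nu i)) n) s) (G s) y.
Proof.
move=> sG s0 cy; elim: n m nu G sG => [|n IH] m nu G sG.
  by rewrite /= big_ord0 mul1r.
have sG1 : smooth right_plane 1 G by exact: (@smooth_le _ right_plane n.+1 1 G isT sG).
have := IH (fun i => m i.+1) (fun i => nu i.+1) (integrate_out (m 0%N) (nu 0%N) G)
  (smooth_integrate_out_right _ _ sG).
have E (T : Type) (f : nat -> T) : mkseq f n.+1 = f 0%N :: mkseq (fun i => f i.+1) n.
  by rewrite /mkseq /= -[1%N]/(1 + 0)%N iotaDl -map_comp.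
rewrite !E /= => <-; apply: iterated_ext => // z cz.
rewrite /integrate_out /int0 -cintMl.
- apply: eq_cint => t /I01E/andP[t0 t1]; rewrite big_ord_recl /= var_weightE//.
  set P := \prod_(i < n) pow_factor (m i.+1) s (z i).
  by ring.
- exact: measurable_I01.
- exact: lebesgue_I01_fin.
- exact: integrand_bmf.
Qed.

Lemma regularized_integral M N n (m : nat -> nat) G : 0 <= M ->
  (forall i, M * (m i)%:R < N%:R) -> (forall K, smooth (half_plane M) K G) ->
  exists h : C -> C, (forall s, half_plane M s -> exists f, hol f s h) /\
    forall s, 0 < complex.Re s ->
    h s = (\prod_(i < n) pole_factor (m i) i N s) *
      outer_iterated n (fun i t => (t ^+ i)%:C : C)
        (fun y => (\prod_(i < n) pow_factor (m i) s (y i)) * G s y).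
Proof.
move=> M0 mN sG; set e := mkseq (fun i => (m i, i)) n.
have [|H [sH HE]] := @iterated_regularize M N 0 e G M0 _ (sG _).
  by move=> p /mapP[i _ ->]; exact: mN.
have c0 : cube (fun=> 0 : R) by move=> i; rewrite lexx ler01.
exists (fun s => H s (fun=> 0)); split=> [s Ms|s s0].
  by have [f fP] := sH s Ms; exists f; exact: fP.
rewrite HE// outer_iteratedE iterated_pull//; last exact: half_plane_right (sG _).
by congr (_ * _); rewrite /e /mkseq big_map -(big_mkord xpredT (fun i => pole_factor (m i) i N s)) /index_iota subn0.
Qed.

End Regularization.

(** * Unordered sums *)

Lemma sum_fsetU (I : choiceType) (V : nmodType) (A B : {fset I}) (F : I -> V) :
  [disjoint A & B]%fset ->
  \sum_(i <- (A `|` B)%fset) F i = \sum_(i <- A) F i + \sum_(i <- B) F i.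
Proof.
move=> dAB; rewrite (big_fsetID _ (mem A)) /=; congr (_ + _); apply: eq_fbigl => i.
  by rewrite !inE /=; case: (i \in A); rewrite ?andbF.
rewrite !inE /=; case iA : (i \in A) => /=; last by rewrite andbT.
by rewrite (negPf (fdisjointP dAB i iA)).
Qed.

Section UnorderedSums.
Context {R : realType} {I : choiceType}.
Local Notation C := (cplx R).
Implicit Types (f g : I -> C) (S : C) (A : {fset I}).

Definition usum f S : Prop := partial_sum f @ totally --> S.

Lemma partial_sumE f A : partial_sum f A = \sum_(i <- A) f i.
Proof. by rewrite /partial_sum big_seq_fsetE. Qed.

Lemma usumP f S : usum f S <-> forall e : R, 0 < e -> exists A0 : {fset I},
  forall A, (A0 `<=` A)%fset -> nm (\sum_(i <- A) f i - S) < e.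
Proof.
have FF : Filter (@totally I) := @filter_filter _ _ (@totally_filter I).
split=> [H e e0|H].
  have [A0 _ AP] := (@cvgCP R _ _ FF _ _).1 H e e0.
  by exists A0 => A /AP /=; rewrite partial_sumE.
by apply/cvgCP => e /H[A0 AP]; exists A0 => // A /AP /=; rewrite partial_sumE.
Qed.

Lemma usum_ext f g S : (forall i, f i = g i) -> usum f S -> usum g S.
Proof. by move=> /funext ->. Qed.

Lemma usumD f g S S' : usum f S -> usum g S' -> usum (fun i => f i + g i) (S + S').
Proof.
move=> /usumP H /usumP H'; apply/usumP => e e0; have e20 : 0 < e / 2 by rewrite divr_gt0.
have [A AP] := H _ e20; have [A' AP'] := H' _ e20; exists (A `|` A')%fset => B BA.
rewrite big_split opprD addrACA; apply: le_lt_trans (nmD _ _) _; rewrite [e]splitr.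
apply: ltrD; first by apply: AP; apply: fsubset_trans BA; exact: fsubsetUl.
by apply: AP'; apply: fsubset_trans BA; exact: fsubsetUr.
Qed.

Lemma usumZ f S (a : C) : usum f S -> usum (fun i => a * f i) (a * S).
Proof.
move=> /usumP H; apply/usumP => e e0.
have a0 : 0 < nm a + 1 by rewrite ltr_wpDl ?nm_ge0.
have [A AP] := H _ (divr_gt0 e0 a0); exists A => B /AP h.
rewrite -mulr_sumr -mulrBr; apply: le_lt_trans (nmM _ _) _.
apply: le_lt_trans (_ : (nm a + 1) * nm (\sum_(i <- B) f i - S) < _).
  by rewrite ler_wpM2r ?nm_ge0// lerDl.
by rewrite mulrC -ltr_pdivlMr.
Qed.

Lemma usumB f g S S' : usum f S -> usum g S' -> usum (fun i => f i - g i) (S - S').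
Proof.
move=> uf ug; have := usumD uf (usumZ (a := -1) ug); rewrite mulN1r; apply: usum_ext => i.
by rewrite mulN1r.
Qed.

Lemma usum0 : usum (fun=> 0) 0.
Proof. by apply/usumP => e e0; exists fset0 => A _; rewrite big1// subrr nm0. Qed.

Lemma usum_sum (J : Type) (r : seq J) (F : J -> I -> C) (T : J -> C) :
  (forall j, usum (F j) (T j)) -> usum (fun i => \sum_(j <- r) F j i) (\sum_(j <- r) T j).
Proof.
move=> H; elim: r => [|j r IH].
  by rewrite big_nil; apply: usum_ext usum0 => i; rewrite big_nil.
by rewrite big_cons; apply: usum_ext (usumD (H j) IH) => i; rewrite big_cons.
Qed.

(** Absolute summability with its bound kept: the bounds are what passes to derivatives
    and to limits. *)
Definition abs_bound f (B : R) := forall A, \sum_(i <- A) nm (f i) <= B.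

Lemma abs_bound_ge0 f B : abs_bound f B -> 0 <= B.
Proof. by move/(_ fset0); rewrite big_seq_fset0. Qed.

Lemma abs_bound_le f g B (c : R) : 0 <= c -> (forall i, nm (g i) <= c * nm (f i)) ->
  abs_bound f B -> abs_bound g (c * B).
Proof.
move=> c0 gf fB A; apply: le_trans (_ : \sum_(i <- A) c * nm (f i) <= _).
  by apply: ler_sum => i _.
by rewrite -mulr_sumr ler_wpM2l.
Qed.

Lemma usum_nm f S B : abs_bound f B -> usum f S -> nm S <= B.
Proof.
move=> fB /usumP H; apply/ler_addgt0Pr => e e0; have [A AP] := H e e0.
have := AP A (fsubset_refl _); set x := \sum_(i <- A) _ => h.
rewrite (_ : S = x - (x - S)); last by rewrite subKr.
apply: le_trans (nmB _ _) _; apply: lerD; last exact: ltW.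
by apply: le_trans (nm_sum _ _ _) (fB A).
Qed.

Lemma real_sum_abs_le (h : I -> R) A (B : R) :
  (forall A', (A' `<=` A)%fset -> `|\sum_(i <- A') h i| <= B) ->
  \sum_(i <- A) `|h i| <= B + B.
Proof.
move=> H.
have filt (P : pred I) : \sum_(i <- A | P i) h i = \sum_(i <- [fset i in A | P i]%fset) h i.
  by rewrite big_fset.
have sub (P : pred I) : ([fset i in A | P i] `<=` A)%fset.
  by apply/fsubsetP => i; rewrite !inE => /andP[].
rewrite (bigID (fun i => 0 <= h i)) /=; apply: lerD.
  rewrite (eq_bigr h); last by move=> i /ger0_norm.
  by rewrite filt; apply: le_trans (ler_norm _) (H _ (sub _)).
rewrite (eq_bigr (fun i => - h i)); last by move=> i; rewrite -ltNge => /ltW/ler0_norm.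
by rewrite sumrN filt; apply: le_trans (ler_norm _) _; rewrite normrN; exact: H.
Qed.

(** Finite sums over sets avoiding a large finite set are bounded; applying this to the
    terms of one sign bounds the sums of absolute values. *)
Lemma usum_abs_bound f S : usum f S -> exists B, abs_bound f B.
Proof.
move=> /usumP/(_ 1 ltr01)[A0 A0P].
have key A : [disjoint A & A0]%fset -> nm (\sum_(i <- A) f i) <= 2.
  move=> dA; have h0 := A0P A0 (fsubset_refl _).
  have h1 := A0P (A `|` A0)%fset (fsubsetUr _ _).
  have E : \sum_(i <- (A `|` A0)%fset) f i = \sum_(i <- A) f i + \sum_(i <- A0) f i.
    exact: sum_fsetU.
  rewrite E in h1; set x := \sum_(i <- A) _ in h1 *; set y := \sum_(i <- A0) _ in h0 h1.
  rewrite (_ : x = (x + y - S) - (y - S)); last by ring.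
  by apply: le_trans (nmB _ _) _; rewrite (_ : 2 = 1 + 1)// lerD// ltW.
(* real and imaginary parts are split by sign; each of the four sums is at most 2 *)
exists (\sum_(i <- A0) nm (f i) + 8) => A.
rewrite -(fsetID A0 A) sum_fsetU /=; last first.
  by apply/fdisjointP => i; rewrite !inE => /andP[_ ->].
apply: lerD.
  rewrite -{2}(fsetID A A0) sum_fsetU /=; last first.
    by apply/fdisjointP => i; rewrite !inE => /andP[_ ->].
  by rewrite fsetIC lerDl sumr_ge0// => i _; exact: nm_ge0.
have dD : [disjoint (A `\` A0) & A0]%fset by apply/fdisjointP => i; rewrite !inE => /andP[].
rewrite /nm big_split /= (_ : 8 = (2 + 2) + (2 + 2)) ?lerD//; last by ring.
  apply: real_sum_abs_le => A' A'A; rewrite -Re_sum; apply: le_trans (Re_le_nm _) (key _ _).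
  by apply: fdisjointWl dD.
apply: real_sum_abs_le => A' A'A; rewrite -Im_sum; apply: le_trans (Im_le_nm _) (key _ _).
by apply: fdisjointWl dD.
Qed.

Lemma real_usum_nneg (h : I -> R) (B : R) : (forall i, 0 <= h i) ->
  (forall A, \sum_(i <- A) h i <= B) ->
  exists s : R, forall e : R, 0 < e -> exists A0 : {fset I},
    forall A, (A0 `<=` A)%fset -> `|\sum_(i <- A) h i - s| < e.
Proof.
move=> h0 hB; pose X := [set \sum_(i <- A) h i | A in [set: {fset I}]].
have X0 : X !=set0 by exists (\sum_(i <- fset0) h i), fset0.
have Xb : has_ubound X by exists B => _ [A _ <-].
exists (sup X) => e e0; have [_ [A0 _ <-] A0e] := sup_adherent e0 (conj X0 Xb).
exists A0 => A A0A.
have le1 : \sum_(i <- A0) h i <= \sum_(i <- A) h i.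
  rewrite -(fsetID A0 A) sum_fsetU /=.
    by rewrite (fsetIidPr A0A) lerDl sumr_ge0.
  by apply/fdisjointP => i; rewrite !inE => /andP[_ ->].
have le2 : \sum_(i <- A) h i <= sup X by apply: ub_le_sup => //; exists A.
by rewrite ltr_norml; apply/andP; split; lra.
Qed.

(** A bounded increasing net of finite sums converges to its supremum; split into
    nonnegative parts. *)
Lemma usum_exists f B : abs_bound f B -> exists S, usum f S /\ nm S <= B.
Proof.
move=> fB; have B0 := abs_bound_ge0 fB.
have half (h : I -> R) : (forall i, `|h i| <= nm (f i)) ->
    exists s : R, forall e : R, 0 < e -> exists A0 : {fset I},
    forall A, (A0 `<=` A)%fset -> `|\sum_(i <- A) h i - s| < e.
  move=> hf.
  have [||s sP] := @real_usum_nneg (fun i => h i + `|h i|) (B + B).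
  - by move=> i; have := ler_norm (- h i); rewrite normrN; lra.
  - move=> A; apply: le_trans (_ : \sum_(i <- A) (nm (f i) + nm (f i)) <= _).
      by apply: ler_sum => i _; rewrite lerD// (le_trans (ler_norm _)).
    by rewrite big_split lerD ?fB.
  have [||s' sP'] := @real_usum_nneg (fun i => `|h i|) B.
  - by move=> i.
  - by move=> A; apply: le_trans (fB A); apply: ler_sum => i _.
  exists (s - s') => e e0; have e20 : 0 < e / 2 by rewrite divr_gt0.
  have [A AP] := sP _ e20; have [A' AP'] := sP' _ e20; exists (A `|` A')%fset => D DA.
  have h1 := AP D (fsubset_trans (fsubsetUl _ _) DA).
  have h2 := AP' D (fsubset_trans (fsubsetUr _ _) DA).
  rewrite big_split /= in h1.
  set x := \sum_(i <- D) _ in h1 *; set y := \sum_(i <- D) _ in h1 h2.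
  rewrite (_ : _ - _ = (x + y - s) - (y - s')); last by ring.
  by apply: le_lt_trans (ler_normB _ _) _; rewrite [e]splitr ltrD.
have [s sP] := half (fun i => complex.Re (f i)) (fun i => Re_le_nm _).
have [s' sP'] := half (fun i => complex.Im (f i)) (fun i => Im_le_nm _).
have uS : usum f (s +i* s').
  apply/usumP => e e0; have e20 : 0 < e / 2 by rewrite divr_gt0.
  have [A AP] := sP _ e20; have [A' AP'] := sP' _ e20; exists (A `|` A')%fset => D DA.
  have h1 := AP D (fsubset_trans (fsubsetUl _ _) DA).
  have h2 := AP' D (fsubset_trans (fsubsetUr _ _) DA).
  by rewrite /nm ReB ImB Re_sum Im_sum [e]splitr ltrD.
by exists (s +i* s'); split => //; exact: usum_nm uS.
Qed.

End UnorderedSums.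

Lemma usum_reindex {R : realType} (I J : choiceType) (phi : J -> I) (psi : I -> J)
    (f : I -> cplx R) (S : cplx R) :
  cancel phi psi -> (forall i, phi (psi i) != i -> f i = 0) ->
  usum f S -> usum (f \o phi) S.
Proof.
move=> phiK f0 /usumP H; apply/usumP => e /H[A0 A0P].
exists (psi @` A0)%fset => B BA.
have inj : injective phi := can_inj phiK.
have -> : \sum_(j <- B) (f \o phi) j = \sum_(i <- (phi @` B)%fset) f i.
  by rewrite big_imfset//= => x y _ _ /inj.
have <- : \sum_(i <- ((phi @` B) `|` A0)%fset) f i = \sum_(i <- (phi @` B)%fset) f i.
  symmetry; apply: big_fset_incl; first exact: fsubsetUl.
  move=> i; rewrite inE => /orP[->//|iA0] niB; apply: f0; apply: contra niB => /eqP <-.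
  by apply/imfsetP; exists (psi i) => //=; apply: (fsubsetP BA); apply/imfsetP; exists i.
by apply: A0P; exact: fsubsetUr.
Qed.

(** * Analytic functions of several variables and their gradients *)

Section MonomialBounds.
Context {R : realType} (N : nat).
Local Notation C := (cplx R).
Local Notation MI := {ffun 'I_N -> nat}.
Implicit Types (z xi : 'rV[C]_N) (al be : MI) (r t d : R).

Definition weight al r : R := \prod_i r ^+ al i.

Lemma weight_ge0 al r : 0 <= r -> 0 <= weight al r.
Proof. by move=> r0; apply: prodr_ge0 => i _; exact: exprn_ge0. Qed.

Lemma nm_prod_le (I : Type) (s : seq I) (F : I -> C) (B : I -> R) :
  (forall i, nm (F i) <= B i) -> nm (\prod_(i <- s) F i) <= \prod_(i <- s) B i.
Proof.
move=> FB; elim: s => [|i s IH]; first by rewrite !big_nil nm1.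
by rewrite !big_cons; apply: le_trans (nmM _ _) _; apply: ler_pM; rewrite ?nm_ge0.
Qed.

Definition dmonomial al k z : C := (al k)%:R * \prod_i z 0 i ^+ (al i - (i == k)).

(** Splitting the majorant by order makes it multiplicative: the majorant of a product
    is the product of the majorants. Hence the remainder of a monomial is bounded by the
    same monomial at an enlarged radius. *)
Definition quad_expansion (F F' L : C) (M t : R) := exists m0 m1 m2 : R,
  [/\ 0 <= m0, 0 <= m1, 0 <= m2 & m0 + m1 + m2 <= M] /\
  [/\ nm F <= m0, nm L <= m1 * t & nm (F' - F - L) <= m2 * t ^+ 2].

Lemma quad_expansionM F F' L G G' H (M M' t : R) : 0 <= t <= 1 ->
  quad_expansion F F' L M t -> quad_expansion G G' H M' t ->
  quad_expansion (F * G) (F' * G') (F * H + G * L) (M * M') t.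
Proof.
move=> /andP[t0 t1] [m0 [m1 [m2 [[m00 m10 m20 mM] [F0 L0 R0]]]]].
move=> [n0 [n1 [n2 [[n00 n10 n20 nM] [G0 H0 S0]]]]].
exists (m0 * n0), (m0 * n1 + n0 * m1), (m0 * n2 + n0 * m2 + m1 * n1 + m1 * n2 + m2 * n1 + m2 * n2).
split; first split.
- by rewrite mulr_ge0.
- by rewrite addr_ge0 ?mulr_ge0.
- by rewrite !addr_ge0 ?mulr_ge0.
- apply: le_trans (ler_pM _ _ mM nM); rewrite ?addr_ge0//.
  by rewrite le_eqVlt; apply/orP; left; apply/eqP; ring.
have P x y (a b : R) : nm x <= a -> nm y <= b -> nm (x * y) <= a * b.
  by move=> xa yb; apply: le_trans (nmM _ _) _; apply: ler_pM; rewrite ?nm_ge0.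
split; first exact: P.
  apply: le_trans (nmD _ _) _; rewrite mulrDl -!mulrA; apply: lerD; exact: P.
set RF := F' - F - L in R0; set RG := G' - G - H in S0.
rewrite (_ : _ - _ = F * RG + G * RF + L * H + L * RG + RF * H + RF * RG); last by rewrite /RF /RG; ring.
have t2 : 0 <= t ^+ 2 by exact: sqr_ge0.
have tt : t * t ^+ 2 <= t ^+ 2 by rewrite ler_piMl.
have tt' : t ^+ 2 * t ^+ 2 <= t ^+ 2 by rewrite ler_piMl// exprn_ile1.
apply: le_trans (_ : m0 * (n2 * t ^+ 2) + n0 * (m2 * t ^+ 2) + (m1 * t) * (n1 * t) +
   (m1 * t) * (n2 * t ^+ 2) + (m2 * t ^+ 2) * (n1 * t) + (m2 * t ^+ 2) * (n2 * t ^+ 2) <= _).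
  by do !(apply: le_trans (nmD _ _) _; apply: lerD; last exact: P); exact: P.
have h1 : m1 * t * (n2 * t ^+ 2) <= m1 * n2 * t ^+ 2.
  by rewrite mulrACA; apply: ler_wpM2l => //; exact: mulr_ge0.
have h2 : m2 * t ^+ 2 * (n1 * t) <= m2 * n1 * t ^+ 2.
  by rewrite mulrACA [t ^+ 2 * t]mulrC; apply: ler_wpM2l => //; exact: mulr_ge0.
have h3 : m2 * t ^+ 2 * (n2 * t ^+ 2) <= m2 * n2 * t ^+ 2.
  by rewrite mulrACA; apply: ler_wpM2l => //; exact: mulr_ge0.
have h4 : m1 * t * (n1 * t) = m1 * n1 * t ^+ 2 by ring.
rewrite !mulrDl h4 !mulrA; rewrite !mulrA in h1 h2 h3.
by rewrite !lerD.
Qed.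

Lemma quad_expansionX (x h : C) n r d t : 0 <= t <= 1 -> 0 <= d -> nm x <= r -> nm h <= t * d ->
  quad_expansion (x ^+ n) ((x + h) ^+ n) (h * (n%:R * x ^+ n.-1)) ((r + d) ^+ n) t.
Proof.
move=> t01 d0 xr hd; have r0 := le_trans (nm_ge0 _) xr.
have q1 : quad_expansion x (x + h) h (r + d) t.
  exists r, d, 0; split; first by rewrite addr0.
  by rewrite mulrC; split => //; rewrite [x + h]addrC addrK subrr nm0 mul0r.
elim: n => [|n IH].
  exists 1, 0, 0; split; first by rewrite !expr0 !addr0.
  by rewrite !expr0 nm1 mul0r mulr0 nm0 !mul0r subrr subr0 nm0.
have := quad_expansionM t01 q1 IH; rewrite -!exprS.
rewrite (_ : x * _ + _ = h * (n.+1%:R * x ^+ n.+1.-1))//.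
by case: n {IH} => [|n] /=; rewrite ?expr0 -?natr1 ?exprS; ring.
Qed.

Lemma quad_expansion_prod al z xi r d t (s : seq 'I_N) : uniq s ->
  0 <= t <= 1 -> 0 <= d -> (forall i, nm (z 0 i) <= r) -> (forall i, nm (xi 0 i) <= t * d) ->
  quad_expansion (\prod_(i <- s) z 0 i ^+ al i) (\prod_(i <- s) (z + xi) 0 i ^+ al i)
   (\sum_(k <- s) xi 0 k * ((al k)%:R * \prod_(i <- s) z 0 i ^+ (al i - (i == k))))
   (\prod_(i <- s) (r + d) ^+ al i) t.
Proof.
move=> us t01 d0 zr xid; elim: s us => [|i0 s IH] /=.
  move=> _; rewrite !big_nil; exists 1, 0, 0; split; first by rewrite !addr0.
  by rewrite nm1 nm0 !mul0r subrr subr0 nm0.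
move=> /andP[i0s us]; rewrite !big_cons.
have := quad_expansionM t01 (quad_expansionX (al i0) t01 d0 (zr i0) (xid i0)) (IH us).
rewrite mxE; set L := (X in quad_expansion _ _ X); set L' := (X in _ -> quad_expansion _ _ X _ _).
suff -> : L = L' by [].
rewrite /L /L' addrC eqxx subn1; congr (_ + _).
  rewrite mulrC -!mulrA; congr (_ * (_ * (_ * _))); rewrite !big_seq; apply: eq_bigr => i is_.
  by case: eqP is_ i0s => [->|_ _ _]; [move=> ->|rewrite subn0].
rewrite mulr_sumr !big_seq; apply: eq_bigr => k ks; rewrite big_cons.
case: eqP ks i0s => [->|_ _ _]; first by move=> ->.
by rewrite subn0; ring.
Qed.

(** The bound is the general term of a convergent series as soon as r + d stays within
    the polyradius, so the expansion can be summed. *)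
Lemma monomial_quad al z xi r d t : 0 <= t <= 1 -> 0 <= d ->
  (forall i, nm (z 0 i) <= r) -> (forall i, nm (xi 0 i) <= t * d) ->
  nm (monomial al (z + xi) - monomial al z - \sum_k xi 0 k * dmonomial al k z) <=
  weight al (r + d) * t ^+ 2.
Proof.
move=> t01 d0 zr xid.
have [m0 [m1 [m2 [[m00 m10 m20 mM] [_ _ H]]]]] :=
  quad_expansion_prod al (index_enum_uniq _) t01 d0 zr xid.
apply: le_trans H _; apply: ler_wpM2r; first exact: sqr_ge0.
by apply: le_trans mM; rewrite lerDr addr_ge0.
Qed.

Lemma dmonomial_le al k z r d : 0 < d -> (forall i, nm (z 0 i) <= r) ->
  nm (dmonomial al k z) <= d^-1 * weight al (r + d).
Proof.
move=> d0 zr; rewrite -ler_pdivrMl ?invr_gt0// invrK.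
pose xi : 'rV[C]_N := \row_i (if i == k then d%:C else 0).
have xid i : nm (xi 0 i) <= 1 * d.
  by rewrite mxE mul1r; case: eqP => _; [rewrite nm_real gtr0_norm|rewrite nm0 ltW].
have t01 : 0 <= (1 : R) <= 1 by rewrite ler01 lexx.
have [m0 [m1 [m2 [[m00 m10 m20 mM] [_ H _]]]]] :=
  quad_expansion_prod al (index_enum_uniq _) t01 (ltW d0) zr xid.
move: H; rewrite mulr1 (bigD1_seq k) ?index_enum_uniq ?mem_index_enum//= [X in nm (_ + X)]big1 => [|i ik]; last first.
  by rewrite mxE (negPf ik) mul0r.
rewrite addr0 mxE eqxx nmMr gtr0_norm// => H; apply: le_trans H _; apply: le_trans mM.
by rewrite addrAC lerDr addr_ge0.
Qed.

End MonomialBounds.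

Section PowerSeriesManyVariables.
Context {R : realType} (N : nat).
Local Notation C := (cplx R).
Local Notation MI := {ffun 'I_N -> nat}.
Implicit Types (f : 'rV[C]_N -> C) (p z xi : 'rV[C]_N) (al be : MI) (r t d : R).

Lemma nbhs_rVC p (P : set 'rV[C]_N) :
  nbhs p P <-> exists2 e : R, 0 < e & forall z, (forall i, nm (z 0 i - p 0 i) < e) -> P z.
Proof.
split=> [[Q HQ QP]|[e e0 eP]].
  have [e eP] : exists e : 'I_1 -> 'I_N -> R, forall i j,
      0 < e i j /\ forall z : C, nm (z - p i j) < e i j -> Q i j z.
    have h i : exists e : 'I_N -> R, forall j, 0 < e j /\ forall z : C, nm (z - p i j) < e j -> Q i j z.
      have h1 j : exists e : R, 0 < e /\ forall z : C, nm (z - p i j) < e -> Q i j z.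
        by have /nbhsCP[e e0 eP] := HQ i j; exists e.
      by have [e eP] := choice h1; exists e.
    by have [e eP] := choice h; exists e.
  exists (\big[Num.min/1]_i e 0 i).
    by apply: lt_bigmin => // i _; case: (eP 0 i).
  move=> z zp; apply: QP => i j; rewrite (ord1 i); case: (eP 0 j) => _; apply.
  by apply: lt_le_trans (zp j) _; exact: bigmin_le.
exists (fun i j => [set z : C | nm (z - p i j) < e]); last first.
  by move=> z /= zP; apply: eP => i; exact: zP.
by move=> i j; apply/nbhsCP; exists e.
Qed.

Lemma analytic_local f p : analytic_at f p ->
  exists (a : MI -> C) (rho A : R), [/\ 0 < rho,
    abs_bound (fun al => a al * (weight al rho)%:C) A &
    forall z, (forall i, nm (z 0 i) <= rho) -> usum (fun al => a al * monomial al z) (f (p + z))].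
Proof.
move=> [a /nbhs_rVC[e e0 eP]]; exists a; pose rho := e / 2.
have r0 : 0 < rho by rewrite divr_gt0.
have re : rho < e by rewrite ltr_pdivrMr// ltr_pMr// ltr1n.
have us z : (forall i, nm (z 0 i) <= rho) -> usum (fun al => a al * monomial al z) (f (p + z)).
  move=> zr; have := eP (p + z); rewrite addrAC subrr add0r; apply => i.
  by rewrite mxE addrAC subrr add0r; exact: le_lt_trans (zr i) re.
have [|A AP] := usum_abs_bound (us (const_mx rho%:C) _).
  by move=> i; rewrite mxE nm_real gtr0_norm.
exists rho, A; split => // F; apply: le_trans (AP F).
rewrite le_eqVlt; apply/orP; left; apply/eqP; apply: eq_bigr => al _.
congr (nm (_ * _)); rewrite /weight rmorph_prod; apply: eq_bigr => i _.
by rewrite mxE rmorphXn.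
Qed.

Lemma analytic_at_usum f p (a : MI -> C) (rho : R) : 0 < rho ->
  (forall z, (forall i, nm (z 0 i) < rho) -> usum (fun al => a al * monomial al z) (f (p + z))) ->
  analytic_at f p.
Proof.
move=> r0 us; exists a; apply/nbhs_rVC; exists rho => // z zp.
have zE : p + (z - p) = z by rewrite addrC subrK.
have := us (z - p); rewrite zE; apply => i.
by rewrite !mxE.
Qed.

Definition is_grad f p (D : 'I_N -> C) := exists K r : R, 0 < r /\ forall xi t,
  0 <= t -> t <= r -> (forall i, nm (xi 0 i) <= t) ->
  nm (f (p + xi) - f p - \sum_k xi 0 k * D k) <= K * t ^+ 2.

Lemma is_grad_unique f p D D' : is_grad f p D -> is_grad f p D' -> D = D'.
Proof.
move=> [K [r [r0 H]]] [K' [r' [r'0 H']]]; apply/funext => k.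
apply/eqP; rewrite -subr_eq0; apply/eqP/nm_eq0/eqP; rewrite eq_le nm_ge0 andbT.
apply/ler_addgt0Pr => e e0; rewrite add0r.
set B := `|K| + `|K'| + 1; have B0 : 0 < B by rewrite ltr_wpDl ?addr_ge0.
pose t := Num.min (e / B) (Num.min r r').
have t0 : 0 < t by rewrite !lt_min r0 r'0 !andbT divr_gt0.
have tr : t <= r by rewrite !ge_min lexx /= orbT.
have tr' : t <= r' by rewrite !ge_min lexx /= !orbT.
have te : t <= e / B by rewrite ge_min lexx.
pose xi : 'rV[C]_N := \row_i (if i == k then t%:C else 0).
have xit i : nm (xi 0 i) <= t.
  by rewrite mxE; case: eqP => _; [rewrite nm_real gtr0_norm|rewrite nm0 ltW].
have sE (E : 'I_N -> C) : \sum_j xi 0 j * E j = t%:C * E k.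
  rewrite (bigD1 k)//= big1 => [|i ik]; last by rewrite mxE (negPf ik) mul0r.
  by rewrite addr0 mxE eqxx.
have h := H xi t (ltW t0) tr xit; have h' := H' xi t (ltW t0) tr' xit.
rewrite !sE in h h'.
have hh : nm (t%:C * (D k - D' k)) <= B * t ^+ 2.
  rewrite (_ : _ * _ = (f (p + xi) - f p - t%:C * D' k) - (f (p + xi) - f p - t%:C * D k)); last by ring.
  apply: le_trans (nmB _ _) _; apply: le_trans (lerD h' h) _; rewrite -mulrDl ler_wpM2r ?sqr_ge0//.
  rewrite addrC /B -addrA; apply: lerD; first exact: ler_norm.
  by apply: le_trans (ler_norm _) _; rewrite lerDl.
rewrite nmMr gtr0_norm// -ler_pdivlMl// in hh.
apply: le_trans hh _; rewrite mulrC expr2 -!mulrA mulfV ?gt_eqF// mulr1 mulrC.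
by rewrite -ler_pdivlMr.
Qed.

(** The gradient is singled out as the linear part of an expansion with quadratic
    remainder, which determines it. *)
Definition grad f p : 'I_N -> C := xget (fun=> 0) [set D | is_grad f p D].

Lemma gradE f p D : is_grad f p D -> grad f p = D.
Proof.
move=> H; apply: (@is_grad_unique f p) => //; rewrite /grad.
exact: (@xgetPex _ (fun=> 0) [set D | is_grad f p D] (ex_intro _ D H)).
Qed.

(** Absolute convergence at radius rho dominates both the differentiated series and the
    remainders of the monomials at half that radius. *)
Lemma grad_local f p : analytic_at f p -> exists (a : MI -> C) (rho A : R), [/\ 0 < rho,
  abs_bound (fun al => a al * (weight al rho)%:C) A,
  forall z k, (forall i, nm (z 0 i) <= rho / 2) ->
    usum (fun al => a al * dmonomial al k z) (grad f (p + z) k) &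
  forall z xi t, (forall i, nm (z 0 i) <= rho / 2) -> 0 <= t <= 1 ->
    (forall i, nm (xi 0 i) <= t * (rho / 2)) ->
    nm (f (p + z + xi) - f (p + z) - \sum_k xi 0 k * grad f (p + z) k) <= A * t ^+ 2].
Proof.
move=> /analytic_local[a [rho [A [r0 aA us]]]]; exists a, rho, A.
have r20 : 0 < rho / 2 by rewrite divr_gt0.
have rr : rho / 2 + rho / 2 = rho by rewrite -splitr.
have ex z : exists T : 'I_N -> C, (forall i, nm (z 0 i) <= rho / 2) ->
    forall k, usum (fun al => a al * dmonomial al k z) (T k).
  have [zr|nzr] := pselect (forall i, nm (z 0 i) <= rho / 2); last by exists (fun=> 0).
  suff h k : exists T : C, usum (fun al => a al * dmonomial al k z) T.
    by have [T TP] := choice h; exists T.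
  have b : abs_bound (fun al => a al * dmonomial al k z) ((rho / 2)^-1 * A).
    apply: abs_bound_le aA; first by rewrite invr_ge0 ltW.
    move=> al; apply: le_trans (nmM _ _) _.
    rewrite [a al * _]mulrC nmMr ger0_norm; last by rewrite weight_ge0// ltW.
    rewrite mulrC mulrA; apply: ler_wpM2r; first exact: nm_ge0.
    by apply: le_trans (dmonomial_le al k r20 zr) _; rewrite rr.
  by have [T [TP _]] := usum_exists b; exists T.
have [T TP] := choice ex.
have key z xi t : (forall i, nm (z 0 i) <= rho / 2) -> 0 <= t <= 1 ->
    (forall i, nm (xi 0 i) <= t * (rho / 2)) ->
    nm (f (p + z + xi) - f (p + z) - \sum_k xi 0 k * T z k) <= A * t ^+ 2.
  move=> zr t01 xit; have /andP[t0 t1] := t01.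
  have u1 : usum (fun al => a al * monomial al (z + xi)) (f (p + z + xi)).
    rewrite -addrA; apply: us => i; rewrite mxE -rr; apply: le_trans (nmD _ _) _; apply: lerD => //.
    by apply: le_trans (xit i) _; rewrite ler_piMl// ltW.
  have u2 : usum (fun al => a al * monomial al z) (f (p + z)).
    by apply: us => i; apply: le_trans (zr i) _; rewrite ler_pdivrMr// ler_peMr ?ler1n// ltW.
  have u3 : usum (fun al => \sum_k xi 0 k * (a al * dmonomial al k z)) (\sum_k xi 0 k * T z k).
    by apply: usum_sum => k; apply: usumZ; exact: TP.
  have u := usumB (usumB u1 u2) u3.
  rewrite mulrC; apply: usum_nm u; apply: abs_bound_le aA; first exact: sqr_ge0.
  move=> al; rewrite [a al * _%:C]mulrC nmMr ger0_norm; last by rewrite weight_ge0// ltW.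
  rewrite (_ : _ - _ = a al * (monomial al (z + xi) - monomial al z - \sum_k xi 0 k * dmonomial al k z)); last first.
    by rewrite !mulrBr mulr_sumr; congr (_ - _); apply: eq_bigr => k _; rewrite mulrCA.
  apply: le_trans (nmM _ _) _; rewrite mulrC mulrA; apply: ler_wpM2r; first exact: nm_ge0.
  by rewrite mulrC; apply: le_trans (monomial_quad al t01 (ltW r20) zr xit) _; rewrite rr.
have gT z : (forall i, nm (z 0 i) <= rho / 2) -> grad f (p + z) = T z.
  move=> zr; apply: gradE; exists (A * (rho / 2)^-1 ^+ 2), (rho / 2); split => // xi t t0 tr xit.
  have := key z xi (t / (rho / 2)) zr; rewrite divfK ?gt_eqF// => /(_ _ xit).
  rewrite exprMn mulrA mulrAC; apply.
  by rewrite divr_ge0 ?(ltW r20)//= ler_pdivrMr// mul1r.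
split => //.
- by move=> z k zr; rewrite gT//; exact: TP.
- by move=> z xi t zr t01 xit; rewrite gT//; exact: key.
Qed.

(** Lowering the exponent of the k-th variable by one reindexes the differentiated
    series as a power series. *)
Lemma grad_analytic f p k : analytic_at f p -> analytic_at (fun q => grad f q k) p.
Proof.
move=> /grad_local[a [rho [A [r0 _ us _]]]].
pose up be : MI := [ffun i => (be i + (i == k))%N].
pose down al : MI := [ffun i => (al i - (i == k))%N].
have upK : cancel up down by move=> be; apply/ffunP => i; rewrite !ffunE addnK.
apply: (@analytic_at_usum _ _ (fun be => a (up be) * (be k).+1%:R) (rho / 2)).
  by rewrite divr_gt0.
move=> z zr; have zr' i : nm (z 0 i) <= rho / 2 by exact: ltW.
have := usum_reindex upK _ (us z k zr').
move=> H; apply: usum_ext (H _) => [be|al ne] /=.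
  rewrite /dmonomial /up !ffunE eqxx addn1 -mulrA; congr (_ * (_ * _)).
  by apply: eq_bigr => i _; rewrite ffunE addnK.
suff -> : dmonomial al k z = 0 by rewrite mulr0.
rewrite /dmonomial; have [->|al0] := posnP (al k); first by rewrite mul0r.
case/eqP: ne; apply/ffunP => i; rewrite !ffunE subnK//.
by case: eqP => // ->.
Qed.

End PowerSeriesManyVariables.

(** * Analytic functions along a compact set of real points *)

Section AnalyticFamily.
Context {R : realType} (n : nat).
Local Notation C := (cplx R).
Local Notation cp := (@complex_point R n).
Implicit Types (s w : C) (x : 'rV[R]_n) (E : 'rV[C]_(1 + n) -> C).

Let i0 : 'I_(1 + n) := lshift n ord0.

Lemma complex_point_l s x : cp s x 0 i0 = s.
Proof. by rewrite /complex_point row_mxEl mxE. Qed.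

Lemma complex_point_r s x j : cp s x 0 (rshift 1 j) = (x 0 j)%:C.
Proof. by rewrite /complex_point row_mxEr mxE. Qed.

Lemma complex_pointP (P : C -> Prop) s x : P s -> (forall j, P (x 0 j)%:C) ->
  forall i, P (cp s x 0 i).
Proof.
move=> Ps Px i; case: (split_ordP i) => j ->; last by rewrite complex_point_r.
by rewrite (ord1 j) complex_point_l.
Qed.

Lemma complex_pointB s x s' x' : cp s x - cp s' x' = cp (s - s') (x - x').
Proof.
apply/rowP => i; rewrite mxE [X in _ + X]mxE /complex_point.
case: (split_ordP i) => j ->; last by rewrite !row_mxEr !mxE rmorphB.
by rewrite !row_mxEl (ord1 j) !mxE !eqxx.
Qed.

Lemma monomial_complex_point (al : {ffun 'I_(1 + n) -> nat}) w x :
  monomial al (cp w x) = w ^+ al i0 * monomial al (cp 1 x).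
Proof.
rewrite /monomial (bigD1 i0)//= [in RHS](bigD1 i0)//= !complex_point_l expr1n mul1r.
congr (_ * _); apply: eq_bigr => i ii0; case: (split_ordP i) ii0 => j ->.
  by rewrite (ord1 j) eqxx.
by rewrite !complex_point_r.
Qed.

(** Group the multi-indices by the exponent of the first variable. *)
Lemma hol_slice_local E s0 x0 : analytic_at E (cp s0 x0) ->
  exists (e r : R), 0 < r /\ forall x, (forall j, `|x 0 j - x0 0 j| <= r) ->
    hol e s0 (fun s => E (cp s x)).
Proof.
move=> /analytic_local[a [rho [A [r0 aA us]]]].
have A0 := abs_bound_ge0 aA.
pose e := Num.min (A + 1)^-1 (rho / 2).
have A1 : 0 < A + 1 by rewrite ltr_wpDl.
have e0 : 0 < e by rewrite lt_min invr_gt0 A1 divr_gt0.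
have eA : A <= e^-1.
  by rewrite (le_trans (_ : A <= A + 1)) ?lerDl// -[A + 1]invrK lef_pV2 ?posrE ?invr_gt0// ge_min lexx.
have er : e <= rho / 2 by rewrite ge_min lexx orbT.
have r1 : rho^-1 <= e^-1.
  rewrite lef_pV2 ?posrE//; apply: le_trans er _.
  by rewrite ler_pdivrMr// ler_peMr ?ler1n// ltW.
exists e, rho; split => // x xr.
set u := cp 1 (x - x0).
have mono_le al : nm (monomial al u) <= rho^-1 ^+ al i0 * weight al rho.
  rewrite /monomial /weight (bigD1 i0)//= [in X in _ <= X](bigD1 i0)//= complex_point_l expr1n mul1r.
  rewrite mulrA exprVn mulVf ?expf_neq0 ?gt_eqF// mul1r.
  rewrite big_mkcond [X in _ <= X]big_mkcond; apply: nm_prod_le => i.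
  case: ifPn => ii0; last by rewrite nm1.
  apply: le_trans (nmX _ _) _; rewrite lerXn2r ?nnegrE ?nm_ge0 ?(ltW r0)//.
  case: (split_ordP i) ii0 => j ->; first by rewrite (ord1 j) eqxx.
  by rewrite complex_point_r nm_real !mxE.
have term_le al : nm (a al * monomial al u) <= rho^-1 ^+ al i0 * nm (a al * (weight al rho)%:C).
  apply: le_trans (nmM _ _) _; rewrite [a al * _%:C]mulrC nmMr ger0_norm; last by rewrite weight_ge0// ltW.
  by rewrite mulrA mulrC; apply: ler_wpM2r; rewrite ?nm_ge0.
have ch (k : nat) : exists c : C, usum (fun al : {ffun 'I_(1 + n) -> nat} => if al i0 == k then a al * monomial al u else 0) c /\
    nm c <= rho^-1 ^+ k * A.
  apply: usum_exists; apply: abs_bound_le aA; first by rewrite exprn_ge0// invr_ge0 ltW.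
  move=> al; case: eqP => [<-//|_]; rewrite nm0 mulr_ge0 ?nm_ge0// exprn_ge0// invr_ge0 ltW//.
have [c cP] := choice ch.
split => //; exists c; split => [k|s hs].
  have [_ ck] := cP k; apply: le_trans ck _; rewrite mulrC; apply: ler_pM => //.
    by rewrite exprn_ge0// invr_ge0 ltW.
  by rewrite lerXn2r ?nnegrE ?invr_ge0 ?(ltW r0) ?(ltW e0).
set w := s - s0.
have wr : nm w <= rho / 2 by apply: le_trans er; exact: ltW.
have tot : usum (fun al : {ffun 'I_(1 + n) -> nat} => a al * monomial al (cp w (x - x0))) (E (cp s x)).
  have -> : cp s x = cp s0 x0 + cp w (x - x0) by rewrite -complex_pointB addrC subrK.
  apply: us; apply: (@complex_pointP (fun z => nm z <= rho)) => [|j]; last by rewrite nm_real !mxE.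
  by apply: le_trans wr _; rewrite ler_pdivrMr// ler_peMr ?ler1n// ltW.
apply: (cvgC_nm0 (v := fun m => A * 2^-1 ^+ m)); last exact: half_pow_cvg0.
move=> m; rewrite nmBC.
have part : usum (fun al : {ffun 'I_(1 + n) -> nat} => \sum_(0 <= k < m) w ^+ k * (if al i0 == k then a al * monomial al u else 0))
    (series (fun k => c k * w ^+ k) m).
  rewrite /series /=; under [X in usum _ X]eq_bigr do rewrite mulrC.
  by apply: usum_sum => k; apply: usumZ; case: (cP k).
have := usumB tot part; apply: usum_nm; rewrite mulrC.
apply: abs_bound_le aA => [|al]; first exact: exprn_ge0.
have -> : \sum_(0 <= k < m) w ^+ k * (if al i0 == k then a al * monomial al u else 0) =
    if (al i0 < m)%N then w ^+ al i0 * (a al * monomial al u) else 0.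
  rewrite big_mkord; case: ltnP => alm.
    rewrite (bigD1 (Ordinal alm))//= eqxx big1 ?addr0// => i ine.
    case: eqP => [E1|_]; last by rewrite mulr0.
    by case/eqP: ine; apply: val_inj.
  rewrite big1// => i _; case: eqP => [E1|_]; last by rewrite mulr0.
  by move: (ltn_ord i); rewrite -E1 ltnNge alm.
rewrite monomial_complex_point -/u; case: ltnP => alm.
  by rewrite mulrCA subrr nm0 mulr_ge0 ?nm_ge0// exprn_ge0.
rewrite subr0 mulrCA; apply: le_trans (nmM _ _) _.
apply: le_trans (ler_pM (nm_ge0 _) (nm_ge0 _) (nmX _ _) (term_le _)) _.
rewrite mulrA -exprMn; apply: ler_wpM2r; first exact: nm_ge0.
apply: le_trans (_ : 2^-1 ^+ al i0 <= _).
  rewrite lerXn2r ?nnegrE ?mulr_ge0 ?nm_ge0 ?invr_ge0 ?(ltW r0)//.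
  by rewrite -ler_pdivlMr ?invr_gt0// invrK mulrC.
by rewrite ler_wiXn2l// invf_le1// ler1n.
Qed.

Lemma nbhs_rVR x0 (r : R) : 0 < r -> \forall x \near x0, forall j, `|(x : 'rV[R]_n) 0 j - x0 0 j| <= r.
Proof.
move=> r0; apply/nbhs_ballP; exists r => // x [_ xr] j.
by have := xr 0 j; rewrite /ball /= distrC => /ltW.
Qed.

Variable V : set 'rV[R]_n.
Hypothesis cV : compact V.

(** Compactness as a covering property, applied to the filter of small positive e. *)
Lemma uniform_on_compact (P : R -> 'rV[R]_n -> Prop) :
  (forall x, V x -> exists e0 r : R, [/\ 0 < e0, 0 < r & forall x' e, 0 < e < e0 ->
     (forall j, `|x' 0 j - x 0 j| <= r) -> P e x']) ->
  exists2 e : R, 0 < e & forall x, V x -> P e x.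
Proof.
move=> H.
have H' x : V x -> \forall x' \near x & i \near 0^'+, P i x'.
  move=> Vx; have [e0 [r [e00 r0 eP]]] := H x Vx.
  exists ([set x' : 'rV[R]_n | forall j, `|x' 0 j - x 0 j| <= r], [set e | 0 < e < e0]).
    split; first exact: nbhs_rVR.
    near=> e; apply/andP; split => //; near: e; exact: nbhs_right_lt.
  by move=> [x' e] /= [x'r e0e]; exact: eP.
have FF : Filter (0^'+ : set_system R) by exact: at_right_proper_filter.
have G := (compact_near_coveringP V).1 cV R _ P FF H'.
have G0 : \forall e \near 0^'+, 0 < e :> R by near=> e.
have [e [e0 eP]] := @filter_ex _ _ (at_right_proper_filter (0 : R)) _ (filterI G0 G).
by exists e.
Unshelve. all: by end_near. Qed.

Lemma hol_slice_uniform E s0 : (forall x, V x -> analytic_at E (cp s0 x)) ->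
  exists e, forall x, V x -> hol e s0 (fun s => E (cp s x)).
Proof.
move=> EV; have [|e e0 eP] := @uniform_on_compact (fun e x => hol e s0 (fun s => E (cp s x))).
  move=> x Vx; have [e [r [r0 H]]] := hol_slice_local (EV x Vx).
  exists e, r; split => //.
    by have := H x; case=> // j; rewrite subrr normr0 ltW.
  by move=> x' e' /andP[e'0 e'e] x'r; apply: hol_le (H x' x'r) => //; exact: ltW.
by exists e.
Qed.

Lemma bounded_slice E s : (forall x, V x -> analytic_at E (cp s x)) ->
  exists2 B : R, 0 <= B & forall x, V x -> nm (E (cp s x)) <= B.
Proof.
move=> /hol_slice_uniform[e eP]; exists `|e^-1| => // x Vx.
by apply: le_trans (hol_val (eP x Vx)) _; exact: ler_norm.
Qed.

Definition partial E j s x : C := grad E (cp s x) (rshift 1 j).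

(** Near each other the points are covered by the local expansions; otherwise t is
    bounded below and boundedness of the function and of its gradient suffices. *)
Lemma quad_slice_uniform E s : (forall x, V x -> analytic_at E (cp s x)) ->
  exists2 K : R, 0 <= K & forall x x' t, V x -> V x' -> 0 <= t ->
    (forall j, `|x' 0 j - x 0 j| <= t) ->
    nm (E (cp s x') - E (cp s x) - \sum_j (x' 0 j - x 0 j)%:C * partial E j s x) <= K * t ^+ 2.
Proof.
move=> EV.
have [e [e0 eP]] : exists e : R, 0 < e /\ forall x, V x -> forall x' t, 0 <= t -> t <= e ->
    (forall j, `|x' 0 j - x 0 j| <= t) ->
    nm (E (cp s x') - E (cp s x) - \sum_j (x' 0 j - x 0 j)%:C * partial E j s x) <= e^-1 * t ^+ 2.
  have [|e e0 eP] := @uniform_on_compact (fun e x => forall x' t, 0 <= t -> t <= e ->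
    (forall j, `|x' 0 j - x 0 j| <= t) ->
    nm (E (cp s x') - E (cp s x) - \sum_j (x' 0 j - x 0 j)%:C * partial E j s x) <= e^-1 * t ^+ 2);
    last by exists e.
  move=> x0 Vx0; have [a [rho [A [r0 aA _ H]]]] := grad_local (EV x0 Vx0).
  have A0 := abs_bound_ge0 aA; have r20 : 0 < rho / 2 by rewrite divr_gt0.
  pose B := A * (rho / 2)^-1 ^+ 2 + 1.
  have B0 : 0 < B by rewrite ltr_wpDl// mulr_ge0// exprn_ge0// invr_ge0 ltW.
  exists (Num.min (rho / 2) B^-1), (rho / 2); split => //.
    by rewrite lt_min r20 invr_gt0.
  move=> x e /andP[e0]; rewrite lt_min => /andP[er eB] xr x' t t0 te x't.
  have zx : cp s x0 + (cp s x - cp s x0) = cp s x by rewrite addrC subrK.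
  have zx' : cp s x0 + (cp s x - cp s x0) + (cp s x' - cp s x) = cp s x' by rewrite zx addrC subrK.
  have := H (cp s x - cp s x0) (cp s x' - cp s x) (t / (rho / 2)).
  rewrite zx' zx divfK ?gt_eqF// => /(_ _ _ _)/le_trans H'.
  have -> : \sum_j (x' 0 j - x 0 j)%:C * partial E j s x =
      \sum_k (cp s x' - cp s x) 0 k * grad E (cp s x) k.
    rewrite complex_pointB big_split_ord /= big_ord1.
    rewrite complex_point_l subrr mul0r add0r; apply: eq_bigr => j _.
    by rewrite complex_point_r !mxE.
  apply: H'.
  - rewrite complex_pointB; apply: (@complex_pointP (fun z => nm z <= rho / 2)) => [|j].
      by rewrite subrr nm0 ltW.
    by rewrite nm_real !mxE.
  - rewrite divr_ge0 ?(ltW r20)//= ler_pdivrMr// mul1r.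
    by apply: le_trans te _; exact: ltW.
  - rewrite complex_pointB; apply: (@complex_pointP (fun z => nm z <= t)) => [|j].
      by rewrite subrr nm0.
    by rewrite nm_real !mxE.
  - rewrite exprMn mulrA mulrAC; apply: ler_wpM2r; first exact: sqr_ge0.
    apply: le_trans (_ : B <= _); first by rewrite lerDl.
    by rewrite -[B]invrK lef_pV2 ?posrE ?invr_gt0// ltW.
have [B B0 BP] := bounded_slice EV.
have [D DP] : exists D : 'I_n -> R, forall j, 0 <= D j /\ forall x, V x -> nm (partial E j s x) <= D j.
  suff h j : exists D : R, 0 <= D /\ forall x, V x -> nm (partial E j s x) <= D.
    by have [D DP] := choice h; exists D.
  have [|D D0 DP] := @bounded_slice (fun q => grad E q (rshift 1 j)) s.
    by move=> x Vx; apply: grad_analytic; exact: EV.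
  by exists D.
pose S := \sum_j D j; have S0 : 0 <= S by apply: sumr_ge0 => j _; case: (DP j).
exists (e^-1 + (2 * B * e^-1 ^+ 2 + S * e^-1)).
  by rewrite !addr_ge0 ?mulr_ge0 ?exprn_ge0 ?invr_ge0// ltW.
move=> x x' t Vx Vx' t0 x't; have [te|et] := leP t e.
  apply: le_trans (eP x Vx x' t t0 te x't) _; apply: ler_wpM2r; first exact: sqr_ge0.
  by rewrite lerDl !addr_ge0 ?mulr_ge0 ?exprn_ge0 ?invr_ge0// ltW.
have t1 : 1 <= t * e^-1 by rewrite ler_pdivlMr// mul1r ltW.
apply: le_trans (_ : 2 * B + S * t <= _).
  apply: le_trans (nmB _ _) _; apply: lerD.
    by apply: le_trans (nmB _ _) _; rewrite mulr_natl mulr2n lerD// BP.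
  apply: le_trans (nm_sum _ _ _) _; rewrite mulr_suml; apply: ler_sum => j _.
  by rewrite nmMr mulrC; apply: ler_pM; rewrite ?nm_ge0//; case: (DP j) => _; apply.
apply: le_trans (_ : (2 * B * e^-1 ^+ 2 + S * e^-1) * t ^+ 2 <= _); last first.
  by rewrite ler_wpM2r ?sqr_ge0// lerDr invr_ge0 ltW.
rewrite [X in _ <= X]mulrDl; apply: lerD.
  by rewrite -mulrA -exprMn ler_peMr ?mulr_ge0// mulrC exprn_ege1.
by rewrite expr2 -mulrA; apply: ler_wpM2l => //; rewrite mulrA [e^-1 * t]mulrC ler_peMl.
Qed.

End AnalyticFamily.

(** * Families built from polynomials in the cube coordinates *)

Section PolynomialComposition.
Context {R : realType}.
Local Notation C := (cplx R).
Local Notation fam := (C -> (nat -> R) -> C).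
Implicit Types (p q h : (nat -> R) -> R) (y : nat -> R) (s a : C) (i N : nat) (u v : R).

(** An inductive predicate on functions: facts about polynomials, such as the existence
    of partial derivatives, follow by induction on their construction. *)
Inductive rpoly : ((nat -> R) -> R) -> Prop :=
| rpoly_cst c : rpoly (fun=> c)
| rpoly_coord i : rpoly (fun y => y i)
| rpoly_add p q : rpoly p -> rpoly q -> rpoly (fun y => p y + q y)
| rpoly_mul p q : rpoly p -> rpoly q -> rpoly (fun y => p y * q y).

Lemma smooth_rpoly (Om : set C) N p : rpoly p -> smooth Om N (fun _ y => (p y)%:C).
Proof.
elim=> [c|i|p1 p2 _ IH1 _ IH2|p1 p2 _ IH1 _ IH2].
- exact: smooth_cst.
- exact: smooth_coord.
- by apply: smooth_ext (smooth_add IH1 IH2) => s y _; rewrite rmorphD.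
- by apply: smooth_ext (smooth_mul IH1 IH2) => s y _; rewrite rmorphM.
Qed.

Lemma rpoly_bound p : rpoly p -> exists2 B : R, 0 <= B & forall y, cube y -> `|p y| <= B.
Proof.
move=> rp; have [] := @hol_unif_bound _ setT (fun _ y => (p y)%:C) 0 (smooth_hol_unif (@smooth_rpoly setT 0 p rp)).
  by [].
by move=> B B0 BP; exists B => // y /BP; rewrite nm_real.
Qed.

Lemma rpoly_der p i : rpoly p -> exists p', rpoly p' /\ exists2 K : R, 0 <= K &
  forall y u, cube y -> 0 <= u <= 1 ->
  `|p (upd y i u) - p y - (u - y i) * p' y| <= K * (u - y i) ^+ 2.
Proof.
elim=> [c|j|p1 p2 _ [p1' [r1 [K1 K10 H1]]] _ [p2' [r2 [K2 K20 H2]]]|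
  p1 p2 rp1 [p1' [r1 [K1 K10 H1]]] rp2 [p2' [r2 [K2 K20 H2]]]].
- exists (fun=> 0); split; first exact: rpoly_cst.
  by exists 0 => // y u _ _; rewrite mulr0 subrr subr0 normr0 mul0r.
- exists (fun=> (j == i)%:R); split; first exact: rpoly_cst.
  exists 0 => // y u _ _; rewrite mul0r /upd; case: eqP => [->|_].
    by rewrite mulr1 subrr normr0.
  by rewrite mulr0 subr0 subrr normr0.
- exists (fun y => p1' y + p2' y); split; first exact: rpoly_add.
  exists (K1 + K2) => [|y u cy u01]; first exact: addr_ge0.
  rewrite [X in _ <= X]mulrDl; apply: le_trans (lerD (H1 y u cy u01) (H2 y u cy u01)).
  apply: le_trans (ler_normD _ _); rewrite le_eqVlt; apply/orP; left; apply/eqP; congr `|_|; ring.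
- exists (fun y => p1' y * p2 y + p1 y * p2' y); split.
    by apply: rpoly_add; exact: rpoly_mul.
  have [B1 B10 b1] := rpoly_bound rp1; have [B2 B20 b2] := rpoly_bound rp2.
  have [B1' B1'0 b1'] := rpoly_bound r1; have [B2' B2'0 b2'] := rpoly_bound r2.
  exists (K1 * B2 + B1' * (K2 + B2') + B1 * K2).
    by rewrite !addr_ge0 ?mulr_ge0// addr_ge0.
  move=> y u cy u01; have cu := cube_upd i cy u01.
  set x := u - y i; set g := p1 y; set gu := p1 (upd y i u); set g' := p1' y.
  set f := p2 y; set fu := p2 (upd y i u); set f' := p2' y.
  have k1 := H1 y u cy u01; have k2 := H2 y u cy u01.
  rewrite -/g -/gu -/g' -/f -/fu -/f' -/x in k1 k2.
  have x1 : `|x| <= 1.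
    by rewrite ler_norml; have /andP[] := cy i; case/andP: u01; rewrite /x; lra.
  have xx : x ^+ 2 = `|x| * `|x| by rewrite -expr2 real_normK ?num_real.
  have fd : `|fu - f| <= (K2 + B2') * `|x|.
    rewrite -[fu - f](subrK (x * f')); apply: le_trans (ler_normD _ _) _.
    rewrite [X in _ <= X]mulrDl; apply: lerD; last by rewrite normrM mulrC ler_wpM2r// b2'.
    by apply: le_trans k2 _; apply: ler_wpM2l => //; rewrite xx ler_piMl.
  rewrite (_ : _ - _ = (gu - g - x * g') * fu + x * (g' * (fu - f)) + g * (fu - f - x * f')); last by ring.
  apply: le_trans (ler_normD _ _) _; rewrite [X in _ <= X]mulrDl; apply: lerD; last first.
    by rewrite normrM -mulrA; apply: ler_pM => //; exact: b1.
  apply: le_trans (ler_normD _ _) _; rewrite [X in _ <= X]mulrDl; apply: lerD.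
    by rewrite normrM mulrAC; apply: ler_pM => //; exact: b2.
  rewrite !normrM; apply: le_trans (_ : `|x| * (B1' * ((K2 + B2') * `|x|)) <= _).
    by apply: ler_wpM2l => //; apply: ler_pM => //; exact: b1'.
  by rewrite xx le_eqVlt; apply/orP; left; apply/eqP; ring.
Qed.

Lemma rpoly_lip p i : rpoly p -> exists2 L : R, 0 <= L & forall y u, cube y -> 0 <= u <= 1 ->
  `|p (upd y i u) - p y| <= L * `|u - y i|.
Proof.
move=> rp; have [p' [rp' [K K0 KP]]] := rpoly_der i rp; have [B B0 BP] := rpoly_bound rp'.
exists (K + B) => [|y u cy u01]; first exact: addr_ge0.
set x := u - y i; rewrite -[_ - p y](subrK (x * p' y)).
have x1 : `|x| <= 1.
  by rewrite ler_norml; have /andP[] := cy i; case/andP: u01; rewrite /x; lra.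
apply: le_trans (ler_normD _ _) _; rewrite [X in _ <= X]mulrDl; apply: lerD.
  apply: le_trans (KP y u cy u01) _; apply: ler_wpM2l => //.
  by rewrite -real_normK ?num_real// expr2 ler_piMl.
by rewrite normrM mulrC ler_wpM2r// BP.
Qed.

Lemma nm_cexp_quad (z : C) : nm (cexp z - 1 - z) <= nm z ^+ 2 * expR (nm z).
Proof.
have cv := cvgC_Br (a := 1 + z) (@cvgC_shift _ 2 _ _ (@cexp_series R z)).
rewrite -addrA -opprD; apply: (cvgC_nm_le cv) => n.
rewrite addn2 /series /= big_nat_recl//= big_nat_recl//= expr0 expr1 fact0 !divr1 addrA [1 + z + _]addrC addrK.
apply: le_trans (nm_sum _ _ _) _.
apply: le_trans (_ : \sum_(0 <= i < n) nm z ^+ 2 * (exp_coeff (nm z) i) <= _).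
  apply: ler_sum => i _; apply: le_trans (nmM _ _) _; rewrite nm_fact_inv.
  rewrite /exp_coeff /= mulrA -exprD; apply: ler_pM; rewrite ?nm_ge0// ?invr_ge0//.
    by rewrite add2n; exact: nmX.
  by rewrite lef_pV2 ?posrE ?ltr0n ?fact_gt0// ler_nat leq_fact//; rewrite leqW.
rewrite -mulr_sumr; apply: ler_wpM2l; first exact: sqr_ge0.
have := @nondecreasing_cvgn_le _ (series (exp_coeff (nm z))) _ (is_cvg_series_exp_coeff (nm z)) n.
rewrite -/(expR (nm z)) /series /=; apply.
apply/nondecreasing_seqP => m; rewrite /series/= big_nat_recr//= lerDl.
by apply: exp_coeff_ge0; exact: nm_ge0.
Qed.

Lemma ln_quad u v (c : R) : 0 < c -> c <= u -> c <= v ->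
  `|ln v - ln u - (v - u) / u| <= (v - u) ^+ 2 / c ^+ 2 /\ `|ln v - ln u| <= `|v - u| / c.
Proof.
move=> c0 cu cv; have u0 : 0 < u by exact: lt_le_trans cu.
have v0 : 0 < v by exact: lt_le_trans cv.
have le1 : ln v - ln u <= (v - u) / u.
  rewrite -ln_div ?posrE//; apply: le_trans (_ : ln (1 + (v / u - 1)) <= _); first by rewrite addrC subrK.
  apply: le_trans (le_ln1Dx _) _.
    by rewrite -subr_gt0 opprK subrK divr_gt0.
  by rewrite mulrBl mulfV ?gt_eqF.
have le2 : (v - u) / v <= ln v - ln u.
  rewrite -lerN2 opprB -ln_div ?posrE//.
  apply: le_trans (_ : ln (1 + (u / v - 1)) <= _); first by rewrite addrC subrK.
  apply: le_trans (le_ln1Dx _) _.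
    by rewrite -subr_gt0 opprK subrK divr_gt0.
  by rewrite -mulNr opprB mulrBl mulfV ?gt_eqF.
have uv : u^-1 * v^-1 <= (c ^+ 2)^-1.
  by rewrite -invfM lef_pV2 ?posrE ?mulr_gt0 ?exprn_gt0// expr2 ler_pM// ltW.
have e1 : (v - u) / u - (v - u) / v = (v - u) ^+ 2 * (u^-1 * v^-1).
  by field; rewrite !gt_eqF.
have ui : u^-1 <= c^-1 by rewrite lef_pV2.
have vi : v^-1 <= c^-1 by rewrite lef_pV2.
have ui0 : 0 <= u^-1 by rewrite invr_ge0 ltW.
have vi0 : 0 <= v^-1 by rewrite invr_ge0 ltW.
split.
  rewrite distrC ger0_norm ?subr_ge0//.
  apply: le_trans (_ : (v - u) / u - (v - u) / v <= _); first by rewrite lerD2l lerN2.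
  by rewrite e1 ler_wpM2l// sqr_ge0.
have t1 : (v - u) / u <= `|v - u| / c.
  apply: le_trans (_ : `|v - u| / u <= _); first by rewrite ler_wpM2r// ler_norm.
  by rewrite ler_wpM2l.
have t2 : - (`|v - u| / c) <= (v - u) / v.
  rewrite lerNl -mulNr; apply: le_trans (_ : `|v - u| / v <= _); last by rewrite ler_wpM2l.
  by rewrite ler_wpM2r// -normrN ler_norm.
by rewrite ler_norml (le_trans t2 le2) (le_trans le1 t1).
Qed.

Lemma cpow_quad (c B : R) a : 0 < c -> exists2 K : R, 0 <= K & forall u v,
  c <= u <= B -> c <= v <= B ->
  nm (cexp (a * (ln v)%:C) - cexp (a * (ln u)%:C) - (v - u)%:C * (a * cexp ((a - 1) * (ln u)%:C)))
    <= K * (v - u) ^+ 2.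
Proof.
move=> c0; pose Lb := `|ln c| + `|ln B|.
pose P := 2 * expR (`|complex.Re a| * Lb).
pose Q := (nm a / c) ^+ 2 * expR (nm a * (B / c)) + nm a / c ^+ 2.
have Q0 : 0 <= Q.
  apply: addr_ge0; first by rewrite mulr_ge0 ?sqr_ge0 ?expR_ge0.
  by rewrite mulr_ge0 ?nm_ge0// invr_ge0 exprn_ge0// ltW.
have P0 : 0 <= P by rewrite mulr_ge0 ?expR_ge0.
exists (P * Q) => [|u v /andP[cu uB] /andP[cv vB]]; first exact: mulr_ge0.
have u0 : 0 < u by exact: lt_le_trans cu.
have v0 : 0 < v by exact: lt_le_trans cv.
have B0 : 0 < B by exact: lt_le_trans uB.
have [q1 q2] := ln_quad c0 cu cv.
set la := ln v - ln u in q1 q2.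
have E1 : cexp (a * (ln v)%:C) = cexp (a * (ln u)%:C) * cexp (a * la%:C).
  by rewrite -cexpD -mulrDr -rmorphD /la addrC subrK.
have E2 : (v - u)%:C * (a * cexp ((a - 1) * (ln u)%:C)) =
    cexp (a * (ln u)%:C) * (a * ((v - u) / u)%:C).
  rewrite mulrBl mul1r cexpD cexpN cexp_real lnK// rmorphM -(rmorphV (real_complex R)) ?unitfE ?gt_eqF//; ring.
rewrite E1 E2 (_ : _ - _ - _ = cexp (a * (ln u)%:C) * ((cexp (a * la%:C) - 1 - a * la%:C) +
  a * (la - (v - u) / u)%:C)); last by rewrite [(la - _)%:C]rmorphB; ring.
apply: le_trans (nmM _ _) _; rewrite -mulrA; apply: ler_pM; rewrite ?nm_ge0//.
  apply: le_trans (nm_cexp_le _) _; rewrite ler_wpM2l// ler_expR ReM /= mulr0 subr0.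
  apply: le_trans (ler_norm _) _; rewrite normrM ler_wpM2l//.
  have l1 : ln c <= ln u by rewrite ler_ln ?posrE.
  have l2 : ln u <= ln B by rewrite ler_ln ?posrE.
  rewrite /Lb ler_norml; have := ler_norm (ln B); have := ler_norm (- ln c); rewrite normrN.
  have := normr_ge0 (ln c); have := normr_ge0 (ln B); move=> *; apply/andP; split; lra.
have nla : nm (a * la%:C) <= nm a * (`|v - u| / c).
  by apply: le_trans (nmM _ _) _; rewrite nm_real ler_wpM2l ?nm_ge0.
have vuB : `|v - u| <= B by rewrite ler_norml; apply/andP; split; lra.
apply: le_trans (nmD _ _) _; rewrite [X in _ <= X]mulrDl; apply: lerD.
  apply: le_trans (nm_cexp_quad _) _.
  apply: le_trans (_ : (nm a * (`|v - u| / c)) ^+ 2 * expR (nm a * (B / c)) <= _).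
    apply: ler_pM; rewrite ?sqr_ge0 ?expR_ge0//.
      by rewrite lerXn2r ?nnegrE ?nm_ge0// mulr_ge0 ?nm_ge0// divr_ge0// ltW.
    rewrite ler_expR; apply: le_trans nla _; rewrite ler_wpM2l ?nm_ge0//.
    by rewrite ler_wpM2r// invr_ge0 ltW.
  rewrite -[(v - u) ^+ 2]real_normK ?num_real//.
  by rewrite le_eqVlt; apply/orP; left; apply/eqP; ring.
apply: le_trans (nmM _ _) _; rewrite nm_real -mulrA; apply: ler_wpM2l; first exact: nm_ge0.
by rewrite [X in _ <= X]mulrC.
Qed.

Section PositivePower.
Variables (h : (nat -> R) -> R) (c : R).
Hypotheses (rh : rpoly h) (c0 : 0 < c) (hc : forall y, cube y -> c <= h y).

(** The family h^(s - j): its derivative is (s - j) h' times the next member. *)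
Definition hpow (j : nat) : fam := fun s y => cexp ((s - j%:R) * (ln (h y))%:C).

Lemma hol_unif_hpow (Om : set C) j : hol_unif Om (hpow j).
Proof.
move=> s0 _; have [B B0 BP] := rpoly_bound rh.
pose L := `|ln c| + `|ln (B + c)|.
have Bc : 0 < B + c by rewrite ltr_wpDl.
have hL y : cube y -> `|ln (h y)| <= L.
  move=> cy; have h0 : 0 < h y := lt_le_trans c0 (hc cy).
  have hB : h y <= B + c.
    by apply: le_trans (ler_norm _) _; apply: le_trans (BP y cy) _; rewrite lerDl ltW.
  have l1 : ln c <= ln (h y) by rewrite ler_ln ?posrE ?hc.
  have l2 : ln (h y) <= ln (B + c) by rewrite ler_ln ?posrE.
  rewrite /L ler_norml; have := ler_norm (ln (B + c)); have := ler_norm (- ln c); rewrite normrN.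
  have := normr_ge0 (ln c); have := normr_ge0 (ln (B + c)); move=> *; apply/andP; split; lra.
pose W := 2 * (2 * expR (j%:R * L)) * expR (`|complex.Re s0| * L + L).
have W0 : 0 < W by rewrite !mulr_gt0 ?expR_gt0.
exists (Num.min 1 W^-1) => y cy.
have e0 : 0 < Num.min 1 W^-1 by rewrite lt_min ltr01 invr_gt0.
set l := ln (h y); have lL := hL y cy; rewrite -/l in lL.
apply: (@hol_eq _ _ _ (fun s => cexp (- (j%:R * l%:C)) * cexp (s * (l%:C : C)))).
  by move=> s _; rewrite /hpow -/l -cexpD; congr cexp; ring.
apply: hol_cexp => //.
apply: le_trans (_ : W <= _); last first.
  by rewrite -{1}[W]invrK lef_pV2 ?posrE ?invr_gt0// ge_min lexx orbT.
apply: ler_pM; rewrite ?mulr_ge0 ?nm_ge0 ?expR_ge0//.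
  rewrite ler_wpM2l//; apply: le_trans (nm_cexp_le _) _; rewrite ler_wpM2l// ler_expR ReN ReM /= mulr0 subr0.
  rewrite Re_nat -mulrN ler_wpM2l//; apply: le_trans lL; rewrite -normrN; exact: ler_norm.
rewrite ler_expR; apply: lerD.
  by apply: le_trans (ler_norm _) _; rewrite normrM ler_wpM2l.
by apply: le_trans (_ : 1 * L <= _); [apply: ler_pM => //; [exact: ltW|rewrite ge_min lexx]|rewrite mul1r].
Qed.

Lemma smooth_hpow (Om : set C) N j : smooth Om N (hpow j).
Proof.
elim: N j => [|N IH] j; first exact: hol_unif_hpow.
split=> [|i]; first exact: hol_unif_hpow.
have [h' [rh' [K1 K10 H1]]] := rpoly_der i rh; have [L L0 HL] := rpoly_lip i rh.
have [B B0 BP] := rpoly_bound rh.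
exists (fun s y => (s - j%:R) * (h' y)%:C * hpow j.+1 s y); split.
  apply: smooth_mul (IH _); apply: smooth_mul; last exact: smooth_rpoly.
  by apply: smooth_sub; [exact: smooth_id|exact: smooth_cst].
move=> s Os; set a := s - j%:R.
have [K K0 KP] := cpow_quad B a c0.
have [D D0 DP] := hol_unif_bound (@hol_unif_hpow Om j.+1) Os.
exists (K * L ^+ 2 + nm a * D * K1) => y u cy u01.
have cu := cube_upd i cy u01.
have Bh z : cube z -> c <= h z <= B.
  by move=> cz; rewrite hc//= (le_trans (ler_norm _) (BP z cz)).
have k1 := KP (h y) (h (upd y i u)) (Bh _ cy) (Bh _ cu).
have aE : hpow j.+1 s y = cexp ((a - 1) * (ln (h y))%:C).
  by rewrite /hpow /a -natr1 opprD addrA.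
set x := u - y i; set v := h (upd y i u) in k1 *.
rewrite /hpow -/(hpow j.+1 s y) -/a -/v aE.
set w := cexp ((a - 1) * _) in k1 *.
rewrite (_ : _ - _ = (cexp (a * (ln v)%:C) - cexp (a * (ln (h y))%:C) - (v - h y)%:C * (a * w)) +
  (v - h y - x * h' y)%:C * (a * w)); last by rewrite [(v - h y - x * h' y)%:C]rmorphB rmorphM; ring.
apply: le_trans (nmD _ _) _; rewrite [X in _ <= X]mulrDl; apply: lerD.
  apply: le_trans k1 _; rewrite -mulrA; apply: ler_wpM2l => //; rewrite -exprMn.
  rewrite -real_normK ?num_real// -[(L * x) ^+ 2]real_normK ?num_real//.
  apply: lerXn2r; rewrite ?nnegrE// normrM (ger0_norm L0); exact: HL.
have := H1 y u cy u01; rewrite -/x -/v => k2.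
have waD : nm (a * w) <= nm a * D.
  apply: le_trans (nmM _ _) _; apply: ler_wpM2l; first exact: nm_ge0.
  by rewrite /w -aE; exact: DP.
rewrite nmMr; apply: le_trans (_ : (K1 * x ^+ 2) * (nm a * D) <= _).
  by apply: ler_pM; rewrite ?nm_ge0.
by rewrite le_eqVlt; apply/orP; left; apply/eqP; ring.
Qed.

End PositivePower.

Section AnalyticComposition.
Variables (n : nat) (V : set 'rV[R]_n) (X : 'I_n -> (nat -> R) -> R).
Hypotheses (cV : compact V) (rX : forall j, rpoly (X j)).
Let x y : 'rV[R]_n := \row_j X j y.
Hypothesis XV : forall y, cube y -> V (x y).

(** By the chain rule the derivative combines the partial derivatives of E, which are
    analytic again. *)
Lemma smooth_analytic (Om : set C) N (E : 'rV[C]_(1 + n) -> C) :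
  (forall s z, V z -> analytic_at E (complex_point s z)) ->
  smooth Om N (fun s y => E (complex_point s (x y))).
Proof.
elim: N E => [|N IH] E EV.
  move=> s0 _; have [|e eP] := @hol_slice_uniform _ _ V cV E s0; first exact: EV.
  by exists e => y cy; exact: eP (XV cy).
split=> [|i].
  move=> s0 _; have [|e eP] := @hol_slice_uniform _ _ V cV E s0; first exact: EV.
  by exists e => y cy; exact: eP (XV cy).
have [X' X'P] : exists X' : 'I_n -> (nat -> R) -> R, forall j, rpoly (X' j) /\ exists2 K : R, 0 <= K &
    forall y u, cube y -> 0 <= u <= 1 ->
    `|X j (upd y i u) - X j y - (u - y i) * X' j y| <= K * (u - y i) ^+ 2.
  by have ch j := rpoly_der i (rX j); have [X' H] := choice ch; exists X'.
have EV' j s z : V z -> analytic_at (fun pt => grad E pt (rshift 1 j)) (complex_point s z).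
  by move=> Vz; apply: grad_analytic; exact: EV.
exists (fun s y => \sum_j (X' j y)%:C * grad E (complex_point s (x y)) (rshift 1 j)); split.
  apply: (@smooth_sum _ Om N _ _ (fun j s y => (X' j y)%:C * grad E (complex_point s (x y)) (rshift 1 j))) => j.
  apply: smooth_mul; first by apply: smooth_rpoly; case: (X'P j).
  by apply: (IH (fun pt => grad E pt (rshift 1 j))) => s z; exact: EV'.
move=> s Os.
have [K K0 KP] := quad_slice_uniform cV (EV s).
have [L LP] : exists L : 'I_n -> R, forall j, 0 <= L j /\ forall y u, cube y -> 0 <= u <= 1 ->
    `|X j (upd y i u) - X j y| <= L j * `|u - y i|.
  have ch j : exists L : R, 0 <= L /\ forall y u, cube y -> 0 <= u <= 1 ->
      `|X j (upd y i u) - X j y| <= L * `|u - y i|.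
    by have [L L0 LP] := rpoly_lip i (rX j); exists L.
  by have [L H] := choice ch; exists L.
have [Q QP] : exists Q : 'I_n -> R, forall j, 0 <= Q j /\ forall y u, cube y -> 0 <= u <= 1 ->
    `|X j (upd y i u) - X j y - (u - y i) * X' j y| <= Q j * (u - y i) ^+ 2.
  have ch j : exists Q : R, 0 <= Q /\ forall y u, cube y -> 0 <= u <= 1 ->
      `|X j (upd y i u) - X j y - (u - y i) * X' j y| <= Q * (u - y i) ^+ 2.
    by have [_ [Q Q0 H]] := X'P j; exists Q.
  by have [Q H] := choice ch; exists Q.
have [D DP] : exists D : 'I_n -> R, forall j, 0 <= D j /\ forall z, V z ->
    nm (partial E j s z) <= D j.
  have ch j : exists D : R, 0 <= D /\ forall z, V z -> nm (partial E j s z) <= D.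
    by have [D D0 H] := bounded_slice cV (EV' j s); exists D.
  by have [D H] := choice ch; exists D.
pose S := \sum_j L j; have S0 : 0 <= S by apply: sumr_ge0 => j _; case: (LP j).
exists (K * S ^+ 2 + \sum_j Q j * D j) => y u cy u01; have cu := cube_upd i cy u01.
set t := u - y i.
have h1 := KP (x y) (x (upd y i u)) (S * `|t|) (XV cy) (XV cu) (mulr_ge0 S0 (normr_ge0 _)).
have {}h1 := h1 _.
set A := E _ - E _ in h1 *; set B := \sum_j _ in h1.
rewrite (_ : A - _ = (A - B) + \sum_j (X j (upd y i u) - X j y - t * X' j y)%:C * partial E j s (x y)); last first.
  have -> : \sum_j (X j (upd y i u) - X j y - t * X' j y)%:C * partial E j s (x y) =
      B - t%:C * (\sum_j (X' j y)%:C * grad E (complex_point s (x y)) (rshift 1 j)).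
    rewrite mulr_sumr /B -sumrB; apply: eq_bigr => j _.
    rewrite !mxE (_ : (_ - t * X' j y)%:C = (X j (upd y i u) - X j y)%:C - t%:C * (X' j y)%:C); last first.
      by rewrite rmorphB rmorphM.
    by rewrite mulrBl mulrA.
  by rewrite addrA subrK.
apply: le_trans (nmD _ _) _; rewrite [X in _ <= X]mulrDl; apply: lerD.
  apply: le_trans (h1 _) _.
    move=> j; rewrite !mxE; have [_ Lj] := LP j; apply: le_trans (Lj y u cy u01) _.
    apply: ler_wpM2r => //; rewrite /S (bigD1 j)//= lerDl; apply: sumr_ge0 => k _; by case: (LP k).
  by rewrite exprMn real_normK ?num_real// mulrA.
apply: le_trans (nm_sum _ _ _) _; rewrite mulr_suml; apply: ler_sum => j _.
rewrite nmMr mulrAC; apply: ler_pM; rewrite ?nm_ge0//.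
  by case: (QP j) => _; apply.
by case: (DP j) => _; apply; exact: XV.
Qed.

End AnalyticComposition.

End PolynomialComposition.

(** * Translations and linear maps of Lebesgue measure *)

Section LebesgueTuples.
Context {R : realType}.
Local Notation mR := (measurableTypeR R).
Local Notation leb := (@lebesgue_measure R).
Local Notation lam := (@lebesgueT R).

Lemma measurable_coord n (i : 'I_n) : measurable_fun [set: n.-tuple mR] (fun u => tnth u i).
Proof. exact: measurable_tnth. Qed.

Lemma measurable_mktuple d (T : measurableType d) n (f : 'I_n -> T -> mR) :
  (forall i, measurable_fun setT (f i)) -> measurable_fun setT (fun x => [tuple f i x | i < n]).
Proof.
move=> mf; apply/measurable_fun_tnthP => i.
by apply: (eq_measurable_fun (f i)) (mf i) => x _ /=; rewrite tnth_mktuple.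
Qed.

Lemma measurable_preim d d' (T : measurableType d) (T' : measurableType d') (f : T -> T') (Y : set T') :
  measurable_fun setT f -> measurable Y -> measurable (f @^-1` Y).
Proof. by move=> mf mY; rewrite -[X in measurable X]setTI; exact: mf. Qed.


Definition tshift n (d : 'I_n -> R) (u : n.-tuple mR) : n.-tuple mR :=
  [tuple tnth u i + d i | i < n].

Lemma measurable_tshift n d : measurable_fun setT (@tshift n d).
Proof.
apply: measurable_mktuple => i; apply: measurable_funD; first exact: measurable_coord.
exact: measurable_cst.
Qed.

Lemma lebesgue_shift (d : R) (Y : set mR) : measurable Y ->
  leb ((fun x => x + d) @^-1` Y) = leb Y.
Proof.
move=> mY.
have mphi : measurable_fun [set: mR] (fun x : mR => x + d : mR).
  by apply: measurable_funD => //; exact: measurable_cst.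
pose phi : {mfun mR >-> mR} := HB.pack (fun x : mR => x + d : mR) (isMeasurableFun.Build _ _ _ _ _ mphi).
rewrite -/(pushforward leb phi Y); apply/esym.
apply: (@lebesgue_measure_unique R (pushforward leb phi)) => // _ [[a b]] _ <-.
have E : (fun x : mR => x + d) @^-1` `]a, b]%classic = `]a - d, b - d]%classic.
  by apply/seteqP; split=> x /=; rewrite !in_itv /= ltrBlDr lerBrDr.
rewrite -[RHS]/(leb ((fun x : mR => x + d) @^-1` `]a, b]%classic)) E.
rewrite !lebesgue_measure_itv /= !lte_fin ltrD2r.
by case: ifP => // _; rewrite -!EFinD opprB addrA subrK.
Qed.

Lemma lebesgueTS n (Y : set (n.+1.-tuple mR)) :
  lam n.+1 Y = (leb \x lam n)%E (@tuple_cons R n @^-1` Y).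
Proof. by []. Qed.

(** A measure on a product is determined by its values on rectangles. *)
Lemma lebesgueT_shift n (d : 'I_n -> R) (Y : set (n.-tuple mR)) : measurable Y ->
  lam n (tshift d @^-1` Y) = lam n Y.
Proof.
elim: n d Y => [|n IH] d Y mY.
  rewrite (_ : tshift d @^-1` Y = Y)//.
  by apply/seteqP; split=> u /=; rewrite [tshift d u]tuple0 [u]tuple0.
pose d' (i : 'I_n) := d (lift ord0 i).
rewrite !lebesgueTS; pose Z := @tuple_cons R n @^-1` Y.
have mZ : measurable Z.
  exact: measurable_preim (@measurable_tuple_cons R n) mY.
have mphi : measurable_fun [set: mR * n.-tuple mR] (fun p => (p.1 + d ord0 : mR, tshift d' p.2)).
  apply: measurable_fun_pair.
    by apply: measurable_funD => //; exact: measurable_cst.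
  by apply: (measurableT_comp (measurable_tshift d')).
pose phi : {mfun _ >-> _} := HB.pack (fun p : mR * n.-tuple mR => (p.1 + d ord0 : mR, tshift d' p.2))
  (isMeasurableFun.Build _ _ _ _ _ mphi).
have -> : @tuple_cons R n @^-1` (tshift d @^-1` Y) = phi @^-1` Z.
  suff E p : tshift d (tuple_cons p) = tuple_cons (phi p) by apply/seteqP; split=> p; rewrite /Z /= E.
  apply: eq_from_tnth => i; rewrite tnth_mktuple.
  case: (unliftP ord0 i) => [j|] ->; first by rewrite !tnthS tnth_mktuple.
  by rewrite !tnth0.
transitivity ((leb \x lam n)%E Z) => //; apply/esym.
apply: (@product_measure_unique _ _ _ _ R leb (lam n) (pushforward (leb \x lam n)%E phi)) => // A B mA mB.
transitivity ((leb \x lam n)%E (((fun x : mR => x + d ord0) @^-1` A) `*` (tshift d' @^-1` B))) => //.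
have m1 : measurable ((fun x : mR => x + d ord0) @^-1` A).
  by apply: measurable_preim mA; apply: measurable_funD => //; exact: measurable_cst.
have m2 : measurable (tshift d' @^-1` B) by apply: measurable_preim mB; exact: measurable_tshift.
apply: etrans (product_measure1E leb (lam n) m1 m2) _.
by congr (_ * _)%E; [exact: lebesgue_shift|exact: IH].
Qed.

Definition tbox n (r : R) : set (n.-tuple mR) := [set u | forall i, - r <= tnth u i <= r].
Arguments tbox : clear implicits.

Lemma measurable_tbox n r : measurable (tbox n r).
Proof.
rewrite (_ : tbox n r = \bigcap_(i in [set: 'I_n]) ((fun u : n.-tuple mR => tnth u i) @^-1` `[- r, r]%classic)).
  apply: fin_bigcap_measurable => // i _; rewrite -[X in measurable X]setTI.
  by apply: measurable_coord => //; exact: measurable_itv.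
by apply/seteqP; split=> u /= H i; have := H i; rewrite /= in_itv /= => // -/(_ I).
Qed.

Lemma lebesgueT_tbox n r : 0 <= r -> lam n (tbox n r) = ((2 * r) ^+ n)%:E.
Proof.
move=> r0; elim: n => [|n IH].
  rewrite (_ : tbox 0 r = setT) /=; first by rewrite diracT expr0.
  by apply/seteqP; split=> // u _ [].
rewrite lebesgueTS (_ : _ @^-1` _ = `[- r, r]%classic `*` tbox n r); last first.
  apply/seteqP; split=> -[x u] /=.
    move=> H; split=> [|i]; first by have := H ord0; rewrite tnth0 /= in_itv.
    by have := H (lift ord0 i); rewrite tnthS.
  rewrite in_itv /= => -[xr H] i; case: (unliftP ord0 i) => [j|] ->; first by rewrite tnthS.
  by rewrite tnth0.
have mi : measurable (`[- r, r]%classic : set mR) by exact: measurable_itv.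
apply: etrans (product_measure1E leb (lam n) mi (@measurable_tbox n r)) _; rewrite IH.
rewrite exprS EFinM; congr (_ * _)%E; apply: etrans (lebesgue_measure_itv _) _.
rewrite /= lte_fin; case: ltP => H; first by rewrite -EFinD opprK mulr_natl mulr2n.
by congr EFin; lra.
Qed.

(** Both sides are the product measure of regions that a shear carries into each other:
    integrate first over z in one, first over u in the other, and use translation
    invariance. This replaces determinants by one unspecified constant. *)
Lemma pushforward_scaling n (S S' : n.-tuple mR -> n.-tuple mR) (Y : set (n.-tuple mR)) :
  measurable_fun setT S -> (forall z u, S (tshift (tnth (S' z)) u) = tshift (tnth z) (S u)) ->
  measurable Y ->
  (lam n (S @^-1` Y) * (2 ^+ n)%:E = lam n (S @^-1` tbox n 1) * lam n Y)%E.
Proof.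
move=> mS SS' mY.
pose T := n.-tuple mR.
have mP : measurable (tbox n 1) by exact: measurable_tbox.
have mS2 : measurable_fun [set: T * T] (fun p : T * T => S p.2).
  exact: (measurableT_comp mS).
have madd (g : T * T -> T) : measurable_fun setT g ->
    measurable_fun setT (fun p : T * T => [tuple tnth (g p) i + tnth p.1 i | i < n]).
  move=> mg; apply: measurable_mktuple => i; apply: measurable_funD.
    by apply: (measurableT_comp (measurable_coord i)).
  by apply: (measurableT_comp (measurable_coord i)).
have msub : measurable_fun setT (fun p : T * T => [tuple tnth p.1 i - tnth (S p.2) i | i < n]).
  apply: measurable_mktuple => i; apply: measurable_funB.
    by apply: (measurableT_comp (measurable_coord i)).
  by apply: (measurableT_comp (measurable_coord i)).
(* the shear u -> u + S' z carries the slices of Q1 over z to those of Q2 *)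
pose Q1 : set (T * T) := [set p | Y (S p.2) /\ tbox n 1 [tuple tnth p.1 i - tnth (S p.2) i | i < n]].
pose Q2 : set (T * T) := [set p | tbox n 1 (S p.2) /\ Y (tshift (tnth p.1) (S p.2))].
have mQ1 : measurable Q1.
  by apply: measurableI; [exact: (measurable_preim mS2)|exact: (measurable_preim msub)].
have mQ2 : measurable Q2.
  apply: measurableI; first exact: (measurable_preim mS2).
  exact: (measurable_preim (madd _ mS2)).
have E12 : (lam n \x lam n)%E Q1 = (lam n \x lam n)%E Q2.
  rewrite /= /product_measure1; apply: eq_integral => z _ /=.
  have mx : measurable (xsection Q1 z) by exact: measurable_xsection.
  apply: etrans (esym (lebesgueT_shift (tnth (S' z)) mx)) _.
  rewrite (_ : _ @^-1` _ = xsection Q2 z)//.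
  apply/seteqP; split=> u; rewrite /= /xsection /= !inE /Q1 /Q2 /= SS'.
    move=> [y b]; split=> // i; have := b i; rewrite !tnth_mktuple; lra.
  move=> [b y]; split=> // i; have := b i; rewrite !tnth_mktuple; lra.
have E m : measurable m -> (lam n \x lam n)%E m = (lam n \x^ lam n)%E m.
  move=> mm; apply: product_measure_unique => // A B mA mB /=.
  by rewrite product_measure2E.
have c0 (A : set T) (x : \bar R) : measurable A -> (0 <= x)%E ->
    (\int[lam n]_u (x * (\1_A u)%:E) = x * lam n A)%E.
  move=> mA x0; rewrite ge0_integralZl//; first by rewrite integral_indic// setIT.
  exact: measurableT_comp.
have shiftP (w : T) (A : set T) : measurable A ->
    lam n [set z : T | A [tuple tnth w i + tnth z i | i < n]] = lam n A.
  move=> mA; rewrite -(lebesgueT_shift (tnth w) mA); congr (lam n _).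
  apply/seteqP; split=> z /=; rewrite (_ : [tuple _ | i < n] = tshift (tnth w) z)//;
    by apply: eq_from_tnth => i; rewrite !tnth_mktuple addrC.
have ind (P : Prop) (A : set T) : lam n [set z | P /\ A z] = (lam n A * (`[< P >])%:R%:E)%E.
  have [p|np] := pselect P.
    rewrite asboolT// mule1; congr (lam n _); apply/seteqP; split=> z //=; first by case.
    rewrite asboolF// mule0 -[RHS](measure0 (lam n)); congr (lam n _).
    by apply/seteqP; split=> z //= [].
have I1 : (lam n \x^ lam n)%E Q1 = ((2 ^+ n)%:E * lam n (S @^-1` Y))%E.
  rewrite -c0 ?lee_fin ?exprn_ge0//; last exact: measurable_preim.
  rewrite /= /product_measure2; apply: eq_integral => u _; rewrite indicE.
  rewrite -[X in ((X ^+ n)%:E)]mulr1 -lebesgueT_tbox// -(shiftP [tuple - tnth (S u) i | i < n] _ mP).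
  transitivity (lam n [set z | Y (S u) /\ tbox n 1 [tuple tnth [tuple - tnth (S u) i | i < n] i + tnth z i | i < n]]).
    congr (lam n _); apply/seteqP; split=> z; rewrite /ysection /= inE /Q1 /= => -[y b]; split=> // i;
      by have := b i; rewrite !tnth_mktuple addrC.
  exact: (ind (Y (S u)) (fun z : T => tbox n 1 [tuple tnth [tuple - tnth (S u) i | i < n] i + tnth z i | i < n])).
have I2 : (lam n \x^ lam n)%E Q2 = (lam n Y * lam n (S @^-1` tbox n 1))%E.
  rewrite -c0 ?measure_ge0//; last exact: measurable_preim.
  rewrite /= /product_measure2; apply: eq_integral => u _; rewrite indicE -(shiftP (S u) _ mY).
  transitivity (lam n [set z | tbox n 1 (S u) /\ Y [tuple tnth (S u) i + tnth z i | i < n]]).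
    by congr (lam n _); apply/seteqP; split=> z; rewrite /ysection /= inE.
  exact: (ind (tbox n 1 (S u)) (fun z : T => Y [tuple tnth (S u) i + tnth z i | i < n])).
by rewrite muleC -I1 -E// E12 E// I2 muleC.
Qed.

End LebesgueTuples.

Arguments tbox {R} n r.

(** * Linear substitution in integrals *)

Section AffineSubstitution.
Context {R : realType}.
Local Notation C := (cplx R).
Local Notation mR := (measurableTypeR R).
Local Notation leb := (@lebesgue_measure R).
Local Notation lam := (@lebesgueT R).

Lemma Rintegral_pushforward d d' (T : measurableType d) (T' : measurableType d')
    (mu : {measure set T -> \bar R}) (A : T -> T') (nu : {measure set T' -> \bar R}) (D : set T') (f : T' -> R) :
  measurable_fun setT A -> (forall Y, measurable Y -> nu Y = mu (A @^-1` Y)) ->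
  measurable D -> measurable_fun D f ->
  Rintegral nu D f = Rintegral mu (A @^-1` D) (f \o A).
Proof.
move=> mA nuE mD mf; rewrite /Rintegral; congr fine.
have nuI (g : T' -> \bar R) : measurable_fun D g -> (forall y, D y -> 0 <= g y)%E ->
    (\int[nu]_(x in D) g x = \int[mu]_(x in A @^-1` D) g (A x))%E.
  move=> mg g0; rewrite (eq_measure_integral (pushforward mu A)).
    by rewrite ge0_integral_pushforward// => y; rewrite inE; exact: g0.
  by move=> Y mY _; exact: nuE.
have m1 : measurable_fun D (EFin \o f)^\+%E by apply: measurable_funepos; exact/measurable_EFinP.
have m2 : measurable_fun D (EFin \o f)^\-%E by apply: measurable_funeneg; exact/measurable_EFinP.
rewrite integralE [RHS]integralE (nuI _ m1); last by move=> y _; exact: funepos_ge0.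
rewrite (nuI _ m2); last by move=> y _; exact: funeneg_ge0.
by rewrite !funepos.unlock !funeneg.unlock.
Qed.

Lemma Rintegral_scaled d (T : measurableType d) (mu nu : {measure set T -> \bar R}) (c : R)
    (D : set T) (f : T -> R) : 0 <= c ->
  (forall Y, measurable Y -> nu Y = c%:E * mu Y)%E ->
  measurable D -> mu.-integrable D (EFin \o f) ->
  Rintegral nu D f = c * Rintegral mu D f.
Proof.
move=> c0 nuE mD fi; rewrite -RintegralZl// /Rintegral; congr fine.
have mf : measurable_fun D (EFin \o f) by exact: measurable_int fi.
pose k := NngNum c0.
have nuI (g : T -> \bar R) : measurable_fun D g -> (forall y, D y -> 0 <= g y)%E ->
    (\int[nu]_(x in D) g x = c%:E * \int[mu]_(x in D) g x)%E.
  move=> mg g0; rewrite (eq_measure_integral (mscale k mu)).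
    by rewrite ge0_integral_mscale.
  by move=> Y mY _; exact: nuE.
have m1 := measurable_funepos mf; have m2 := measurable_funeneg mf.
rewrite integralE (nuI _ m1); last by move=> y _; exact: funepos_ge0.
rewrite (nuI _ m2); last by move=> y _; exact: funeneg_ge0.
have [p n] := (integrable_pos_fin_num mD fi, integrable_neg_fin_num mD fi).
rewrite -muleBr//; last by rewrite fin_num_adde_defr.
rewrite -integralE -integralZl//; by apply: eq_integral => x _; rewrite EFinM.
Qed.

Lemma bmf_comp d d' (T : measurableType d) (T' : measurableType d') (A : T -> T') (D : set T) (D' : set T')
    (f : T' -> C) : measurable_fun setT A -> measurable D -> measurable D' ->
  (forall t, D t -> D' (A t)) -> bmf D' f -> bmf D (f \o A).
Proof.
move=> mA mD mD' DA [f1 f2 [B fB]]; split.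
- apply: (@measurable_comp _ _ _ _ _ _ D' (fun t => complex.Re (f t))) => //.
    by move=> _ [t Dt <-]; exact: DA.
  exact: measurable_funTS.
- apply: (@measurable_comp _ _ _ _ _ _ D' (fun t => complex.Im (f t))) => //.
    by move=> _ [t Dt <-]; exact: DA.
  exact: measurable_funTS.
- by exists B => t /DA; exact: fB.
Qed.

Lemma cint_substitution n (A : n.-tuple mR -> n.-tuple mR) (c : R) (D : set (n.-tuple mR)) (f : n.-tuple mR -> C) :
  measurable_fun setT A -> 0 <= c -> (forall Y, measurable Y -> lam n (A @^-1` Y) = c%:E * lam n Y)%E ->
  measurable D -> (lam n D < +oo)%E -> bmf D f ->
  cint (lam n) (A @^-1` D) (f \o A) = c%:C * cint (lam n) D f.
Proof.
move=> mA c0 AE mD Df bf.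
have R1 (h : n.-tuple mR -> R) : (lam n).-integrable D (EFin \o h) ->
    Rintegral (lam n) (A @^-1` D) (h \o A) = c * Rintegral (lam n) D h.
  move=> hi; have mA' := isMeasurableFun.Build _ _ _ _ _ mA.
  pose Ap : {mfun _ >-> _} := HB.pack A mA'.
  rewrite -(@Rintegral_scaled _ _ (lam n) (pushforward (lam n) Ap) c)//.
  rewrite (@Rintegral_pushforward _ _ _ _ (lam n) A (pushforward (lam n) Ap))//.
  by apply/measurable_EFinP; exact: measurable_int hi.
apply: cplxP => /=.
  by rewrite mul0r subr0; apply: (R1 (fun t => complex.Re (f t))); exact: bmf_Re.
by rewrite mul0r addr0; apply: (R1 (fun t => complex.Im (f t))); exact: bmf_Im.
Qed.

Definition lmap n (B : 'M[R]_n) (u : n.-tuple mR) : n.-tuple mR :=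
  [tuple \sum_j tnth u j * B j i | i < n].

Lemma measurable_lmap n (B : 'M[R]_n) : measurable_fun setT (lmap B).
Proof.
apply: measurable_mktuple => i; apply: measurable_sum => j.
by apply: measurable_funM; [exact: measurable_coord|exact: measurable_cst].
Qed.

Lemma row_of_lmap n (B : 'M[R]_n) u : row_of_tuple (lmap B u) = row_of_tuple u *m B.
Proof. by apply/rowP => i; rewrite !mxE tnth_mktuple; apply: eq_bigr => j _; rewrite mxE. Qed.

Lemma row_of_tshift n (d : 'I_n -> R) u : row_of_tuple (tshift d u) = row_of_tuple u + \row_i d i.
Proof. by apply/rowP => i; rewrite !mxE tnth_mktuple. Qed.

Lemma row_of_tuple_inj n : injective (@row_of_tuple R n).
Proof. by move=> u v /rowP E; apply: eq_from_tnth => i; have := E i; rewrite !mxE. Qed.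

(** The constant is read off from the preimage of a box, which lies in another box. *)
Lemma linear_pushforward n (B : 'M[R]_n) (d : 'I_n -> R) : B \in unitmx ->
  exists2 c : R, 0 <= c & forall Y : set (n.-tuple mR), measurable Y ->
    (lam n ((fun u => tshift d (lmap B u)) @^-1` Y) = c%:E * lam n Y)%E.
Proof.
move=> uB; set P := lmap B @^-1` tbox n 1.
pose K := \sum_i \sum_j `|invmx B j i|; have K0 : 0 <= K.
  by apply: sumr_ge0 => i _; apply: sumr_ge0.
have mP : measurable P by apply: measurable_preim (@measurable_lmap _ B) _; exact: measurable_tbox.
have PK : P `<=` tbox n K.
  move=> u Pu i; rewrite -ler_norml.
  have -> : u = lmap (invmx B) (lmap B u).
    by apply: row_of_tuple_inj; rewrite !row_of_lmap mulmxK.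
  rewrite tnth_mktuple; apply: le_trans (ler_norm_sum _ _ _) _.
  apply: le_trans (_ : \sum_j `|invmx B j i| <= _).
    apply: ler_sum => j _; rewrite normrM; apply: ler_piMl => //.
    by rewrite ler_norml; exact: Pu.
  by rewrite /K [X in _ <= X](bigD1 i)//= lerDl; apply: sumr_ge0 => k _; apply: sumr_ge0.
have Pfin : lam n P \is a fin_num.
  rewrite ge0_fin_numE//; apply: le_lt_trans (_ : (lam n (tbox n K) < +oo)%E).
    by apply: le_measure => //; rewrite inE//; exact: measurable_tbox.
  by rewrite lebesgueT_tbox// ltry.
exists (fine (lam n P) / 2 ^+ n) => [|Y mY].
  by rewrite divr_ge0 ?exprn_ge0// fine_ge0.
have S z u : lmap B (tshift (tnth (lmap (invmx B) z)) u) = tshift (tnth z) (lmap B u).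
  apply: row_of_tuple_inj; rewrite row_of_lmap !row_of_tshift mulmxDl row_of_lmap; congr (_ + _).
  apply/rowP => i; rewrite (_ : \row_j _ = row_of_tuple z *m invmx B); first by rewrite mulmxKV// !mxE.
  by apply/rowP => j; rewrite mxE -row_of_lmap mxE.
have mY' : measurable (tshift d @^-1` Y) by exact: measurable_preim (@measurable_tshift _ _ d) mY.
have := @pushforward_scaling R n (lmap B) (lmap (invmx B)) _ (@measurable_lmap _ B) S mY'.
rewrite lebesgueT_shift// -/P -(fineK Pfin) => E.
rewrite (_ : (fun _ => _) @^-1` Y = lmap B @^-1` (tshift d @^-1` Y))//.
have p2 : (2 : R) ^+ n != 0 by rewrite expf_neq0.
rewrite mulrC EFinM -muleA -E muleC -muleA -EFinM mulfV// mule1//.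
Qed.

Lemma scale_pushforward n (r : R) (Y : set (n.-tuple mR)) : 0 < r -> measurable Y ->
  (lam n (lmap r%:M @^-1` Y) = (r ^- n)%:E * lam n Y)%E.
Proof.
move=> r0 mY; have S (z u : n.-tuple mR) : lmap r%:M (tshift (tnth (lmap (r^-1)%:M z)) u) = tshift (tnth z) (lmap r%:M u).
  apply: row_of_tuple_inj; rewrite row_of_lmap !row_of_tshift mulmxDl row_of_lmap; congr (_ + _).
  apply/rowP => i; rewrite mul_mx_scalar !mxE -[tnth _ i]/(tnth (lmap (r^-1)%:M z) i).
  rewrite tnth_mktuple (bigD1 i)//= big1 => [|j ji]; last by rewrite mxE (negbTE ji) mulr0.
  by rewrite mxE eqxx addr0 mulrCA mulfV ?mulr1 ?gt_eqF.
have := @pushforward_scaling R n (lmap r%:M) (lmap (r^-1)%:M) _ (@measurable_lmap _ _) S mY.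
rewrite (_ : lmap r%:M @^-1` tbox n 1 = tbox n r^-1); last first.
  have key (x : R) : (-1 <= x * r <= 1) = (- r^-1 <= x <= r^-1).
    by rewrite -!ler_norml normrM (gtr0_norm r0) -ler_pdivlMr// mul1r.
  have cE (u : n.-tuple mR) i : tnth (lmap r%:M u) i = tnth u i * r.
    rewrite tnth_mktuple (bigD1 i)//= big1 ?addr0 ?mxE ?eqxx ?mulr1n// => j ji.
    by rewrite mxE (negbTE ji) mulr0.
  by apply/seteqP; split=> u /= H i; have := H i; rewrite cE key.
rewrite lebesgueT_tbox ?invr_ge0 ?ltW// exprMn EFinM => E.
have p2 : (2 : R) ^+ n != 0 by rewrite expf_neq0.
rewrite -[X in X = _]mule1 -[X in (_ * X)%E]/((1 : R)%:E) -(mulfV p2) EFinM muleA E -!muleA muleC.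
by rewrite -!muleA -EFinM mulVf// mule1 muleC exprVn muleC.
Qed.

End AffineSubstitution.

(** * The ordered simplex as an iterated integral *)

Section OrderedSimplex.
Context {R : realType}.
Local Notation C := (cplx R).
Local Notation mR := (measurableTypeR R).
Local Notation leb := (@lebesgue_measure R).
Local Notation lam := (@lebesgueT R).

Lemma Rintegral_tuple_cons n (D : set (n.+1.-tuple mR)) (f : n.+1.-tuple mR -> R) (B : R) :
  measurable D -> (lam n.+1 D < +oo)%E -> measurable_fun D f -> (forall t, D t -> `|f t| <= B) ->
  (forall p, D (tuple_cons p) -> I01 p.1) ->
  (forall x, (lam n [set u | D (tuple_cons (x, u))] < +oo)%E) ->
  Rintegral (lam n.+1) D f = Rintegral leb I01 (fun x =>
    Rintegral (lam n) [set u | D (tuple_cons (x, u))] (fun u => f (tuple_cons (x, u)))).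
Proof.
move=> mD Df mf fB DI Dxf.
have mtc := @measurable_tuple_cons R n.
have mE : measurable (@tuple_cons R n @^-1` D) by exact: measurable_preim mtc mD.
rewrite (@Rintegral_pushforward _ _ _ _ _ (leb \x lam n)%E (@tuple_cons R n))//.
set E := _ @^-1` D in mE *; set g := f \o _.
have mg : measurable_fun E g.
  by apply: (@measurable_comp _ _ _ _ _ _ D f) => //; [move=> _ [p Ep <-]|exact: measurable_funTS].
have gi : (leb \x lam n)%E.-integrable E (EFin \o g).
  by apply: (@bounded_integrable _ _ _ _ _ mE _ _ B) => // p Ep; exact: fB.
rewrite /Rintegral; congr fine.
rewrite integral_mkcond /=.
have gi' : (leb \x lam n)%E.-integrable setT ((EFin \o g) \_ E) by rewrite -integrable_mkcond.
rewrite -(integral12_prod_meas1 gi') [RHS]integral_mkcond; apply: eq_integral => x _.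
have mx : measurable [set u | D (tuple_cons (x, u))].
  by rewrite (_ : [set u | _] = xsection E x); [exact: measurable_xsection|apply/seteqP; split=> u; rewrite /xsection /= inE].
have xi : (lam n).-integrable [set u | D (tuple_cons (x, u))] (EFin \o (fun u => f (tuple_cons (x, u)))).
  apply: (@bounded_integrable _ _ _ _ _ mx _ _ B) ; [exact: Dxf| |by move=> u Du; exact: fB].
  apply: (@measurable_comp _ _ _ _ _ _ D f) => //; first by move=> _ [u Du <-].
  by apply: measurable_funTS; apply: (measurableT_comp mtc); exact: measurable_pair1.
have -> : fubini_F (lam n) ((EFin \o g) \_ E) x =
    (\int[lam n]_(u in [set u | D (tuple_cons (x, u))]) (f (tuple_cons (x, u)))%:E)%E.
  rewrite [RHS]integral_mkcond; apply: eq_integral => u _.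
  by [].
rewrite /patch; case: ifPn => [_|/negP nI].
  by rewrite fineK//; exact: integrable_fin_num.
rewrite (_ : [set u | _] = set0) ?integral_set0//.
by apply/seteqP; split=> u //= /DI; rewrite -[I01 _]/(I01 x) => /mem_set.
Qed.

Lemma cint_tuple_cons n (D : set (n.+1.-tuple mR)) (f : n.+1.-tuple mR -> C) :
  measurable D -> (lam n.+1 D < +oo)%E -> bmf D f ->
  (forall p, D (tuple_cons p) -> I01 p.1) ->
  (forall x, (lam n [set u | D (tuple_cons (x, u))] < +oo)%E) ->
  cint (lam n.+1) D f = cint leb I01 (fun x =>
    cint (lam n) [set u | D (tuple_cons (x, u))] (fun u => f (tuple_cons (x, u)))).
Proof.
move=> mD Df [f1 f2 [B fB]] DI Dxf; apply: cplxP => /=.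
  by apply: (@Rintegral_tuple_cons n D (fun t => complex.Re (f t)) B) => // t Dt; apply: le_trans (Re_le_nm _) (fB _ Dt).
by apply: (@Rintegral_tuple_cons n D (fun t => complex.Im (f t)) B) => // t Dt; apply: le_trans (Im_le_nm _) (fB _ Dt).
Qed.

(** Written as a recursion so that the slice of an ordered simplex at its first
    coordinate is an ordered simplex. *)
Fixpoint ordered (r : R) (s : seq R) : bool :=
  if s is x :: s' then (x <= r) && ordered x s' else 0 <= r.

Lemma ordered_ge0 r s : ordered r s -> 0 <= r.
Proof. by elim: s r => [|x s IH] r //= /andP[xr /IH x0]; exact: le_trans xr. Qed.

Lemma ordered_all r s : ordered r s -> all (fun x => 0 <= x <= r) s.
Proof.
elim: s r => [|x s IH] r //= /andP[xr o]; rewrite (ordered_ge0 o) xr /=.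
by apply: sub_all (IH _ o) => y /andP[-> /le_trans]; exact.
Qed.

(** The ordered simplex r >= u_0 >= ... >= u_(n-1) >= 0. *)
Definition tord n r : set (n.-tuple mR) := [set u | ordered r u].
Arguments tord : clear implicits.

Lemma measurable_ordered n : measurable [set p : mR * n.-tuple mR | ordered p.1 p.2].
Proof.
elim: n => [|n IH].
  rewrite (_ : [set p | _] = fst @^-1` `[0, +oo[%classic).
    by apply: measurable_preim; [exact: measurable_fst|exact: measurable_itv].
  by apply/seteqP; split=> -[x u] /=; rewrite [u]tuple0 /= in_itv /= andbT.
have mh : measurable_fun setT (fun p : mR * n.+1.-tuple mR => tnth p.2 ord0).
  by apply: (measurableT_comp (measurable_coord _)).
rewrite (_ : [set p | _] = [set p : mR * n.+1.-tuple mR | tnth p.2 ord0 <= p.1] `&`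
  ((fun p : mR * n.+1.-tuple mR => (tnth p.2 ord0, [tuple of behead p.2])) @^-1`
    [set p : mR * n.-tuple mR | ordered p.1 p.2])).
  apply: measurableI; last first.
    apply: measurable_preim IH; apply: measurable_fun_pair => //.
    exact: (measurableT_comp (@measurable_behead _ mR n) measurable_snd).
  rewrite (_ : [set p | _] = (fun p : mR * n.+1.-tuple mR => p.1 - tnth p.2 ord0) @^-1` `[0, +oo[%classic).
    by apply: measurable_preim; [exact: measurable_funB|exact: measurable_itv].
  by apply/seteqP; split=> p /=; rewrite in_itv /= andbT subr_ge0.
by apply/seteqP; split=> -[x u] /=; case/tupleP: u => a u /=; rewrite tnth0 /= => /andP.
Qed.

Lemma measurable_tord n r : measurable (tord n r).
Proof.
rewrite (_ : tord n r = (fun u => (r : mR, u)) @^-1` [set p : mR * n.-tuple mR | ordered p.1 p.2])//.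
have m : measurable_fun [set: n.-tuple mR] (fun u => (r : mR, u)) by exact: measurable_pair1.
exact: measurable_preim m (@measurable_ordered n).
Qed.

Lemma tord_tbox n r : tord n r `<=` tbox n r.
Proof.
move=> u o i; have /allP := ordered_all o; have r0 := ordered_ge0 o.
by move=> /(_ (tnth u i) (mem_tnth _ _)) /andP[u0 ->]; rewrite (le_trans _ u0)// oppr_le0.
Qed.

Lemma lebesgueT_tord_fin n r : 0 <= r -> (lam n (tord n r) < +oo)%E.
Proof.
move=> r0; apply: le_lt_trans (_ : (lam n (tbox n r) < +oo)%E).
  by apply: le_measure; rewrite ?inE; [exact: measurable_tord|exact: measurable_tbox|exact: tord_tbox].
by rewrite lebesgueT_tbox// ltry.
Qed.

Lemma lmap_scalar n (r : R) (u : n.-tuple mR) : lmap r%:M u = [tuple r * tnth u i | i < n].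
Proof.
apply: eq_from_tnth => i; rewrite !tnth_mktuple (bigD1 i)//= big1 ?addr0 ?mxE ?eqxx ?mulr1n 1?mulrC// => j ji.
by rewrite mxE (negbTE ji) mulr0.
Qed.

Lemma val_lmap_scalar n (r : R) (u : n.-tuple mR) : tval (lmap r%:M u) = [seq r * y | y <- u].
Proof.
rewrite lmap_scalar; apply: (@eq_from_nth _ 0) => [|i]; rewrite !size_tuple ?size_map ?size_tuple// => i_n.
by rewrite -(tnth_nth _ _ (Ordinal i_n)) tnth_mktuple (nth_map 0) ?size_tuple// (tnth_nth 0).
Qed.

Lemma ordered_scale r x s : 0 < r -> ordered (r * x) [seq r * y | y <- s] = ordered x s.
Proof. by move=> r0; elim: s x => [|y s IH] x /=; rewrite ?pmulr_rge0// ler_pM2l// IH. Qed.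

Lemma tord_scale n r : 0 < r -> lmap r%:M @^-1` tord n r = tord n 1.
Proof.
move=> r0; have E u : ordered r (lmap r%:M u) = ordered 1 u.
  by rewrite val_lmap_scalar -{1}[r]mulr1 ordered_scale.
by apply/seteqP; split=> u; rewrite /tord /preimage /mkset E.
Qed.

Lemma bmf_scale n r (f : n.-tuple mR -> C) : 0 <= r <= 1 -> bmf (tord n r) f ->
  bmf (tord n 1) (fun u => f (lmap r%:M u)).
Proof.
move=> /andP[r0 r1]; apply: bmf_comp; [exact: measurable_lmap|exact: measurable_tord|exact: measurable_tord|].
move=> u; rewrite /tord /mkset val_lmap_scalar.
rewrite -{1}[r]mulr1; elim: (tval u) (1 : R) => [|y s IH] x /=; first exact: mulr_ge0.
by case/andP=> yx /IH ->; rewrite andbT ler_wpM2l.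
Qed.

Lemma cint_tord_scale n r (f : n.-tuple mR -> C) : 0 <= r <= 1 -> bmf (tord n r) f ->
  cint (lam n) (tord n r) f = (r ^+ n)%:C * cint (lam n) (tord n 1) (fun u => f (lmap r%:M u)).
Proof.
move=> /andP[]; rewrite le_eqVlt => /predU1P[<-|r0] r1 bf; last first.
  have ri0 : 0 <= r ^- n by rewrite invr_ge0 exprn_ge0// ltW.
  have E := cint_substitution (@measurable_lmap R n r%:M) ri0
    (fun Y mY => scale_pushforward r0 mY) (@measurable_tord n r) (lebesgueT_tord_fin n (ltW r0)) bf.
  rewrite (tord_scale n r0) in E; rewrite E mulrA -rmorphM mulfV ?mul1r// expf_neq0// gt_eqF//.
case: n f bf => [|n] f bf.
  rewrite expr0 mul1r (_ : tord 0 0 = tord 0 1); last first.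
    by apply/seteqP; split=> u; rewrite /tord /= [u]tuple0 /= ?lexx ?ler01.
  by apply: eq_cint => u _; congr f; rewrite [LHS]tuple0 [RHS]tuple0.
rewrite expr0n mul0r; apply: nm_eq0; apply/le_anti; rewrite nm_ge0 andbT.
have [_ _ [B fB]] := bf.
apply: le_trans (nm_cint_le (@measurable_tord _ _) (lebesgueT_tord_fin n.+1 (lexx 0)) bf fB) _.
suff E : lam n.+1 (tord n.+1 0) = 0%E by rewrite (_ : fine _ = 0) ?mulr0//; exact: (f_equal fine E).
apply/eqP; rewrite eq_le measure_ge0 andbT.
apply: le_trans (_ : (lam n.+1 (tbox n.+1 0) <= _)%E).
  by apply: le_measure; rewrite ?inE; [exact: measurable_tord|exact: measurable_tbox|exact: tord_tbox].
by rewrite lebesgueT_tbox// mulr0 expr0n.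
Qed.

(** The map u_0 = y_(n-1), u_1 = y_(n-1) y_(n-2), ... from the cube onto the ordered
    simplex. *)
Fixpoint duffy_tuple n (y : nat -> R) : n.-tuple mR :=
  if n is n'.+1 then tuple_cons (y n' : mR, lmap (y n')%:M (duffy_tuple n' y)) else [tuple].

Lemma duffy_tuple_upd n k (y : nat -> R) u : (n <= k)%N -> duffy_tuple n (upd y k u) = duffy_tuple n y.
Proof.
elim: n => //= n IH nk; rewrite IH ?(ltnW nk)//.
by rewrite (_ : upd y k u n = y n)// /upd; case: eqP nk => // ->; rewrite ltnn.
Qed.

(** Slicing at the first coordinate t gives the ordered simplex of size t; rescaling it
    produces the weight t^n. *)
Lemma cint_tord n (h : n.-tuple mR -> C) : bmf (tord n 1) h ->
  cint (lam n) (tord n 1) h =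
  outer_iterated n (fun i t => (t ^+ i)%:C : C) (fun y => h (duffy_tuple n y)).
Proof.
elim: n h => [|n IH] h bh.
  rewrite /= (_ : tord 0 1 = setT); last first.
    by apply/seteqP; split=> u //; rewrite /tord /= [u]tuple0 /= ler01.
  have R0 (f : 0.-tuple mR -> R) : Rintegral (lam 0) setT f = f [tuple].
    rewrite /Rintegral /= integral_dirac//; first by rewrite diracT mul1e.
    by rewrite (_ : (fun x => _) = cst (f [tuple])%:E)//; apply/funext => u; rewrite [u]tuple0.
  by apply: cplxP; rewrite /= R0.
have DE x : 0 <= x <= 1 -> [set u | tord n.+1 1 (tuple_cons (x : mR, u))] = tord n x.
  by move=> /andP[_ x1]; apply/seteqP; split=> u; rewrite /tord /= x1.
have DI (p : mR * n.-tuple mR) : tord n.+1 1 (tuple_cons p) -> 0 <= p.1 <= 1.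
  by rewrite /tord /= => /andP[-> /ordered_ge0 ->].
have DF x : (lam n [set u | tord n.+1 1 (tuple_cons (x : mR, u))] < +oo)%E.
  have [x01|nx] := boolP (0 <= x <= 1).
    by rewrite DE//; apply: lebesgueT_tord_fin; case/andP: x01.
  rewrite (_ : [set u | _] = set0) ?measure0 ?ltry//.
  by apply/seteqP; split=> u //= /DI; rewrite (negbTE nx).
have DI' (p : mR * n.-tuple mR) : tord n.+1 1 (tuple_cons p) -> I01 p.1 by move=> /DI /I01E.
rewrite (cint_tuple_cons (@measurable_tord n.+1 1) (lebesgueT_tord_fin n.+1 ler01) bh DI' DF) /=.
apply: eq_cint => x Ix.
have mcons : measurable_fun setT (fun u : n.-tuple mR => tuple_cons (x : mR, u)).
  by apply: (measurableT_comp (@measurable_tuple_cons R n)); exact: measurable_pair1.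
have x01 : 0 <= x <= 1 by exact/I01E.
rewrite DE//; have bx : bmf (tord n x) (fun u => h (tuple_cons (x, u))).
  apply: bmf_comp bh => //; [exact: measurable_tord|exact: measurable_tord|].
  by move=> u; rewrite -DE.
rewrite cint_tord_scale// IH; last exact: (bmf_scale x01 bx).
congr (_ * _); congr outer_iterated; apply/funext => y.
by rewrite duffy_tuple_upd// /upd eqxx.
Qed.

End OrderedSimplex.

Arguments tord {R} n r.

(** * Coordinates on a simplex *)

Section SimplexCoordinates.
Context {R : realType}.
Local Notation C := (cplx R).
Local Notation mR := (measurableTypeR R).
Local Notation lam := (@lebesgueT R).

(** Passes between barycentric coordinates and the ordered coordinates of a simplex. *)
Lemma abel_summation (V : lmodType R) (s : nat -> R) (w : nat -> V) k :
  \sum_(i < k.+1) (s i - s i.+1) *: w i =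
  s 0 *: w 0 + \sum_(i < k) s i.+1 *: (w i.+1 - w i) - s k.+1 *: w k.
Proof.
elim: k => [|k IH]; first by rewrite big_ord1 big_ord0 addr0 scalerBl.
rewrite big_ord_recr IH big_ord_recr /= scalerBl scalerBr !addrA; congr (_ - _).
by rewrite -!addrA; congr (_ + (_ + _)); rewrite addrC.
Qed.

Lemma telescope_sum (s : nat -> R) k : \sum_(i < k.+1) (s i - s i.+1) = s 0 - s k.+1.
Proof.
elim: k => [|k IH]; first by rewrite big_ord1.
by rewrite big_ord_recr IH /= addrA subrK.
Qed.

Lemma orderedP (r : R) (u : seq R) : reflect (forall i, nth 0 (r :: u) i.+1 <= nth 0 (r :: u) i) (ordered r u).
Proof.
elim: u r => [|x u IH] r /=.
  apply: (iffP idP) => [r0 [|i] //=|/(_ 0)//]; by rewrite !nth_nil.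
apply: (iffP andP) => [[xr /IH o] [|i]|o]; rewrite //=; first exact: (o i).
by split; [exact: (o 0)|apply/IH => i; exact: (o i.+1)].
Qed.

Definition afmap (V : lmodType R) k (w : nat -> V) (u : k.-tuple mR) : V :=
  w 0 + \sum_(i < k) (tnth u i : R) *: (w i.+1 - w i).

(** The point of a simplex with given cube coordinates or, when w lists the values of an
    affine function at the vertices, the value of that function there. *)
Fixpoint duffy (V : lmodType R) k (w : nat -> V) (y : nat -> R) : V :=
  if k is k'.+1 then (1 - y k') *: w 0 + y k' *: duffy k' (fun i => w i.+1) y else w 0.

Lemma afmap_duffy (V : lmodType R) k (w : nat -> V) y : afmap w (duffy_tuple k y) = duffy k w y.
Proof.
elim: k w => [|k IH] w; first by rewrite /afmap big_ord0 addr0.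
rewrite [RHS]/= -IH /afmap [in RHS]scalerDr [in RHS]scaler_sumr addrA big_ord_recl tnth0 addrA; congr (_ + _).
  by rewrite scalerBl scale1r scalerBr addrA addrAC.
apply: eq_bigr => i _; rewrite tnthS lmap_scalar tnth_mktuple scalerA.
by [].
Qed.

Lemma tail_sums k (t : 'I_k.+1 -> R) : exists s : nat -> R,
  [/\ s 0 = \sum_i t i, forall i, (k < i)%N -> s i = 0 & forall i : 'I_k.+1, s i - s i.+1 = t i].
Proof.
exists (fun i => \sum_(j < k.+1 | (i <= j)%N) t j); split=> [|i ki|i]; first exact: eq_bigl.
  by rewrite big_pred0// => j; rewrite leqNgt (leq_trans (ltn_ord j) ki).
rewrite (bigD1 i)//= (eq_bigl (fun j : 'I_k.+1 => (i.+1 <= j)%N)) ?addrK// => j.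
by rewrite ltn_neqAle andbC eq_sym.
Qed.

(** The ordered coordinates are the tail sums of the barycentric ones. *)
Lemma tord_afmapP k (V : lmodType R) (w : nat -> V) (x : V) :
  (exists t : 'I_k.+1 -> R, [/\ forall i, 0 <= t i, \sum_i t i = 1 & x = \sum_i t i *: w i]) <->
  (exists2 u : k.-tuple mR, tord k 1 u & x = afmap w u).
Proof.
split=> [[t [t0 t1 ->]]|[u ou ->]].
  have [s [s0 sk sS]] := tail_sums t; rewrite t1 in s0.
  exists [tuple s i.+1 | i < k].
    rewrite /tord /=; apply/orderedP => i.
    have E j : nth 0 (1 :: [tuple s i.+1 | i < k]) j = s j.
      case: j => [|j] /=; first by rewrite s0.
      have [jk|kj] := ltnP j k; last by rewrite nth_default ?sk// size_map size_enum_ord.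
      by rewrite (nth_map (Ordinal jk)) ?size_enum_ord// nth_enum_ord.
    rewrite !E; have [ik|ki] := ltnP i k.+1; last by rewrite !sk// ltnW.
    by rewrite -subr_ge0 (sS (Ordinal ik)).
  under eq_bigr do rewrite -sS.
  rewrite (abel_summation s w) s0 scale1r sk// scale0r subr0 /afmap; congr (_ + _).
  by apply: eq_bigr => i _; rewrite tnth_mktuple.
pose s i := nth 0 (1 :: tval u) i : R.
have sk : s k.+1 = 0 by rewrite /s nth_default//= size_tuple.
exists (fun i => s i - s i.+1); split.
- by move=> i; rewrite subr_ge0; move/orderedP: ou.
- by rewrite telescope_sum sk subr0.
rewrite (abel_summation s w) sk scale0r subr0 /afmap scale1r; congr (_ + _).
by apply: eq_bigr => i _; rewrite (tnth_nth 0).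
Qed.

(** Affine independence in a form that does not single out a vertex. *)
Definition affinely_free n (v : 'I_n.+1 -> 'rV[R]_n) := forall t : 'I_n.+1 -> R,
  \sum_i t i = 0 -> \sum_i t i *: v i = 0 -> forall i, t i = 0.

Lemma affinely_independent_free n (v : 'I_n.+1 -> 'rV[R]_n) :
  affinely_independent v -> affinely_free v.
Proof.
move=> rf t t0; rewrite !big_ord_recl /= => tv.
have Et0 : t ord0 = - \sum_(i < n) t (lift ord0 i).
  by move/eqP: t0; rewrite big_ord_recl addr_eq0 => /eqP.
have tl i : t (lift ord0 i) = 0.
  have /row_free_inj inj := rf; pose r : 'rV[R]_n := \row_i t (lift ord0 i).
  suff : r = 0 by move=> /rowP /(_ i); rewrite !mxE.
  apply: (@inj _ _ 0); rewrite mul0mx mulmx_sum_row.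
  rewrite -[RHS]tv Et0 scaleNr scaler_suml addrC -sumrB; apply: eq_bigr => j _.
  by rewrite rowK mxE scalerBr.
move=> i; case: (unliftP ord0 i) => [j|] -> //.
by rewrite Et0 big1 ?oppr0.
Qed.

Definition edge_mx n (w : nat -> 'rV[R]_n) : 'M[R]_n := \matrix_(i < n) (w i.+1 - w i).

Lemma edge_mx_unit n (w : nat -> 'rV[R]_n) :
  affinely_free (fun i : 'I_n.+1 => w i) -> edge_mx w \in unitmx.
Proof.
move=> af; rewrite -row_free_unit; apply/row_freeP.
suff : row_free (edge_mx w) by move/row_freeP.
rewrite -kermx_eq0; apply/rowV0P => r /sub_kermxP rM.
pose s i := if i is j.+1 then (if insub j is Some k then r 0 k else 0) else 0 : R.
have sr (i : 'I_n) : s i.+1 = r 0 i.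
  by rewrite /s; case: insubP => [k _ /val_inj ->//|]; rewrite ltn_ord.
have sn : s n.+1 = 0 by rewrite /s insubF// ltnn.
have sE := af (fun i => s i - s i.+1).
have {}sE (i : 'I_n.+1) : s i - s i.+1 = 0.
  apply: sE; first by rewrite telescope_sum sn subr0.
  rewrite (abel_summation s w) sn !scale0r subr0 add0r -[RHS]rM mulmx_sum_row.
  by apply: eq_bigr => j _; rewrite rowK sr.
have s0 j : (j <= n.+1)%N -> s j = 0.
  elim: j => [|j IH] // jn; have := sE (Ordinal jn); rewrite /= IH ?(ltnW jn)// => /eqP.
  by rewrite sub0r oppr_eq0 => /eqP.
by apply/rowP => i; rewrite mxE -sr s0// ltnS ltnW.
Qed.

End SimplexCoordinates.

(** * Integrals over a simplex *)

Section SimplexIntegral.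
Context {R : realType} (n : nat).
Local Notation C := (cplx R).
Local Notation mR := (measurableTypeR R).
Local Notation lam := (@lebesgueT R).
Local Notation rt := (@row_of_tuple R n).

(** A superlevel set is the trace on D of the countably many boxes with rational centre
    and radius 1/(m+1) whose trace lies in it. *)
Lemma measurable_fun_modulus (D : set (n.-tuple mR)) (f : n.-tuple mR -> R) : measurable D ->
  (forall e, 0 < e -> exists2 d, 0 < d & forall u u', D u -> D u' ->
    (forall i, `|tnth u' i - tnth u i| < d) -> `|f u' - f u| < e) ->
  measurable_fun D f.
Proof.
move=> mD fmod _; apply: (measurability _ (RGenOInfty.measurableE R)) => //.
move=> _ [_ [a ->] <-].
pose box (p : n.-tuple rat * nat) : set (n.-tuple mR) :=
  [set u | forall i, - (p.2.+1%:R^-1) <= tnth u i - ratr (tnth p.1 i) <= p.2.+1%:R^-1].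
pose P p := forall u, D u -> box p u -> a < f u.
have -> : D `&` f @^-1` `]a, +oo[%classic = D `&` \bigcup_p (if `[< P p >] then box p else set0).
  apply/seteqP; split=> u /=; rewrite in_itv /= andbT => -[Du].
    move=> afu; split=> //; have fa : 0 < f u - a by rewrite subr_gt0.
    have [d d0 dP] := fmod _ fa; have d2 : 0 < d / 2 by rewrite divr_gt0.
    pose m := Num.truncn (d / 2)^-1; have md : m.+1%:R^-1 < d / 2.
      by rewrite invf_plt ?posrE// truncnS_gt.
    have m0 : 0 < m.+1%:R^-1 :> R by rewrite invr_gt0 ltr0n.
    have hlp1 (x y r : R) : x - r < y -> y < x + r -> `|x - y| <= r.
      by move=> h1 h2; rewrite ler_norml; apply/andP; split; lra.
    have hlp2 (x x' y r : R) : `|x - y| <= r -> - r <= x' - y <= r -> r < d / 2 -> `|x' - x| < d.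
      by rewrite ler_norml ltr_norml => /andP[h1 h2] /andP[h3 h4] h5; apply/andP; split; lra.
    have qe i : exists q : rat, `|tnth u i - ratr q| <= m.+1%:R^-1.
      have [|q] := @rat_in_itvoo R (tnth u i - m.+1%:R^-1) (tnth u i + m.+1%:R^-1).
        by rewrite ltrD2l gtrN.
      by rewrite in_itv /= => /andP[q1 q2]; exists q; exact: hlp1.
    have [q qP] := choice qe; pose p := ([tuple q i | i < n], m).
    exists p => //; rewrite asboolT; first by move=> i; rewrite -ler_norml tnth_mktuple.
    move=> u' Du' bu'; have := dP u u' Du Du'; set lt := (forall i, _) => H.
    have : `|f u' - f u| < f u - a.
      by apply: H => i; apply: hlp2 (qP i) _ md; have := bu' i; rewrite tnth_mktuple.
    by rewrite ltr_norml => /andP[]; lra.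
  by move=> [p _]; case: asboolP => // Pp bu; split=> //; exact: Pp.
apply: measurableI => //; apply: countable_bigcupT_measurable => [|p].
  exact: countableP.
case: asboolP => // _.
rewrite (_ : box p = tshift (fun i => - ratr (tnth p.1 i)) @^-1` tbox n p.2.+1%:R^-1).
  by apply: measurable_preim (@measurable_tshift _ _ _) _; exact: measurable_tbox.
by apply/seteqP; split=> u /= H i; have := H i; rewrite tnth_mktuple.
Qed.

Variable w : nat -> 'rV[R]_n.
Let v (i : 'I_n.+1) := w i.
Hypothesis wf : affinely_free v.
Local Notation V := (simplex v).

Let A (u : n.-tuple mR) : n.-tuple mR := tshift (fun i => w 0 0 i) (lmap (edge_mx w) u).
Let A' (u : n.-tuple mR) : n.-tuple mR :=
  tshift (fun i => (- (w 0 *m invmx (edge_mx w))) 0 i) (lmap (invmx (edge_mx w)) u).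

Let rtA u : rt (A u) = afmap w u.
Proof.
rewrite row_of_tshift row_of_lmap /afmap addrC; congr (_ + _).
  by apply/rowP => i; rewrite mxE.
by rewrite mulmx_sum_row; apply: eq_bigr => i _; rewrite rowK mxE.
Qed.

Let AA' : cancel A' A.
Proof.
move=> u; apply: row_of_tuple_inj; have uw := edge_mx_unit wf.
rewrite /A row_of_tshift row_of_lmap /A' row_of_tshift row_of_lmap.
rewrite (_ : \row_i (- (w 0 *m invmx (edge_mx w))) 0 i = - (w 0 *m invmx (edge_mx w))); last by apply/rowP => i; rewrite mxE.
rewrite (_ : \row_i w 0 0 i = w 0); last by apply/rowP => i; rewrite mxE.
by rewrite mulmxDl mulNmx !mulmxKV// subrK.
Qed.

Let A'A : cancel A A'.
Proof.
move=> u; apply: row_of_tuple_inj; have uw := edge_mx_unit wf.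
rewrite /A' row_of_tshift row_of_lmap /A row_of_tshift row_of_lmap.
rewrite (_ : \row_i (- (w 0 *m invmx (edge_mx w))) 0 i = - (w 0 *m invmx (edge_mx w))); last by apply/rowP => i; rewrite mxE.
rewrite (_ : \row_i w 0 0 i = w 0); last by apply/rowP => i; rewrite mxE.
by rewrite mulmxDl mulmxK// addrK.
Qed.

Let mA : measurable_fun setT A.
Proof. exact: (measurableT_comp (@measurable_tshift _ _ _) (@measurable_lmap _ _ _)). Qed.

Let mA' : measurable_fun setT A'.
Proof. exact: (measurableT_comp (@measurable_tshift _ _ _) (@measurable_lmap _ _ _)). Qed.

Lemma simplex_afmapP (x : 'rV[R]_n) : V x <-> exists2 u : n.-tuple mR, tord n 1 u & x = afmap w u.
Proof. exact: (tord_afmapP n w x). Qed.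

Let preV : rt @^-1` V = A' @^-1` tord n 1.
Proof.
apply/seteqP; split=> u /=.
  move/simplex_afmapP => [u' ou']; rewrite -rtA => /row_of_tuple_inj ->.
  by rewrite A'A.
by move=> ou; apply/simplex_afmapP; exists (A' u) => //; rewrite -rtA AA'.
Qed.

Lemma measurable_simplex : measurable (rt @^-1` V).
Proof. by rewrite preV; apply: measurable_preim mA' _; exact: measurable_tord. Qed.

Let Aunit : invmx (edge_mx w) \in unitmx.
Proof. by rewrite unitmx_inv edge_mx_unit. Qed.

Lemma lebesgueT_simplex_fin : (lam n (rt @^-1` V) < +oo)%E.
Proof.
have [c c0 cE] := linear_pushforward (fun i => (- (w 0 *m invmx (edge_mx w))) 0 i) Aunit.
rewrite preV; have := cE (tord n 1) (@measurable_tord _ _ _); rewrite -/A' => ->.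
have F : lam n (tord n 1) \is a fin_num by rewrite ge0_fin_numE// lebesgueT_tord_fin.
by rewrite -(fineK F) -EFinM ltry.
Qed.

(** The affine map from the ordered simplex onto V multiplies the measure by a constant. *)
Lemma simplex_integral : exists2 c : R, 0 <= c & forall g : 'rV[R]_n -> C,
  bmf (rt @^-1` V) (g \o rt) ->
  cintegral V g = c%:C * outer_iterated n (fun i t => (t ^+ i)%:C : C) (fun y => g (duffy n w y)).
Proof.
have [c c0 cE] := linear_pushforward (fun i => (- (w 0 *m invmx (edge_mx w))) 0 i) Aunit.
exists c => // g bg.
have bA : bmf (tord n 1) ((g \o rt) \o A).
  apply: bmf_comp mA (@measurable_tord _ _ _) measurable_simplex _ bg => u ou.
  by apply/simplex_afmapP; exists u; rewrite ?rtA.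
have E := cint_substitution mA' c0 cE (@measurable_tord _ _ _) (lebesgueT_tord_fin n ler01) bA.
rewrite -preV in E; rewrite cint_tord// in E.
rewrite -[LHS]/(cint (lam n) (rt @^-1` V) (g \o rt)) (_ : g \o rt = ((g \o rt) \o A) \o A').
  rewrite E; congr (_ * _); congr outer_iterated; apply/funext => y /=.
  by rewrite rtA afmap_duffy.
by apply/funext => u; rewrite /= AA'.
Qed.

Lemma duffy_simplex y : cube y -> V (duffy n w y).
Proof.
move=> cy; apply/simplex_afmapP; exists (duffy_tuple n y); last by rewrite afmap_duffy.
rewrite /tord /=; elim: (n) => [|k IH] /=; first exact: ler01.
have /andP[y0 y1] := cy k; rewrite y1 /=.
have [yk|yk] := eqVneq (y k) 0; last first.
  by rewrite val_lmap_scalar -[X in ordered X]mulr1 ordered_scale// lt_neqAle eq_sym yk.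
rewrite val_lmap_scalar yk; apply/orderedP => i.
have E (s : seq R) j : nth 0 (0 :: [seq 0 * z | z <- s]) j = 0.
  case: j => [|j] //=; have [js|js] := ltnP j (size s); last by rewrite nth_default ?size_map.
  by rewrite (nth_map 0)// mul0r.
by rewrite !E.
Qed.

Lemma coord_null m (a : R) : lam m.+1 [set u : m.+1.-tuple mR | tnth u ord0 = a] = 0%E.
Proof.
rewrite lebesgueTS (_ : _ @^-1` _ = [set a] `*` setT).
  have ma : measurable ([set a] : set mR) by exact: measurable_set1.
  apply: etrans (product_measure1E (@lebesgue_measure R) (lam m) ma measurableT) _.
  apply: etrans (congr1 (fun x => x * lam m setT)%E (lebesgue_measure_set1 a)) _.
  exact: mul0e.
by apply/seteqP; split=> -[x u] /=; rewrite tnth0 //; case.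
Qed.

(** In ordered coordinates the face opposite to the first vertex lies in the hyperplane
    u_0 = 1. *)
Lemma face_null : (0 < n)%N -> exists N : set (n.-tuple mR), [/\ measurable N, lam n N = 0%E &
  rt @^-1` [set x | exists t : 'I_n.+1 -> R,
    [/\ \sum_i t i = 1, t ord0 = 0 & x = \sum_i t i *: v i]] `<=` N].
Proof.
have [c c0 cE] := linear_pushforward (fun i => (- (w 0 *m invmx (edge_mx w))) 0 i) Aunit.
move=> n0; pose H : set (n.-tuple mR) := [set u | tnth u (Ordinal n0) = 1].
have mH : measurable H.
  rewrite (_ : H = (fun u : n.-tuple mR => tnth u (Ordinal n0)) @^-1` [set 1])//.
  by apply: measurable_preim (measurable_coord _) _; exact: measurable_set1.
have H0 : lam n H = 0%E.
  rewrite /H; case: (n) (n0) => [//|m] m0.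
  by rewrite (_ : Ordinal m0 = ord0) ?coord_null//; exact: val_inj.
exists (A' @^-1` H); split; first exact: measurable_preim mA' mH.
  by rewrite cE// H0 mule0.
move=> u /= [t [t1 t0 tE]]; have [s [s0 sk sS]] := tail_sums t; rewrite t1 in s0.
have -> : u = A [tuple s i.+1 | i < n].
  apply: row_of_tuple_inj; rewrite rtA tE; under eq_bigr do rewrite -sS.
  rewrite (abel_summation s w) s0 scale1r sk// scale0r subr0 /afmap; congr (_ + _).
  by apply: eq_bigr => i _; rewrite tnth_mktuple.
by rewrite A'A /H /= tnth_mktuple /=; have := sS ord0; rewrite t0 s0 => /eqP; rewrite subr_eq0 => /eqP.
Qed.

End SimplexIntegral.

Lemma compact_simplex (R : realType) n (v : 'I_n.+1 -> 'rV[R]_n) : compact (simplex v).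
Proof.
pose f (t : 'rV[R]_n.+1) : 'rV[R]_n := \sum_i t 0 i *: v i.
pose K := [set t : 'rV[R]_n.+1 | forall i, `[0 : R, 1]%classic (t 0 i)] `&` [set t | \sum_i t 0 i = 1].
have -> : simplex v = f @` K.
  apply/seteqP; split=> x.
    move=> [t [t0 t1 ->]]; exists (\row_i t i).
      split=> [i|]; rewrite /= ?mxE.
        rewrite in_itv /= t0 /= -t1 (bigD1 i)//= lerDl; exact: sumr_ge0.
      by rewrite -[RHS]t1; apply: eq_bigr => i _; rewrite mxE.
    by rewrite /f; apply: eq_bigr => i _; rewrite mxE.
  move=> [t [t01 t1] <-]; exists (fun i => t 0 i); split=> // i.
  by have := t01 i; rewrite /= in_itv /= => /andP[].
apply: continuous_compact.
  apply: continuous_subspaceT.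
  apply: (@continuous_big 'rV[R]_n 'I_n.+1 +%R 0 xpredT) => [|i _ t]; first exact: add_continuous.
  apply: cvgZr_tmp; first exact: (nbhs_filter t).
  exact: (@coord_continuous R 1 n.+1 0 i t).
apply: compact_closedI.
  by apply: (@rV_compact _ _ (fun=> `[0 : R, 1]%classic)) => i; exact: segment_compact.
apply: (@closed_comp _ _ (fun t : 'rV[R]_n.+1 => \sum_i t 0 i) [set 1]); last exact: closed_eq.
move=> t _; apply: (@continuous_big R 'I_n.+1 +%R 0 xpredT) => [|i _ t']; first exact: add_continuous.
exact: (@coord_continuous R 1 n.+1 0 i t').
Qed.

(** * The integrand in cube coordinates *)

Section IntegrandOnSimplex.
Context {R : realType}.
Local Notation C := (cplx R).
Local Notation mR := (measurableTypeR R).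
Local Notation lam := (@lebesgueT R).
Local Notation rt := (@row_of_tuple R _).

Lemma cint_setU d (T : measurableType d) (mu : {measure set T -> \bar R}) (D1 D2 N : set T) (f : T -> C) :
  measurable D1 -> measurable D2 -> measurable N -> mu N = 0%E -> D1 `&` D2 `<=` N ->
  (mu (D1 `|` D2) < +oo)%E -> bmf (D1 `|` D2) f ->
  cint mu (D1 `|` D2) f = cint mu D1 f + cint mu D2 f.
Proof.
move=> m1 m2 mN N0 DN muD bf.
have mU : measurable (D1 `|` D2) by exact: measurableU.
have key (h : T -> R) : mu.-integrable (D1 `|` D2) (EFin \o h) ->
    Rintegral mu (D1 `|` D2) h = Rintegral mu D1 h + Rintegral mu D2 h.
  move=> hi.
  have h1 : mu.-integrable D1 (EFin \o h) by apply: integrableS hi => //; exact: subsetUl.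
  have h2 : mu.-integrable D2 (EFin \o h) by apply: integrableS hi => //; exact: subsetUr.
  have nN (D : set T) : measurable D -> mu.-integrable D (EFin \o h) ->
      Rintegral mu D h = Rintegral mu (D `\` N) h.
    by move=> mD iD; rewrite /Rintegral (negligible_integral mN mD).
  rewrite (nN _ mU hi) (nN _ m1 h1) (nN _ m2 h2) setDUl Rintegral_setU//.
  - exact: measurableD.
  - exact: measurableD.
  - by rewrite -setDUl; apply: integrableS hi => //; exact: measurableD.
  - apply/disj_setPS => t [[d1 nt] [d2 _]]; exact/nt/DN.
apply: cplxP => /=.
  by apply: (key (fun t => complex.Re (f t))); exact: bmf_Re.
by apply: (key (fun t => complex.Im (f t))); exact: bmf_Im.
Qed.

(** An analytic function is Lipschitz along a compact set. *)
Lemma bmf_analytic n (V : set 'rV[R]_n) (E : 'rV[C]_(1 + n) -> C) s :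
  compact V -> measurable (rt @^-1` V) -> (forall x, V x -> analytic_at E (complex_point s x)) ->
  bmf (rt @^-1` V) (fun u => E (complex_point s (rt u))).
Proof.
move=> cV mV EV; have [K K0 KP] := quad_slice_uniform cV EV.
have [B B0 BP] := bounded_slice cV EV.
have [D DP] : exists D : 'I_n -> R, forall j, 0 <= D j /\ forall z, V z -> nm (partial E j s z) <= D j.
  have ch j : exists D : R, 0 <= D /\ forall z, V z -> nm (partial E j s z) <= D.
    have [|D D0 H] := @bounded_slice _ _ V cV (fun pt => grad E pt (rshift 1 j)) s; last by exists D.
    by move=> x Vx; apply: grad_analytic; exact: EV.
  by have [D H] := choice ch; exists D.
pose S := K + \sum_j D j; have S0 : 0 <= S by apply: addr_ge0 => //; apply: sumr_ge0 => j _; case: (DP j).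
have key e : 0 < e -> exists2 d : R, 0 < d & forall u u' : n.-tuple mR, V (rt u) -> V (rt u') ->
    (forall i, `|tnth u' i - tnth u i| < d) ->
    nm (E (complex_point s (rt u')) - E (complex_point s (rt u))) < e.
  move=> e0; have S1 : 0 < S + 1 by rewrite ltr_wpDl.
  exists (Num.min 1 (e / (S + 1))); first by rewrite lt_min ltr01 divr_gt0.
  set d := Num.min _ _ => u u' Vu Vu' uu.
  have d1 : d <= 1 by rewrite ge_min lexx.
  have de : d * (S + 1) <= e by rewrite -ler_pdivlMr// ge_min lexx orbT.
  have d0 : 0 < d by rewrite lt_min ltr01 divr_gt0.
  apply: lt_le_trans de; rewrite mulrDr mulr1; apply: le_lt_trans (_ : d * S < _); last by rewrite ltrDl.
  have h := KP (rt u) (rt u') d Vu Vu' (ltW d0) _.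
  have {}h := h (fun j => _).
  have H : forall j, `|rt u' 0 j - rt u 0 j| <= d by move=> j; rewrite !mxE ltW.
  have {}h := KP (rt u) (rt u') d Vu Vu' (ltW d0) H.
  rewrite -[_ - _](subrK (\sum_j (rt u' 0 j - rt u 0 j)%:C * partial E j s (rt u))).
  apply: le_trans (nmD _ _) _; rewrite /S mulrDr; apply: lerD.
    by apply: le_trans h _; rewrite expr2 [d * K]mulrC; apply: ler_wpM2l => //; rewrite ler_piMl// ltW.
  apply: le_trans (nm_sum _ _ _) _; rewrite mulr_sumr; apply: ler_sum => j _.
  by rewrite nmMr; apply: ler_pM => //; [exact: nm_ge0|case: (DP j) => _; exact].
split; last by exists B => u Vu; exact: BP.
- apply: measurable_fun_modulus => // e /key[d d0 dP]; exists d => // u u' Vu Vu' uu.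
  by apply: le_lt_trans (dP u u' Vu Vu' uu); rewrite -raddfB; exact: Re_le_nm.
- apply: measurable_fun_modulus => // e /key[d d0 dP]; exists d => // u u' Vu Vu' uu.
  by apply: le_lt_trans (dP u u' Vu Vu' uu); rewrite -raddfB; exact: Im_le_nm.
Qed.

Lemma bmf_cpow_comp d (T : measurableType d) (D : set T) (P : T -> R) (B : R) s :
  measurable_fun setT P -> (forall t, D t -> 0 <= P t <= B) -> 0 <= complex.Re s ->
  bmf D (fun t => real_cpow (P t) s).
Proof.
move=> mP PB s0; have [c1 c2] := measurable_cpow s; split.
- by apply: measurable_funTS; exact: (measurableT_comp c1 mP).
- by apply: measurable_funTS; exact: (measurableT_comp c2 mP).
exists (2 * expR (complex.Re s * ln (B + 1))) => t /PB/andP[].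
rewrite le_eqVlt => /predU1P[<-|P0] PtB; first by rewrite cpow0 nm0 mulr_ge0 ?expR_ge0.
apply: le_trans (nm_cpow_le _ P0) _; rewrite ler_wpM2l// ler_expR ler_wpM2l// ler_ln ?posrE//.
  by apply: le_trans PtB _; rewrite lerDl.
by rewrite ltr_wpDl// (le_trans (ltW P0)).
Qed.

Lemma linear_poly_comb n (c : R) (l : 'rV[R]_n) (I : finType) (t : I -> R) (v : I -> 'rV[R]_n) :
  \sum_i t i = 1 -> linear_poly c l (\sum_i t i *: v i) = \sum_i t i * linear_poly c l (v i).
Proof.
move=> t1; rewrite /linear_poly; under [RHS]eq_bigr do rewrite mulrDr.
rewrite big_split /= -mulr_suml t1 mul1r; congr (_ + _).
under [RHS]eq_bigr do rewrite mulr_sumr; rewrite exchange_big /=; apply: eq_bigr => i _.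
rewrite summxE mulr_sumr; apply: eq_bigr => j _; rewrite mxE; ring.
Qed.

Lemma duffy_map (V W : lmodType R) (f : V -> W) k (w : nat -> V) y :
  (forall t a b, f ((1 - t) *: a + t *: b) = (1 - t) *: f a + t *: f b) ->
  f (duffy k w y) = duffy k (fun i => f (w i)) y.
Proof. by move=> fl; elim: k w => //= k IH w; rewrite fl IH. Qed.

Definition duffyR k (al : nat -> R) y : R := @duffy R R^o k al y.

Lemma duffyRS k al y : duffyR k.+1 al y = (1 - y k) * al 0 + y k * duffyR k (fun i => al i.+1) y.
Proof. by []. Qed.

Lemma linear_poly_duffy n (c : R) (l : 'rV[R]_n) k (w : nat -> 'rV[R]_n) y :
  linear_poly c l (duffy k w y) = duffyR k (fun i => linear_poly c l (w i)) y.
Proof.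
apply: (@duffy_map _ R^o (linear_poly c l)) => t a b.
rewrite /linear_poly -![_ *: (_ : R^o)]/(_ * _) !mulrDr addrACA -mulrDl subrK mul1r; congr (_ + _).
by rewrite !mulr_sumr -big_split /=; apply: eq_bigr => i _; rewrite !mxE; ring.
Qed.

Lemma coord_duffy n k (w : nat -> 'rV[R]_n) y j :
  duffy k w y 0 j = duffyR k (fun i => w i 0 j) y.
Proof. by apply: (@duffy_map _ R^o (fun x : 'rV[R]_n => x 0 j)) => t a b; rewrite !mxE. Qed.

Lemma rpoly_duffyR k al : rpoly (duffyR k al).
Proof.
elim: k al => [|k IH] al; first exact: rpoly_cst.
apply: rpoly_add; apply: rpoly_mul; [|exact: rpoly_cst|exact: rpoly_coord|exact: IH].
rewrite (_ : (fun y => _) = (fun y => 1 + (-1) * y k)); last by apply/funext => y; rewrite mulN1r.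
by apply: rpoly_add; [exact: rpoly_cst|apply: rpoly_mul; [exact: rpoly_cst|exact: rpoly_coord]].
Qed.

Lemma duffyR_gt0 k al : (forall i, (i <= k)%N -> 0 < al i) ->
  exists2 c : R, 0 < c & forall y, cube y -> c <= duffyR k al y.
Proof.
elim: k al => [|k IH] al al0; first by exists (al 0) => //; exact: al0.
have [|c c0 cP] := IH (fun i => al i.+1); first by move=> i ik; exact: (al0 i.+1).
exists (Num.min (al 0) c) => [|y cy]; first by rewrite lt_min c0 al0.
have /andP[y0 y1] := cy k; rewrite duffyRS -[X in X <= _]mul1r -[X in X * _](subrK (y k)) mulrDl.
apply: lerD; first by rewrite ler_wpM2l ?subr_ge0// ge_min lexx.
by rewrite ler_wpM2l// (le_trans _ (cP y cy))// ge_min lexx orbT.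
Qed.

(** While the leading value vanishes a factor y_k comes out; once all the values that
    remain are positive, so is every convex combination of them. *)
Lemma duffyR_monomial k al : (forall i, (i <= k)%N -> 0 <= al i) ->
  (forall i i', (i <= i' <= k)%N -> al i' = 0 -> al i = 0) ->
  (exists2 i, (i <= k)%N & al i != 0) ->
  exists (e : nat -> nat) H (c : R), [/\ forall i, (e i <= 1)%N, rpoly H, 0 < c,
    forall y, cube y -> c <= H y & forall y, duffyR k al y = (\prod_(i < k) y i ^+ e i) * H y].
Proof.
elim: k al => [|k IH] al al0 zf [i0 i0k ai0].
  move: i0k ai0; rewrite leqn0 => /eqP -> a0.
  exists (fun=> 0%N), (fun=> al 0), (al 0); split=> //; first exact: rpoly_cst.
    by rewrite lt_neqAle eq_sym a0 al0.
  by move=> y; rewrite big_ord0 mul1r.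
have [a0|a0] := eqVneq (al 0) 0.
  have [||| e [H [c [e1 rH c0 cH dE]]]] := IH (fun i => al i.+1).
  - by move=> i ik; exact: (al0 i.+1).
  - by move=> i i' ii'; exact: (zf i.+1 i'.+1).
  - by case: i0 i0k ai0 => [|i] ik ai; [rewrite a0 eqxx in ai|exists i].
  exists (fun i => if i == k then 1%N else e i), H, c; split=> // [i|y].
    by case: ifP.
  rewrite duffyRS a0 mulr0 add0r dE big_ord_recr /= eqxx expr1 mulrA [y k * _]mulrC.
  by congr (_ * _ * _); apply: eq_bigr => i _; rewrite ltn_eqF.
have [i ik|c c0 cP] := @duffyR_gt0 k.+1 al.
  rewrite lt_neqAle al0// andbT eq_sym; apply/eqP => ai; move/eqP: a0; apply.
  by apply: (zf 0 i).
exists (fun=> 0%N), (duffyR k.+1 al), c; split=> //; first exact: rpoly_duffyR.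
by move=> y; rewrite big1 ?mul1r// => i _; rewrite expr0.
Qed.

Lemma outer_iterated_ext n w F G : (forall y, cube y -> F y = G y) ->
  @outer_iterated R n w F = outer_iterated n w G.
Proof.
elim: n F G => [|n IH] F G FG /=; first by apply: FG => i; rewrite lexx ler01.
apply: eq_cint => t /I01E t01; congr (_ * _); apply: IH => y cy; apply: FG; exact: cube_upd.
Qed.

Lemma cpowM0 (t u : R) a : 0 <= t -> 0 <= u -> real_cpow (t * u) a = real_cpow t a * real_cpow u a.
Proof.
move=> t0; rewrite le_eqVlt => /predU1P[<-|u0]; last exact: cpowM.
by rewrite mulr0 cpow0 mulr0.
Qed.

Lemma cpow_expr (t : R) m s : 0 <= t -> real_cpow (t ^+ m) s = pow_factor m s t.
Proof.
rewrite /pow_factor; case: (eqVneq m 0) => [-> _|m0]; first by rewrite expr0 cpow1.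
rewrite le_eqVlt => /predU1P[<-|t0]; first by rewrite expr0n (negbTE m0) !cpow0.
rewrite !cpow_pos ?exprn_gt0// lnXn// -[ln t *+ m]mulr_natr rmorphM rmorph_nat; congr cexp; ring.
Qed.

Lemma cpow_monomial n (m : nat -> nat) (y : nat -> R) s : cube y ->
  real_cpow (\prod_(i < n) y i ^+ m i) s = \prod_(i < n) pow_factor (m i) s (y i) /\
  0 <= \prod_(i < n) y i ^+ m i.
Proof.
move=> cy; elim: n => [|n [IH p0]]; first by rewrite !big_ord0 cpow1 ler01.
have /andP[y0 _] := cy n.
by rewrite !big_ord_recr /= cpowM0 ?exprn_ge0// IH cpow_expr// mulr_ge0 ?exprn_ge0.
Qed.

End IntegrandOnSimplex.

(** * Simplices with nested zero sets *)

Section ClearedPoles.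
Context {R : realType}.
Local Notation C := (cplx R).
Local Notation rt := (@row_of_tuple R _).

Definition holat (s0 : C) (g : C -> C) := exists e, hol e s0 g.

Lemma holat_cst s0 a : holat s0 (fun=> a).
Proof.
exists (nm a + 1)^-1; apply: hol_cst; first by rewrite invr_gt0 ltr_wpDl ?nm_ge0.
by rewrite invrK lerDl.
Qed.

Lemma holat_id s0 : holat s0 id.
Proof.
have p : 0 < nm s0 + 1 by rewrite ltr_wpDl ?nm_ge0.
exists (nm s0 + 1)^-1; apply: hol_id; first by rewrite invr_gt0.
  by rewrite invf_le1// lerDr nm_ge0.
by rewrite invrK lerDl.
Qed.

Lemma holat2 s0 g h : holat s0 g -> holat s0 h -> exists e, hol e s0 g /\ hol e s0 h.
Proof.
move=> [e he] [e' he']; have e0 := hol_gt0 he; have e'0 := hol_gt0 he'.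
exists (Num.min e e'); split; [apply: hol_le he|apply: hol_le he'];
  by rewrite ?lt_min ?e0 ?e'0// ge_min lexx ?orbT.
Qed.

Lemma holat_add s0 g h : holat s0 g -> holat s0 h -> holat s0 (fun s => g s + h s).
Proof. by move=> hg /(holat2 hg)[e [h1 h2]]; exists (e / 2); exact: hol_add. Qed.

Lemma holat_mul s0 g h : holat s0 g -> holat s0 h -> holat s0 (fun s => g s * h s).
Proof. by move=> hg /(holat2 hg)[e [h1 h2]]; exists (mul_radius e); exact: hol_mul. Qed.

Lemma holat_expr s0 g m : holat s0 g -> holat s0 (fun s => g s ^+ m).
Proof.
move=> hg; elim: m => [|m IH].
  by have [e he] := holat_cst s0 1; exists e; apply: hol_eq he => s _; rewrite expr0.
by have [e he] := holat_mul hg IH; exists e; apply: hol_eq he => s _; rewrite exprS.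
Qed.

Lemma holat_prod s0 (I : Type) (r : seq I) (P : pred I) (F : I -> C -> C) :
  (forall i, P i -> holat s0 (F i)) -> holat s0 (fun s => \prod_(i <- r | P i) F i s).
Proof.
move=> hF; elim: r => [|i r IH].
  by have [e he] := holat_cst s0 1; exists e; apply: hol_eq he => s _; rewrite big_nil.
case Pi : (P i); last by have [e he] := IH; exists e; apply: hol_eq he => s _; rewrite big_cons Pi.
by have [e he] := holat_mul (hF i Pi) IH; exists e; apply: hol_eq he => s _; rewrite big_cons Pi.
Qed.

Lemma holat_subr s0 q : holat s0 (fun s => s - q).
Proof. by apply: holat_add; [exact: holat_id|exact: holat_cst]. Qed.

(** All rationals -a/m in a range containing the zeros of the factors of every variable,
    whatever the exponents m <= k; repetitions are removed so that the zeros are simple. *)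
Definition pole_list n k M : seq rat :=
  undup [seq - (a%:R / m%:R) | a <- iota 1 (n + (M * k).+1), m <- iota 1 k].

Definition pole_prod n k M (s : C) : C := \prod_(q <- pole_list n k M) (s - ratr q).

(** Each of the n variables contributes at most a simple zero at each point, hence the
    n-th power. *)
Definition clearing n k M (s : C) : C := pole_prod n k M s ^+ n.

(** The zeros of the factors of one variable are distinct members of the list. *)
Lemma pole_factor_dvd n k M m nu : (m <= k)%N -> (nu < n)%N ->
  exists2 Q : C -> C, forall s, holat s Q &
    forall s, pole_prod n k M s = Q s * pole_factor m nu (M * k).+1 s.
Proof.
move=> mk nun; set N := (M * k).+1.
case: (posnP m) => [->|m0].
  exists (pole_prod n k M) => [s|s]; last by rewrite /pole_factor eqxx mulr1.
  by apply: holat_prod => q _; exact: holat_subr.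
pose root j : rat := - ((nu + j.+1)%:R / m%:R); pose r := [seq root j | j <- iota 0 N].
have m0' : (m%:R : rat) != 0 by rewrite pnatr_eq0 -lt0n.
have ur : uniq r.
  rewrite map_inj_uniq ?iota_uniq// => i j /oppr_inj /(divIf m0') /eqP.
  by rewrite eqr_nat eqn_add2l eqSS => /eqP.
have rp q : q \in r -> q \in pole_list n k M.
  move=> /mapP[j]; rewrite mem_iota /= add0n => jN ->; rewrite mem_undup.
  apply/allpairsP; exists ((nu + j.+1)%N, m); split=> //=; rewrite mem_iota.
    rewrite addnS ltnS leq0n /= -addSn; apply: leq_trans (_ : (nu.+1 + N <= _)%N); last first.
      by rewrite -/N add1n ltnW// ltnS leq_add2r.
    by rewrite ltn_add2l.
  by rewrite m0 add1n ltnS.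
pose Q s : C := (m%:R ^+ N)^-1 * \prod_(q <- pole_list n k M | q \notin r) (s - ratr q).
exists Q => [s|s].
  by apply: holat_mul; [exact: holat_cst|apply: holat_prod => q _; exact: holat_subr].
have mC : (m%:R : C) != 0 by rewrite pnatr_eq0 -lt0n.
have PF : pole_factor m nu N s = m%:R ^+ N * \prod_(q <- r) (s - ratr q).
  rewrite /pole_factor gtn_eqF// /r big_map -[X in iota 0 X]subn0 -/(index_iota 0 N) big_mkord.
  rewrite -[X in _ ^+ X]card_ord -prodr_const -big_split /=; apply: eq_bigr => j _.
  rewrite /root rmorphN opprK fmorph_div !rmorph_nat mulrDr -addrA -natrD; congr (_ + _).
  by rewrite mulrCA mulfV ?mulr1.
rewrite PF /Q /pole_prod (bigID (fun q => q \in r)) /= mulrC.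
rewrite [RHS]mulrACA mulVf ?expf_neq0// mul1r; congr (_ * _).
rewrite -big_filter; apply: perm_big; apply: uniq_perm => //.
  by rewrite filter_uniq// undup_uniq.
by move=> q; rewrite mem_filter; case: (boolP (q \in r)) => //= /rp.
Qed.

Definition power_integrand n k (c : 'I_k -> R) (l : 'I_k -> 'rV[R]_n) (E : 'rV[C]_(1 + n) -> C) (s : C) (x : 'rV[R]_n) : C :=
  real_cpow (\prod_j linear_poly (c j) (l j) x) s * E (complex_point s x).

(** The multiplier depends neither on V nor on g, which makes the property additive in
    V. *)
Definition continuable n k (V : set 'rV[R]_n) (g : C -> 'rV[R]_n -> C) := forall M : nat,
  exists2 h : C -> C, forall s, half_plane M%:R s -> holat s h &
    forall s, 0 < complex.Re s -> h s = clearing n k M s * cintegral V (g s).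

Lemma bmf_power_integrand n k (v : 'I_n.+1 -> 'rV[R]_n) (c : 'I_k -> R) (l : 'I_k -> 'rV[R]_n) E s :
  measurable (rt @^-1` simplex v) ->
  (forall j i, 0 <= linear_poly (c j) (l j) (v i)) ->
  (forall x, simplex v x -> analytic_at E (complex_point s x)) -> 0 <= complex.Re s ->
  bmf (rt @^-1` simplex v) (fun u => power_integrand c l E s (rt u)).
Proof.
move=> mV cl0 EV s0; apply: bmfM; last by apply: bmf_analytic => //; exact: compact_simplex.
apply: (@bmf_cpow_comp _ _ _ _ (fun u => \prod_j linear_poly (c j) (l j) (rt u))
  (\prod_j \sum_i linear_poly (c j) (l j) (v i))) => //.
  apply: (@measurable_prod _ _ R setT _ _ (fun j u => linear_poly (c j) (l j) (rt u))) => j _; rewrite /linear_poly.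
  apply: measurable_funD => //; apply: measurable_sum => i.
  apply: measurable_funM => //.
  by apply: eq_measurable_fun (measurable_coord i) => u _; rewrite mxE.
move=> u [t [t0 t1 ->]].
have E1 j : linear_poly (c j) (l j) (\sum_i t i *: v i) = \sum_i t i * linear_poly (c j) (l j) (v i).
  exact: linear_poly_comb.
apply/andP; split.
  by apply: prodr_ge0 => j _; rewrite E1; apply: sumr_ge0 => i _; rewrite mulr_ge0.
apply: ler_prod => j _; rewrite E1; apply/andP; split.
  by apply: sumr_ge0 => i _; rewrite mulr_ge0.
apply: ler_sum => i _; apply: ler_piMl => //.
by rewrite -t1 (bigD1 i)//= lerDl; exact: sumr_ge0.
Qed.

(** In cube coordinates every form is a monomial times a positive polynomial, so the
    integrand has the shape required by regularized_integral. *)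
Lemma sorted_continuable n k (w : nat -> 'rV[R]_n) (c : 'I_k -> R) (l : 'I_k -> 'rV[R]_n) E :
  let v := fun i : 'I_n.+1 => w i in
  affinely_free v ->
  (forall j i, (i <= n)%N -> 0 <= linear_poly (c j) (l j) (w i)) ->
  (forall j i i', (i <= i' <= n)%N -> linear_poly (c j) (l j) (w i') = 0 -> linear_poly (c j) (l j) (w i) = 0) ->
  (forall j, exists2 i, (i <= n)%N & linear_poly (c j) (l j) (w i) != 0) ->
  (forall s x, simplex v x -> analytic_at E (complex_point s x)) ->
  continuable k (simplex v) (power_integrand c l E).
Proof.
move=> v wf al0 zf nz EV M.
have mono j := duffyR_monomial (al0 j) (zf j) (nz j).
have [e eP] := choice mono.
have [H HP] := choice eP.
have [d dP] := choice HP.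
pose m i := (\sum_j e j i)%N.
have mk i : (m i <= k)%N.
  rewrite /m -[X in (_ <= X)%N]card_ord -sum1_card; apply: leq_sum => j _; by case: (dP j).
pose h0 y := \prod_j H j y.
have rh0 : rpoly h0.
  rewrite /h0; elim: (index_enum _) => [|j r IH].
    by rewrite (_ : (fun y => _) = fun=> 1); [exact: rpoly_cst|apply/funext => y; rewrite big_nil].
  rewrite (_ : (fun y => _) = fun y => H j y * \prod_(i <- r) H i y).
    by apply: rpoly_mul => //; case: (dP j).
  by apply/funext => y; rewrite big_cons.
have d0 : 0 < \prod_j d j by apply: prodr_gt0 => j _; case: (dP j).
have h0d y : cube y -> \prod_j d j <= h0 y.
  move=> cy; apply: ler_prod => j _; case: (dP j) => _ _ dj0 dH _.
  by rewrite (ltW dj0) dH.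
pose G s y := hpow h0 0 s y * E (complex_point s (duffy n w y)).
have sG K : smooth (half_plane M%:R) K G.
  apply: smooth_mul; first exact: (smooth_hpow rh0 d0 h0d).
  have rX (j : 'I_n) : rpoly (duffyR n (fun i => w i 0 j)) by exact: rpoly_duffyR.
  have XE y : \row_(j < n) duffyR n (fun i => w i 0 j) y = duffy n w y.
    by apply/rowP => j; rewrite mxE coord_duffy.
  have XV y : cube y -> simplex v (\row_(j < n) duffyR n (fun i => w i 0 j) y).
    by rewrite XE; exact: duffy_simplex.
  apply: smooth_ext (smooth_analytic (@compact_simplex _ _ v) rX XV (half_plane M%:R) K EV) => s y _.
  by rewrite XE.
(* M k + 1 integrations by parts in each variable reach the half-plane, as m i <= k *)
have Mm i : M%:R * (m i)%:R < ((M * k).+1%:R : R).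
  by rewrite -natrM ltr_nat ltnS leq_mul2l mk orbT.
have [h [hh hE]] := regularized_integral n (ler0n R M) Mm sG.
have [cc cc0 ccE] := simplex_integral wf.
have Qe (i : 'I_n) := @pole_factor_dvd n k M (m i) i (mk i) (ltn_ord i).
have [Q QP] := choice (fun i => let: ex_intro2 Q a b := Qe i in ex_intro (fun Q => _ /\ _) Q (conj a b)).
exists (fun s => cc%:C * (\prod_i Q i s) * h s) => [s hs|s s0].
  apply: holat_mul; last exact: hh.
  apply: holat_mul; first exact: holat_cst.
  by apply: holat_prod => i _; case: (QP i) => + _; exact.
have bi : bmf (rt @^-1` simplex v) (power_integrand c l E s \o rt).
  apply: bmf_power_integrand; [exact: measurable_simplex| |by move=> x; exact: EV|exact: ltW].
  by move=> j i; apply: al0; rewrite -ltnS.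
rewrite hE// ccE//.
have -> : clearing n k M s = (\prod_i Q i s) * \prod_(i < n) pole_factor (m i) i (M * k).+1 s.
  rewrite /clearing -big_split /= -[X in _ ^+ X]card_ord -prodr_const; apply: eq_bigr => i _.
  by case: (QP i) => _ ->.
set O := outer_iterated _ _ _; set O' := outer_iterated _ _ _.
suff -> : O = O' by rewrite [RHS]mulrCA !mulrA.
apply: outer_iterated_ext => y cy.
rewrite /power_integrand /G mulrA; congr (_ * _).
have -> : \prod_j linear_poly (c j) (l j) (duffy n w y) = (\prod_(i < n) y i ^+ m i) * h0 y.
  under eq_bigr do rewrite linear_poly_duffy.
  rewrite (eq_bigr (fun j => (\prod_(i < n) y i ^+ e j i) * H j y)); last first.
    by move=> j _; case: (dP j) => _ _ _ _ ->.
  rewrite big_split /= exchange_big /=; congr (_ * _); apply: eq_bigr => i _.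
  by rewrite /m expr_sum.
have h0p : 0 < h0 y := lt_le_trans d0 (h0d _ cy).
have [<- p0] := @cpow_monomial _ n m y s cy.
by rewrite cpowM// [real_cpow (h0 y) s]cpow_pos// /hpow subr0.
Qed.

End ClearedPoles.

(** * Bisection *)

Section Bisection.
Context {R : realType} (n : nat).
Local Notation C := (cplx R).
Local Notation rt := (@row_of_tuple R n).
Local Notation lam := (@lebesgueT R n).
Implicit Types (v : 'I_n.+1 -> 'rV[R]_n).

Section Reordering.
Variables (p p' : 'I_n.+1 -> 'I_n.+1) (pK : cancel p p') (p'K : cancel p' p).

Lemma simplex_reorder v : simplex (fun i => v (p i)) = simplex v.
Proof.
have reidx := reindex_inj (can_inj pK).
apply/seteqP; split=> x [t [t0 t1 ->]].
  exists (fun i => t (p' i)); split=> //.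
    by rewrite -t1 reidx /=; apply: eq_bigr => i _; rewrite pK.
  by rewrite [RHS]reidx /=; apply: eq_bigr => i _; rewrite pK.
exists (fun i => t (p i)); split=> //; first by rewrite -t1 [RHS]reidx.
by rewrite [LHS]reidx.
Qed.

Lemma affinely_free_reorder v : affinely_free v -> affinely_free (fun i => v (p i)).
Proof.
have reidx := reindex_inj (can_inj pK).
move=> af t t0 tv i; have <- := pK i; apply: (af (fun i => t (p' i))).
  by apply: etrans t0; rewrite reidx /=; apply: eq_bigr => j _; rewrite pK.
by apply: etrans tv; rewrite reidx /=; apply: eq_bigr => j _; rewrite pK.
Qed.

End Reordering.

Lemma vertex_seq v : exists2 w : nat -> 'rV[R]_n, (fun i : 'I_n.+1 => w i) = v & forall i : 'I_n.+1, w i = v i.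
Proof.
exists (fun i => v (inord i)); last by move=> i; rewrite inord_val.
by apply/funext => i; rewrite inord_val.
Qed.

Lemma opposite_face_null v (b : 'I_n.+1) : (0 < n)%N -> affinely_free v ->
  exists N : set (n.-tuple (measurableTypeR R)), [/\ measurable N, lam N = 0%E &
  forall u, (exists t : 'I_n.+1 -> R, [/\ \sum_i t i = 1, t b = 0 & rt u = \sum_i t i *: v i]) -> N u].
Proof.
(* exchanges b with the first vertex *)
pose p (i : 'I_n.+1) := if i == ord0 then b else if i == b then ord0 else i.
have pK : involutive p.
  move=> i; rewrite /p; have [->|i0] := eqVneq i ord0; first by rewrite eqxx; case: eqVneq.
  by have [->|ib] := eqVneq i b; rewrite ?eqxx// (negbTE i0) (negbTE ib).
move=> n0 af; have reidx := reindex_inj (can_inj pK).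
have [w wE wE'] := vertex_seq (fun i => v (p i)).
have wf : affinely_free (fun i : 'I_n.+1 => w i) by rewrite wE; exact: affinely_free_reorder pK _ af.
have [N [mN N0 NP]] := face_null wf n0.
exists N; split=> // u [t [t1 tb tE]]; apply: NP; exists (fun i => t (p i)); split.
- by rewrite -t1 [RHS]reidx.
- by rewrite /p eqxx.
- by rewrite tE [LHS]reidx; apply: eq_bigr => i _; rewrite wE'.
Qed.

(** Doing this at either end of the edge ab gives the two halves of the simplex. *)
Definition bisect v (a b : 'I_n.+1) (i : 'I_n.+1) : 'rV[R]_n :=
  if i == a then 2^-1 *: (v a + v b) else v i.

(** The barycentric coordinates, with respect to the original vertices, of the point
    with weights t. *)
Definition bisect_weight (a b : 'I_n.+1) (t : 'I_n.+1 -> R) (i : 'I_n.+1) : R :=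
  (if i == a then t a / 2 else t i) + (if i == b then t a / 2 else 0).

Lemma bisect_weight_sum (V : lmodType R) a b t (v : 'I_n.+1 -> V) :
  \sum_i bisect_weight a b t i *: v i =
  \sum_i t i *: (if i == a then 2^-1 *: (v a + v b) else v i).
Proof.
rewrite /bisect_weight; under eq_bigr do rewrite scalerDl.
rewrite big_split /= [X in _ + X](bigD1 b)//= eqxx [X in _ + (_ + X)]big1 ?addr0; last first.
  by move=> i ib; rewrite (negbTE ib) scale0r.
rewrite (bigD1 a)//= [RHS](bigD1 a)//= !eqxx scalerA scalerDr addrAC; congr (_ + _).
by apply: eq_bigr => i ia; rewrite (negbTE ia).
Qed.

Lemma sum_bisect_weight a b t : \sum_i bisect_weight a b t i = \sum_i t i.
Proof.
have := @bisect_weight_sum R^o a b t (fun=> 1).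
under eq_bigr do rewrite -[_ *: _]/(_ * _) mulr1; move=> ->.
apply: eq_bigr => i _; rewrite -![_ *: _]/(_ * _); case: ifP => _; last by rewrite mulr1.
by field.
Qed.

Lemma bisect_free v a b : a != b -> affinely_free v -> affinely_free (bisect v a b).
Proof.
move=> ab af t t0 tv.
have s0 := af (bisect_weight a b t); rewrite sum_bisect_weight bisect_weight_sum in s0.
have {}s0 := s0 t0 tv.
have ta : t a = 0.
  by have := s0 a; rewrite /bisect_weight eqxx (negbTE ab) addr0 => /eqP; rewrite mulf_eq0 invr_eq0 pnatr_eq0 orbF => /eqP.
by move=> i; have := s0 i; rewrite /bisect_weight ta mul0r; case: eqP => [->//|_]; case: ifP; rewrite addr0.
Qed.

Lemma bisect_subset v a b : simplex (bisect v a b) `<=` simplex v.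
Proof.
move=> x [t [t0 t1 ->]]; exists (bisect_weight a b t); split.
- by move=> i; rewrite /bisect_weight; apply: addr_ge0; case: ifP => // _; rewrite divr_ge0.
- by rewrite sum_bisect_weight.
- by rewrite bisect_weight_sum.
Qed.

Lemma bisect_cover v a b t : a != b -> (forall i, 0 <= t i) -> \sum_i t i = 1 -> t a <= t b ->
  simplex (bisect v a b) (\sum_i t i *: v i).
Proof.
(* chosen so that the weights s of the half reproduce t *)
move=> ab t0 t1 tab; pose s i := t i + (if i == a then t a else 0) - (if i == b then t a else 0).
have E i : bisect_weight a b s i = t i.
  rewrite /bisect_weight /s eqxx (negbTE ab) subr0.
  have [->|ia] := eqVneq i a; first by rewrite (negbTE ab) addr0; field.
  by rewrite addr0; case: ifP => _; [field|rewrite subr0 addr0].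
exists s; split.
- move=> i; rewrite /s; have [->|ia] := eqVneq i a; first by rewrite (negbTE ab) subr0 addr_ge0.
  by rewrite addr0; case: eqP => [->|_]; rewrite ?subr0// subr_ge0.
- by rewrite -(sum_bisect_weight a b) -t1; apply: eq_bigr => i _; rewrite E.
- by rewrite -bisect_weight_sum; apply: eq_bigr => i _; rewrite E.
Qed.

Lemma bisect_union v a b : a != b ->
  simplex v = simplex (bisect v a b) `|` simplex (bisect v b a).
Proof.
move=> ab; apply/seteqP; split=> [x [t [t0 t1 ->]]|x []]; try exact: bisect_subset.
have [tab|/ltW tba] := leP (t a) (t b); [left|right]; apply: bisect_cover => //.
by rewrite eq_sym.
Qed.

(** A point common to both halves has equal weights at a and b, hence no weight at b in
    the half that keeps b. *)
Lemma bisect_overlap v a b x : a != b -> affinely_free v ->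
  simplex (bisect v a b) x -> simplex (bisect v b a) x ->
  exists t : 'I_n.+1 -> R, [/\ \sum_i t i = 1, t b = 0 & x = \sum_i t i *: bisect v a b i].
Proof.
move=> ab af [t [t0 t1 xt]] [t' [t'0 t'1 xt']]; exists t; split=> //.
have E i : bisect_weight a b t i = bisect_weight b a t' i.
  apply/eqP; rewrite -subr_eq0; apply/eqP; apply: (af (fun i => bisect_weight a b t i - bisect_weight b a t' i)).
    by rewrite sumrB !sum_bisect_weight t1 t'1 subrr.
  under eq_bigr do rewrite scalerBl; rewrite sumrB !bisect_weight_sum.
  by apply/eqP; rewrite subr_eq0; apply/eqP; rewrite -[LHS]xt -[RHS]xt'.
have ba : b != a by rewrite eq_sym.
have := E a; have := E b; rewrite /bisect_weight !eqxx (negbTE ab) (negbTE ba) !addr0 => E1 E2.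
apply/eqP; rewrite eq_le t0 andbT; have := t'0 a; have := t0 b; lra.
Qed.

Lemma sorting_perm m (key : 'I_m -> nat) : exists p p' : 'I_m -> 'I_m, [/\ cancel p p', cancel p' p &
  forall i i' : 'I_m, (i <= i')%N -> (key (p i') <= key (p i))%N].
Proof.
pose r := (fun a b : 'I_m => key b <= key a)%N; pose s := sort r (enum 'I_m).
have ss : size s = m by rewrite size_sort size_enum_ord.
have us : uniq s by rewrite sort_uniq enum_uniq.
have inj : injective (fun i : 'I_m => nth i s i).
  move=> i j /eqP; rewrite (set_nth_default i j) ?ss ?ltn_ord//.
  by rewrite nth_uniq ?ss ?ltn_ord// => /eqP /val_inj.
exists (fun i => nth i s i), (invF inj); split; [exact: invF_f|exact: f_invF|].
move=> i i' ii'; rewrite (set_nth_default i i') ?ss ?ltn_ord//.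
have st : sorted r s by apply: sort_sorted => a b; exact: leq_total.
have tr : transitive r by move=> a b c; rewrite /r => h1 h2; exact: leq_trans h2 h1.
have rr : reflexive r by move=> a; exact: leqnn.
by apply: (sorted_leq_nth tr rr _ st) => //; rewrite inE ss ltn_ord.
Qed.

End Bisection.

Section Induction.
Context {R : realType} (n k : nat) (c : 'I_k -> R) (l : 'I_k -> 'rV[R]_n).
Local Notation C := (cplx R).
Variable E : 'rV[C]_(1 + n) -> C.
Local Notation rt := (@row_of_tuple R n).
Local Notation lp j x := (linear_poly (c j) (l j) x).
Implicit Types (v : 'I_n.+1 -> 'rV[R]_n).

Definition zeros v := [set p : 'I_k * 'I_n.+1 | lp p.1 (v p.2) == 0]%SET.

Lemma linear_poly_mid j (x y : 'rV[R]_n) : lp j (2^-1 *: (x + y)) = 2^-1 * (lp j x + lp j y).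
Proof.
rewrite /linear_poly addrACA mulrDr -mulr2n -[c j *+ 2]mulr_natl mulKf ?pnatr_eq0//; congr (_ + _).
by rewrite -big_split mulr_sumr; apply: eq_bigr => i _; rewrite !mxE /=; ring.
Qed.

Lemma continuable_setU (V V1 V2 : set 'rV[R]_n) N g : V = V1 `|` V2 ->
  measurable (rt @^-1` V1) -> measurable (rt @^-1` V2) -> measurable N -> lebesgueT n N = 0%E ->
  rt @^-1` (V1 `&` V2) `<=` N -> (lebesgueT n (rt @^-1` V) < +oo)%E ->
  (forall s, 0 < complex.Re s -> bmf (rt @^-1` V) (fun u => g s (rt u))) ->
  continuable k V1 g -> continuable k V2 g -> continuable k V g.
Proof.
move=> -> m1 m2 mN N0 VN Vf bg c1 c2 M.
have [h1 hol1 e1] := c1 M; have [h2 hol2 e2] := c2 M.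
exists (fun s => h1 s + h2 s) => [s hs|s s0].
  by apply: holat_add; [exact: hol1|exact: hol2].
rewrite e1// e2// -mulrDr; congr (_ * _); apply/esym.
exact: (cint_setU m1 m2 mN N0 VN Vf (bg s s0)).
Qed.

(** Induction on the number of pairs of a form and a vertex where it vanishes. At a
    midpoint a nonnegative form vanishes only if it does at both ends, so either half of
    a bisected edge loses a zero. If no edge can be used, the zero sets are nested, and
    sorting the vertices by decreasing number of zeros gives the situation of
    sorted_continuable. *)
Lemma simplex_continuable v : affinely_free v ->
  (forall j i, 0 <= lp j (v i)) -> (forall j, exists i, lp j (v i) != 0) ->
  (forall s x, simplex v x -> analytic_at E (complex_point s x)) ->
  continuable k (simplex v) (power_integrand c l E).
Proof.
have [m] := ubnP #|zeros v|; elim: m v => // m IH v; rewrite ltnS => zm af ge0 nz EV.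
have [/existsP[a /existsP[b /existsP[j /existsP[j' /and4P[ja jb j'b j'a]]]]]|chain] :=
  boolP [exists a, exists b, exists j, exists j',
    [&& lp j (v a) == 0, lp j (v b) != 0, lp j' (v b) == 0 & lp j' (v a) != 0]].
  have ab : a != b by apply: contraNneq jb => <-.
  have n0 : (0 < n)%N.
    rewrite lt0n; apply/eqP => n0; move/eqP: ab; apply; apply: val_inj.
    have z (i : 'I_n.+1) : val i = 0%N.
      by apply/eqP; rewrite -leqn0; apply: leq_trans (leq_ord i) _; rewrite n0.
    by rewrite !z.
  have sub (a0 b0 : 'I_n.+1) (i : 'I_k) : a0 != b0 -> lp i (v a0) == 0 -> lp i (v b0) != 0 ->
      continuable k (simplex (bisect v a0 b0)) (power_integrand c l E).
    move=> ab0 ia ib.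
    have mid i0 : lp i0 (bisect v a0 b0 a0) = 2^-1 * (lp i0 (v a0) + lp i0 (v b0)).
      by rewrite /bisect eqxx linear_poly_mid.
    have oth q : q != a0 -> bisect v a0 b0 q = v q by rewrite /bisect => /negbTE ->.
    apply: IH.
    - apply: leq_trans zm; apply: proper_card; apply/properP; split.
        apply/fintype.subsetP => -[i0 q]; rewrite !inE /=; have [->|qa] := eqVneq q a0; last by rewrite oth.
        by rewrite mid mulf_eq0 invr_eq0 pnatr_eq0 /= paddr_eq0// => /andP[].
      exists (i, a0); rewrite !inE //= mid mulf_eq0 invr_eq0 pnatr_eq0 /= paddr_eq0//.
      by rewrite (negbTE ib) andbF.
    - exact: bisect_free.
    - move=> i0 q; have [->|qa] := eqVneq q a0; last by rewrite oth.
      by rewrite mid mulr_ge0// addr_ge0.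
    - move=> i0; have [q qn] := nz i0; exists q.
      have [qa|qa] := eqVneq q a0; last by rewrite oth.
      rewrite qa mid mulf_eq0 invr_eq0 pnatr_eq0 /= paddr_eq0//.
      by rewrite -qa (negbTE qn).
    - by move=> s x /bisect_subset; exact: EV.
  have ba : b != a by rewrite eq_sym.
  have [N [mN N0 NP]] := opposite_face_null b n0 (bisect_free ab af).
  have msimplex v' : affinely_free v' -> measurable (rt @^-1` simplex v').
    by have [w <- _] := vertex_seq v'; exact: measurable_simplex.
  apply: (continuable_setU (bisect_union v ab) (msimplex _ (bisect_free ab af)) (msimplex _ (bisect_free ba af)) mN N0).
  - by move=> u [u1 u2]; apply: NP; exact: bisect_overlap u2.
  - have [w wE _] := vertex_seq v; rewrite -wE; apply: lebesgueT_simplex_fin; by rewrite wE.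
  - by move=> s s0; apply: bmf_power_integrand; [exact: msimplex|exact: ge0|move=> x; exact: EV|exact: ltW].
  - exact: (sub _ _ _ ab ja jb).
  - exact: (sub _ _ _ ba j'b j'a).
pose Z i := [set j | lp j (v i) == 0]%SET.
have [p [p' [pK p'K pP]]] := sorting_perm (fun i => #|Z i|).
have [w wE wE'] := vertex_seq (fun i => v (p i)).
have wP i : (i <= n)%N -> exists o : 'I_n.+1, i = o /\ w i = v (p o).
  by move=> i_n; exists (inord i); rewrite inordK// -wE' inordK.
rewrite -(simplex_reorder pK v) -wE; apply: sorted_continuable.
- by rewrite wE; exact: affinely_free_reorder pK _ af.
- by move=> j i /wP [ o [_ ->]].
- move=> j i i' /andP[ii' i'n].
  have [ o [io ->]] := wP _ (leq_trans ii' i'n); have [ o' [io' ->]] := wP _ i'n.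
  move=> jo'; apply/eqP; apply/negPn/negP => jo.
  have ZZ : Z (p o) \proper Z (p o').
    apply/properP; split; last by exists j; rewrite !inE ?jo'// (negbTE jo).
    apply/fintype.subsetP => j'; rewrite !inE => j'o; apply/negPn/negP => j'o'.
    move/existsPn: chain => /(_ (p o')) /existsPn /(_ (p o)) /existsPn /(_ j) /existsPn /(_ j').
    by rewrite jo' eqxx jo j'o j'o'.
  have := proper_card ZZ; rewrite ltnNge => /negP; apply; apply: pP.
  by rewrite -io -io'.
- move=> j; have [i ji] := nz j; exists (p' i); first by rewrite -ltnS.
  by rewrite wE' p'K.
- by move=> s x; rewrite wE (simplex_reorder pK); exact: EV.
Qed.

End Induction.

(** * Gluing the continuations *)

Section Gluing.
Context {R : realType}.
Local Notation C := (cplx R).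
Implicit Types (g h : C -> C) (p s z : C).

Lemma holat_eq g h p (r : R) : 0 < r -> (forall z, nm (z - p) < r -> g z = h z) -> holat p g -> holat p h.
Proof.
move=> r0 gh [e he]; have e0 := hol_gt0 he; exists (Num.min e r).
have m0 : 0 < Num.min e r by rewrite lt_min e0.
apply: (@hol_eq _ _ _ g) => [z zr|]; first by apply: gh; apply: lt_le_trans zr _; rewrite ge_min lexx orbT.
by apply: hol_le he => //; rewrite ge_min lexx.
Qed.

Lemma holat_neq0 p g : holat p g -> g p != 0 -> exists2 r : R, 0 < r & forall z, nm (z - p) < r -> g z != 0.
Proof.
move=> [e he] gp; have e0 := hol_gt0 he; have G0 := nm_gt0 gp.
pose K := 2 * e^-1 ^+ 2; have K0 : 0 < K by rewrite mulr_gt0 ?exprn_gt0 ?invr_gt0.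
exists (Num.min (e / 2) (nm (g p) / K)) => [|z]; first by rewrite lt_min !divr_gt0.
rewrite lt_min => /andP[z1 z2]; apply/eqP => gz.
have := hol_lip he (ltW z1); rewrite gz sub0r nmN -/K => H.
by move: z2; rewrite ltr_pdivlMr// ltNge mulrC H.
Qed.

Lemma complex_near p (r : R) : 0 < r -> exists z, [/\ z != p, nm (z - p) < r & complex.Im z = complex.Im p].
Proof.
move=> r0; exists (p + (r / 2)%:C).
have E : p + (r / 2)%:C - p = (r / 2)%:C by rewrite addrC addKr.
split.
- by rewrite -subr_eq0 E; apply: contraTneq r0 => /(congr1 (fun z => complex.Re z)) /= h; rewrite -leNgt; lra.
- by rewrite E nm_real gtr0_norm ?divr_gt0// ltr_pdivrMr// ltr_pMr// ltr1n.
- by rewrite ImD /= addr0.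
Qed.

Lemma holat_punctured0 p g (r : R) : 0 < r -> holat p g ->
  (forall z, nm (z - p) < r -> z != p -> g z = 0) -> exists2 r' : R, 0 < r' & forall z, nm (z - p) < r' -> g z = 0.
Proof.
move=> r0 [e he] gz; have e0 := hol_gt0 he; case: (hol_factor he) => [H|[k [f [e' [hf fp fE]]]]].
  by exists e.
have [r1 r10 fn] := holat_neq0 (ex_intro _ e' hf) fp.
have [|z [zp]] := @complex_near p (Num.min r (Num.min e r1)); first by rewrite !lt_min r0 e0.
rewrite !lt_min => /and3P[z1 z2 z3] _; have := gz z z1 zp; rewrite fE// => /eqP.
by rewrite mulf_eq0 (negbTE (fn _ z3)) orbF expf_eq0 subr_eq0 (negbTE zp) andbF.
Qed.

Lemma holat_punctured_eq p g h (r : R) : 0 < r -> holat p g -> holat p h ->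
  (forall z, nm (z - p) < r -> z != p -> g z = h z) -> g p = h p.
Proof.
move=> r0 hg hh gh.
have hd : holat p (fun z => g z + (-1) * h z).
  exact: holat_add hg (holat_mul (holat_cst p (-1)) hh).
have [|r' r'0 H] := holat_punctured0 r0 hd; first by move=> z zr zp; rewrite gh// mulN1r subrr.
by apply/eqP; rewrite -subr_eq0 -mulN1r; apply/eqP/H; rewrite subrr nm0.
Qed.

(** Go left from the zero region along the horizontal line through s; at the infimum of
    the abscissae reached, a nonzero germ could not vanish at the nearby points to the
    right. *)
Lemma identity_half_plane (M : R) g : 0 <= M -> (forall s, half_plane M s -> holat s g) ->
  (forall s, 0 < complex.Re s -> g s = 0) -> forall s, half_plane M s -> g s = 0.
Proof.
move=> M0 hg g0 s0 hs0; pose pt (x : R) : C := x +i* complex.Im s0.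
have ptd x x' : pt x - pt x' = (x - x')%:C by apply: cplxP; rewrite ?ReD ?ImD /= ?subrr.
set a := complex.Re s0.
have hp x : a <= x -> half_plane M (pt x) by rewrite /half_plane /=; exact: lt_le_trans hs0.
have s0E : s0 = pt a by apply: cplxP.
(* the abscissae to the right of which g vanishes near every point of the line *)
pose T : set R := [set x | a <= x /\ forall x', x <= x' -> exists2 r : R, 0 < r & forall z, nm (z - pt x') < r -> g z = 0].
have TM : T (Num.max a 1).
  split=> [|x' x'x]; first by rewrite le_max lexx.
  have x'0 : 0 < x' by apply: lt_le_trans x'x; rewrite lt_max ltr01 orbT.
  exists x' => // z zx; apply: g0; have := Re_le_nm (z - pt x'); rewrite ReD /=.
  by move=> /le_lt_trans /(_ zx); rewrite ltr_norml => /andP[]; lra.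
have hT : has_inf T by split; [exists (Num.max a 1)|exists a => x []].
pose x0 := inf T; have ax0 : a <= x0 by apply: lb_le_inf; [case: hT|move=> x []].
have [e he] := hg _ (hp _ ax0); have e0 := hol_gt0 he.
have adh (d : R) : 0 < d -> exists2 x1, T x1 & x0 <= x1 < x0 + d.
  move=> d0; have [x1 Tx1 x1d] := inf_adherent d0 hT; exists x1 => //.
  by rewrite x1d andbT; apply: ge_inf => //; case: hT.
have ball0 : forall z, nm (z - pt x0) < e -> g z = 0.
  case: (hol_factor he) => // -[k [f [e' [hf fp fE]]]].
  have [r1 r10 fn] := holat_neq0 (ex_intro _ e' hf) fp.
  pose m := Num.min e r1; have m0 : 0 < m by rewrite lt_min e0.
  have [x1 [_ /(_ x1 (lexx _)) [r r0 gz]] /andP[x01 x1m]] := adh (m / 2) (divr_gt0 m0 (ltr0n _ 2)).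
  pose d := Num.min (r / 2) (m / 4); have d0 : 0 < d by rewrite lt_min !divr_gt0.
  have dr : d <= r / 2 by rewrite ge_min lexx.
  have dm : d <= m / 4 by rewrite ge_min lexx orbT.
  have z1 : nm (pt (x1 + d) - pt x1) < r.
    by rewrite ptd addrC addKr nm_real gtr0_norm//; lra.
  have z2 : nm (pt (x1 + d) - pt x0) < m.
    by rewrite ptd nm_real gtr0_norm; lra.
  have := gz _ z1; move: z2; rewrite lt_min => /andP[z2 z3]; rewrite fE// => /eqP.
  rewrite mulf_eq0 (negbTE (fn _ z3)) orbF expf_eq0 ptd => /andP[_ /eqP/(congr1 (fun z => complex.Re z))] /=.
  by lra.
have Tm : T (Num.max a (x0 - e / 2)).
  split=> [|x']; first by rewrite le_max lexx.
  rewrite ge_max => /andP[ax' x'0].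
  have [x'x|xx'] := ltP x' (x0 + e / 2).
    have d0 : `|x' - x0| <= e / 2 by rewrite ler_norml; apply/andP; split; lra.
    exists (e / 2); first by rewrite divr_gt0.
    move=> z zx; apply: ball0; rewrite (_ : z - pt x0 = (z - pt x') + (pt x' - pt x0)); last by rewrite addrA subrK.
    apply: le_lt_trans (nmD _ _) _; rewrite ptd nm_real; lra.
  have [x1 [_ TT] /andP[_ x1e]] := adh (e / 2) (divr_gt0 e0 (ltr0n _ 2)).
  by apply: TT; exact: ltW (lt_le_trans x1e xx').
have := ge_inf (proj2 hT) Tm; rewrite -/x0 le_max => /orP[x0a|H]; last by exfalso; lra.
have -> : s0 = pt x0 by rewrite s0E; congr pt; apply/le_anti; rewrite ax0.
by apply: ball0; rewrite subrr nm0.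
Qed.

Lemma ratr_inj : injective (@ratr C).
Proof. exact: fmorph_inj. Qed.

Lemma holat_inv_prod_expr p (B : seq rat) n : (\prod_(q <- B) (p - ratr q)) ^+ n != 0 ->
  holat p (fun s => ((\prod_(q <- B) (s - ratr q)) ^+ n)^-1).
Proof.
case: n => [|n] H.
  by apply: holat_eq ltr01 _ (holat_cst p 1) => z _; rewrite expr0 invr1.
have {}H : \prod_(q <- B) (p - ratr q) != 0 by apply: contraNneq H => ->; rewrite expr0n.
apply: (@holat_eq (fun s => (\prod_(q <- B) (s - ratr q)^-1) ^+ n.+1) _ p 1) => //.
  by move=> z _; rewrite prodfV exprVn.
apply: holat_expr; rewrite big_seq_cond in H.
have F : forall q, q \in B -> p != ratr q.
  move=> q qB; apply: contraNneq H => pq; rewrite -big_seq_cond (big_rem q)//= pq subrr mul0r//.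
elim: B F {H} => [|q B IH] F.
  by apply: holat_eq ltr01 _ (holat_cst p 1) => z _; rewrite big_nil.
apply: (@holat_eq (fun s => (s - ratr q)^-1 * \prod_(q <- B) (s - ratr q)^-1) _ p 1) => //.
  by move=> z _; rewrite big_cons.
apply: holat_mul; first by apply: hol_inv; apply: F; rewrite mem_head.
by apply: IH => q' q'B; apply: F; rewrite inE q'B orbT.
Qed.

(** As the list has no repetition, at most one of its factors vanishes at p. *)
Lemma reciprocal_local p (B : seq rat) n : uniq B -> exists m0 (Gi : C -> C) (r : R),
  [/\ (m0 <= n)%N, (0 < m0)%N -> exists q : rat, p = ratr q, holat p Gi, Gi p != 0 & 0 < r /\
  forall z, nm (z - p) < r -> z != p -> (\prod_(q <- B) (z - ratr q)) ^+ n != 0 /\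
    ((\prod_(q <- B) (z - ratr q)) ^+ n)^-1 = Gi z / (z - p) ^+ m0].
Proof.
move=> uB; pose D (B : seq rat) z := (\prod_(q <- B) (z - ratr q)) ^+ n.
have gen (B' : seq rat) : (forall q, q \in B' -> p != ratr q) ->
    [/\ holat p (fun s => (D B' s)^-1), (D B' p)^-1 != 0 & exists2 r : R, 0 < r & forall z, nm (z - p) < r -> D B' z != 0].
  move=> pB; have Dp : D B' p != 0.
    rewrite /D expf_neq0// prodf_seq_neq0; apply/allP => q /pB; by rewrite subr_eq0.
  have hD : holat p (fun s => (D B' s)^-1) by exact: holat_inv_prod_expr.
  have Dp' : (D B' p)^-1 != 0 by rewrite invr_eq0.
  split=> //; have [r r0 rP] := holat_neq0 hD Dp'.
  by exists r => // z /rP; rewrite invr_eq0.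
have [/hasP[q0 q0B /eqP q0p]|/hasPn nB] := boolP (has (fun q => p == ratr q) B); last first.
  have [//|hD Dp [r r0 rP]] := gen B.
  exists 0%N, (fun s => (D B s)^-1), r; split=> //; split=> // z zr _.
  by rewrite expr0 divr1; split=> //; exact: rP.
have [|hD Dp [r r0 rP]] := gen (rem q0 B).
  by move=> q; rewrite mem_rem_uniq// inE => /andP[qq _]; rewrite q0p (inj_eq ratr_inj) eq_sym.
exists n, (fun s => (D (rem q0 B) s)^-1), r; split=> //; first by exists q0.
split=> // z zr zp; have E : (\prod_(q <- B) (z - ratr q)) ^+ n = (z - p) ^+ n * D (rem q0 B) z.
  by rewrite (big_rem q0)//= exprMn q0p.
by rewrite E mulf_neq0 ?rP ?expf_neq0 ?subr_eq0//; split=> //; rewrite invfM mulrC.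
Qed.

Section Continuation.
Variables (n : nat) (I : C -> C) (B : nat -> seq rat) (h : nat -> C -> C).
Hypotheses (uB : forall M, uniq (B M)) (B0 : forall M q, q \in B M -> q < 0).
Let D M z : C := (\prod_(q <- B M) (z - ratr q)) ^+ n.
Hypotheses (holh : forall (M : nat) s, half_plane M%:R s -> holat s (h M))
  (hI : forall (M : nat) s, 0 < complex.Re s -> h M s = D M s * I s).

Lemma exists_half_plane p : exists M : nat, half_plane M%:R p.
Proof.
exists (Num.truncn (- complex.Re p)).+1; rewrite /half_plane /=.
rewrite ltrNl; exact: truncnS_gt.
Qed.

Let quo M z := h M z / D M z.

Lemma holat_D M s : holat s (D M).
Proof. by apply: holat_expr; apply: holat_prod => q _; exact: holat_subr. Qed.

Lemma cross_multiplied M M' s : half_plane M%:R s -> half_plane M'%:R s ->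
  h M s * D M' s = h M' s * D M s.
Proof.
wlog MM : M M' / (M <= M')%N => [W|] hs hs'.
  by have [/W|/ltnW /W H] := leqP M M'; [exact|apply/esym/H].
apply/eqP; rewrite -subr_eq0; apply/eqP.
apply: (@identity_half_plane M%:R (fun s => h M s * D M' s - h M' s * D M s)) => //.
  move=> z hz; have hz' : half_plane M'%:R z.
    by move: hz; rewrite /half_plane /=; apply: le_lt_trans; rewrite lerN2 ler_nat.
  apply: (@holat_eq (fun s => h M s * D M' s + (-1) * (h M' s * D M s)) _ z 1) => //.
    by move=> w _; rewrite mulN1r.
  apply: holat_add; first by apply: holat_mul; [exact: holh|exact: holat_D].
  apply: holat_mul; first exact: holat_cst.
  by apply: holat_mul; [exact: holh|exact: holat_D].
by move=> z z0; rewrite !hI//; ring.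
Qed.

Definition germ p (phi : C -> C) := holat p phi /\ exists M : nat, half_plane M%:R p /\
  exists2 r : R, 0 < r & forall z, nm (z - p) < r -> z != p -> phi z = quo M z.

(** The value at p of the holomorphic germ that agrees with the quotients near p, and 0
    at a pole. *)
Definition continuation p : C := xget 0 [set w | exists2 phi, germ p phi & w = phi p].

Lemma germ_unique p phi psi : germ p phi -> germ p psi -> phi p = psi p.
Proof.
move=> [h1 [M [hM [r r0 rE]]]] [h2 [M' [hM' [r' r'0 r'E]]]].
have [mu [G [d [_ _ _ _ [d0 dP]]]]] := reciprocal_local p n (uB M).
have [mu' [G' [d' [_ _ _ _ [d'0 d'P]]]]] := reciprocal_local p n (uB M').
have [e e0 eP] := half_plane_open hM; have [e' e'0 e'P] := half_plane_open hM'.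
apply: (@holat_punctured_eq p phi psi (Num.min (Num.min r r') (Num.min (Num.min d d') (Num.min e e')))) => //.
  by rewrite !lt_min r0 r'0 d0 d'0 e0 e'0.
move=> z; rewrite !lt_min => /and3P[/andP[z1 z2] /andP[z3 z4] /andP[z5 z6]] zp.
rewrite rE// r'E// /quo; have [D1 _] := dP z z3 zp; have [D2 _] := d'P z z4 zp.
by apply/eqP; rewrite eqr_div//; apply/eqP; apply: cross_multiplied; [exact: eP|exact: e'P].
Qed.

Lemma continuationE p phi : germ p phi -> continuation p = phi p.
Proof.
move=> gp; rewrite /continuation; case: xgetP => [w _ [psi gpsi ->]|/(_ (phi p)) []].
  exact: germ_unique gpsi gp.
by exists phi.
Qed.

Lemma continuation_quo M p : half_plane M%:R p -> D M p != 0 -> continuation p = quo M p.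
Proof.
move=> hp Dp; apply: continuationE; split.
  by apply: holat_mul; [exact: holh|exact: holat_inv_prod_expr].
by exists M; split=> //; exists 1.
Qed.

Lemma continuation_right s : 0 < complex.Re s -> continuation s = I s.
Proof.
move=> s0; have hs : half_plane 0%:R s by rewrite /half_plane /= oppr0.
have D0 : D 0 s != 0.
  rewrite /D expf_neq0// prodf_seq_neq0; apply/allP => q /B0 q0; rewrite /= subr_eq0.
  apply: contraTneq s0 => ->; rewrite -(fmorph_rat (real_complex R)) /= -leNgt.
  by rewrite lerq0 ltW.
by rewrite (continuation_quo hs D0) /quo hI// mulrAC mulfV// mul1r.
Qed.

Lemma continuation_local p : exists m0 (H : C -> C) (r : R),
  [/\ (m0 <= n)%N, (0 < m0)%N -> exists q : rat, p = ratr q, holat p H, 0 < r &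
  forall z, nm (z - p) < r -> z != p -> continuation z = H z / (z - p) ^+ m0] /\
  (forall phi (r' : R), 0 < r' -> holat p phi ->
    (forall z, nm (z - p) < r' -> z != p -> phi z = H z / (z - p) ^+ m0) -> continuation p = phi p).
Proof.
have [M hM] := exists_half_plane p.
have [m0 [Gi [r [m0n m0q hG G0 [r0 rP]]]]] := reciprocal_local p n (uB M).
have [e e0 eP] := half_plane_open hM.
have E z : nm (z - p) < r -> z != p -> quo M z = h M z * Gi z / (z - p) ^+ m0.
  by move=> zr zp; have [_ Dz] := rP z zr zp; rewrite /quo Dz mulrA.
exists m0, (fun z => h M z * Gi z), (Num.min r e); split.
  split; [exact: m0n|exact: m0q|exact: holat_mul (holh hM) hG| |].
    by rewrite lt_min r0.
  move=> z; rewrite lt_min => /andP[zr ze] zp; rewrite -E//.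
  by apply: continuation_quo; [exact: eP|case: (rP z zr zp)].
move=> phi r' r'0 hphi phiE; apply: continuationE; split=> //; exists M; split=> //.
exists (Num.min r r'); first by rewrite lt_min r0.
by move=> z; rewrite lt_min => /andP[z1 z2] zp; rewrite E// phiE.
Qed.

(** Compare the order of vanishing of H with the exponent m0. *)
Lemma continuation_meromorphic : meromorphic continuation.
Proof.
move=> p; have [m0 [H [r [[m0n m0q hH r0 HE] cE]]]] := continuation_local p.
have analytic phi r' : 0 < r' -> holat p phi ->
    (forall z, nm (z - p) < r' -> z != p -> phi z = H z / (z - p) ^+ m0) -> analytic1_at continuation p.
  move=> r'0 hphi phiE; have cp := cE phi r' r'0 hphi phiE.
  have [e he] : holat p continuation.
    apply: (@holat_eq phi _ p (Num.min r r')) => //; first by rewrite lt_min r0.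
    move=> z; rewrite lt_min => /andP[z1 z2]; have [->//|zp] := eqVneq z p.
    by rewrite phiE// HE.
  exact: hol_analytic1 he.
have [e he] := hH; have e0 := hol_gt0 he.
case: (hol_factor he) => [H0|[k [g [e' [hg gp gE]]]]].
  left; apply: (analytic (fun=> 0) e e0 (holat_cst p 0)) => z ze zp.
  by rewrite H0// mul0r.
have [m0k|km0] := leqP m0 k.
  left; apply: (analytic (fun z => (z - p) ^+ (k - m0) * g z) e e0).
    apply: holat_mul; last by exists e'.
    by apply: holat_expr; exact: holat_subr.
  move=> z ze zp; rewrite gE// -{2}(subnK m0k) exprD.
  by rewrite [X in _ = X / _]mulrAC mulfK// expf_neq0// subr_eq0.
right; exists (m0 - k)%N; split; first by rewrite subn_gt0.
exists g; split=> //; first exact: hol_analytic1 hg.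
apply/nbhsCP; exists (Num.min r e); first by rewrite lt_min r0.
move=> z; rewrite lt_min => /andP[z1 z2] zp; rewrite HE// gE//.
rewrite -{1}(subnK (ltnW km0)) exprD [_ ^+ k * _]mulrC -mulf_div.
by rewrite mulfV ?mulr1// expf_neq0// subr_eq0.
Qed.

(** If the order exceeded m0, the leading coefficient would be the value at p of a
    multiple of z - p. *)
Lemma pole_order_le p m : pole_of_order m continuation p -> exists m0,
  [/\ (m <= m0)%N, (m0 <= n)%N & (0 < m0)%N -> exists q : rat, p = ratr q].
Proof.
have [m0 [H [r [[m0n m0q hH r0 HE] _]]]] := continuation_local p.
move=> [m_gt0 [g [ag gp /nbhsCP[r' r'0 gE]]]]; exists m0; split=> //.
rewrite leqNgt; apply/negP => m0m; move/eqP: gp; apply.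
have hg := analytic1_hol ag.
pose f z := (z - p) ^+ (m - m0) * H z.
suff -> : g p = f p by rewrite /f subrr expr0n subn_eq0 leqNgt m0m mul0r.
apply: (@holat_punctured_eq p g f (Num.min r r')); [by rewrite lt_min r0|exact: hg| |].
  by apply: holat_mul hH; apply: holat_expr; exact: holat_subr.
move=> z; rewrite lt_min => /andP[z1 z2] zp.
have zp0 : z - p != 0 by rewrite subr_eq0.
have := gE z z2 zp; rewrite HE// => /eqP; rewrite eqr_div ?expf_neq0// => /eqP E.
apply: (mulIf (expf_neq0 m0 zp0)); rewrite -E /f mulrAC -exprD subnK 1?mulrC//; exact: ltnW.
Qed.

End Continuation.

End Gluing.

(** * Signs of the forms, and the theorem *)

Section Signs.
Context {R : realType} (n k : nat) (v : 'I_n.+1 -> 'rV[R]_n) (c : 'I_k -> R) (l : 'I_k -> 'rV[R]_n).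
Local Notation C := (cplx R).
Local Notation lp j x := (linear_poly (c j) (l j) x).

(** In barycentric coordinates a small displacement changes the weights little. *)
Lemma barycentric_interior (t : 'I_n.+1 -> R) : affinely_independent v ->
  (forall i, 0 < t i) -> \sum_i t i = 1 -> (simplex v)° (\sum_i t i *: v i).
Proof.
move=> ai t0 t1; set x := \sum_i _; pose A : 'M[R]_n := \matrix_(i < n) (v (lift ord0 i) - v ord0).
have uA : A \in unitmx by rewrite -row_free_unit; exact: ai.
have t1' i : t i <= 1 by rewrite -t1 (bigD1 i)//= lerDl; apply: sumr_ge0 => j _; exact: ltW.
(* a common lower bound of the weights, as all of them are at most 1 *)
pose tau := \prod_i t i; have tau0 : 0 < tau by apply: prodr_gt0.
have taut i : tau <= t i.
  rewrite /tau (bigD1 i)//= ler_piMr ?(ltW (t0 i))//; apply: prodr_ile1 => j _.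
  by rewrite (ltW (t0 j)) t1'.
pose K := \sum_j \sum_i `|invmx A i j|; have K0 : 0 <= K by apply: sumr_ge0 => j _; apply: sumr_ge0.
have r0 : 0 < tau / (K + 1) by rewrite divr_gt0// ltr_wpDl.
rewrite /interior; near=> y.
have yx : forall i, `|y 0 i - x 0 i| <= tau / (K + 1) by near: y; exact: nbhs_rVR.
pose d : 'rV[R]_n := (y - x) *m invmx A.
have dj : \sum_j `|d 0 j| <= tau.
  apply: le_trans (_ : tau / (K + 1) * K <= _); last first.
    by rewrite mulrAC ler_pdivrMr ?ltr_wpDl// mulrDr mulr1 lerDl ltW.
  rewrite /K mulr_sumr; apply: ler_sum => j _; rewrite mxE; apply: le_trans (ler_norm_sum _ _ _) _.
  rewrite mulr_sumr; apply: ler_sum => i _; rewrite normrM; apply: ler_wpM2r => //.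
  by rewrite !mxE; exact: yx.
have dle (j : 'I_n) : `|d 0 j| <= tau.
  by apply: le_trans dj; rewrite [X in _ <= X](bigD1 j)//= lerDl; apply: sumr_ge0.
pose t' i := t i + (if unlift ord0 i is Some j then d 0 j else - \sum_j d 0 j).
have E0 : t' ord0 = t ord0 - \sum_j d 0 j by rewrite /t' unlift_none.
have EL j : t' (lift ord0 j) = t (lift ord0 j) + d 0 j by rewrite /t' liftK.
exists t'; split.
- move=> i; case: (unliftP ord0 i) => [j|] ->.
    rewrite EL; have := taut (lift ord0 j); have := dle j; rewrite ler_norml => /andP[]; lra.
  rewrite E0 subr_ge0; apply: le_trans (taut ord0); apply: le_trans dj.
  by apply: ler_sum => j _; exact: ler_norm.
- rewrite big_ord_recl (eq_bigr _ (fun j _ => EL j)) E0.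
  rewrite big_split /= -t1 big_ord_recl; ring.
- rewrite big_ord_recl (eq_bigr (fun j => t (lift ord0 j) *: v (lift ord0 j) + d 0 j *: v (lift ord0 j))); last first.
    by move=> j _; rewrite EL scalerDl.
  rewrite E0.
  have -> : y = x + d *m A by rewrite /d mulmxKV// addrC subrK.
  rewrite big_split /= scalerBl /x big_ord_recl mulmx_sum_row addrACA -!addrA; congr (_ + (_ + _)).
  rewrite scaler_suml -sumrN -big_split /=; apply: eq_bigr => j _.
  by rewrite rowK scalerBr addrC.
Unshelve. all: by end_near.
Qed.

Hypotheses (ai : affinely_independent v)
  (nz : forall j x, (simplex v)° x -> lp j x != 0).

(** Enlarging one weight of the barycentre of the vertices moves the value of the form
    along a segment; it must not reach 0, as the point stays in the interior. *)
Lemma vertex_signs j : exists sg : R, [/\ sg = 1 \/ sg = -1,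
  forall i, 0 <= sg * lp j (v i) & exists i, lp j (v i) != 0].
Proof.
(* the value at the barycentre, up to the factor n + 1 *)
pose P := \sum_i lp j (v i).
have key i0 mu : 0 <= mu -> P + mu * lp j (v i0) != 0.
  move=> mu0; pose S := \sum_(i < n.+1) (1 + (if i == i0 then mu else 0)).
  have S0 : 0 < S.
    rewrite /S big_ord_recl; apply: ltr_wpDr.
      by apply: sumr_ge0 => i _; apply: addr_ge0 => //; case: ifP.
    by apply: ltr_wpDr => //; case: ifP.
  pose t i := (1 + (if i == i0 then mu else 0)) / S.
  have t0 i : 0 < t i by rewrite divr_gt0// ltr_wpDr//; case: ifP.
  have t1 : \sum_i t i = 1 by rewrite -mulr_suml mulfV// gt_eqF.
  have := nz j (barycentric_interior ai t0 t1); rewrite linear_poly_comb//.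
  suff -> : \sum_i t i * lp j (v i) = (P + mu * lp j (v i0)) / S.
    by apply: contra => /eqP ->; rewrite mul0r.
  rewrite /t; under eq_bigr do rewrite mulrAC mulrDl mul1r.
  rewrite -mulr_suml big_split /=; congr ((_ + _) / _).
  by rewrite (bigD1 i0)//= eqxx big1 ?addr0// => i /negbTE ->; rewrite mul0r.
have P0 : P != 0 by have := key ord0 0 (lexx 0); rewrite mul0r addr0.
have ex : exists i, lp j (v i) != 0.
  apply/existsP; apply: contraNT P0 => /existsPn H.
  by rewrite /P big1// => i _; apply/eqP; have := H i; rewrite negbK.
have no_opposite i : lp j (v i) != 0 -> 0 <= - P / lp j (v i) -> False.
  by move=> li mu0; have := key i _ mu0; rewrite divfK// subrr eqxx.
have [Pp|Pn] := ltP 0 P.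
  exists 1; split=> //; first by left.
  move=> i; rewrite mul1r leNgt; apply/negP => li; apply: (no_opposite i); first by rewrite lt_eqF.
  by apply: mulr_le0; rewrite ?oppr_le0 ?invr_le0 ltW.
exists (-1); split=> //; first by right.
move=> i; rewrite mulN1r oppr_ge0 leNgt; apply/negP => li; apply: (no_opposite i); first by rewrite gt_eqF.
by apply: mulr_ge0; rewrite ?oppr_ge0 ?invr_ge0// ltW.
Qed.

End Signs.

Section SignPower.
Context {R : realType}.
Local Notation C := (cplx R).

Definition sign_factor (e : R) (s : C) : C := if 0 < e then 1 else cexp (- (pi%:C * 'i * s)).

Lemma cpow_sign (e a : R) s : e = 1 \/ e = -1 -> 0 <= a ->
  real_cpow (e * a) s = sign_factor e s * real_cpow a s.
Proof.
move=> e1; rewrite le_eqVlt => /predU1P[<-|a0]; first by rewrite mulr0 cpow0 mulr0.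
case: e1 => ->; first by rewrite mul1r /sign_factor ltr01 mul1r.
rewrite mulN1r /sign_factor ltr0N1 /real_cpow oppr_eq0 gt_eqF// oppr_gt0 ltNge (ltW a0) /= a0.
by rewrite normrN gtr0_norm// mulrC.
Qed.

Lemma holat_sign_factor s0 e : holat s0 (sign_factor e).
Proof.
rewrite /sign_factor; case: (0 < e); first exact: holat_cst.
pose L : C := - (pi%:C * 'i); pose K := 2 * nm (1 : C) * expR (complex.Re (s0 * L) + nm L).
have K0 : 0 < K by rewrite mulr_gt0 ?expR_gt0// nm1 mulr1.
exists (Num.min 1 K^-1); have m0 : 0 < Num.min 1 K^-1 by rewrite lt_min ltr01 invr_gt0.
apply: (@hol_eq _ _ _ (fun s => 1 * cexp (s * L))).
  by move=> s _; rewrite mul1r /L; congr cexp; ring.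
apply: hol_cexpC => //; apply: le_trans (_ : K <= _); last first.
  by rewrite -{1}[K]invrK lef_pV2 ?posrE ?invr_gt0// ge_min lexx orbT.
rewrite /K ler_wpM2l ?mulr_ge0 ?nm_ge0// ler_expR lerD2l ler_piMl ?nm_ge0// ge_min lexx//.
Qed.

End SignPower.

Theorem lemma3p1 (R : realType) (n k : nat)
    (v : 'I_n.+1 -> 'rV[R]_n)
    (c : 'I_k -> R) (l : 'I_k -> 'rV[R]_n)
    (E : 'rV[cplx R]_(1 + n) -> cplx R) (U : set 'rV[cplx R]_(1 + n)) :
  affinely_independent v ->
  (forall j x, (simplex v)° x -> linear_poly (c j) (l j) x != 0) ->
  open U ->
  (forall (s : cplx R) (x : 'rV[R]_n), simplex v x -> U (complex_point s x)) ->
  (forall p, U p -> analytic_at E p) ->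
  let integrand (s : cplx R) (x : 'rV[R]_n) : cplx R :=
    real_cpow (\prod_j linear_poly (c j) (l j) x) s * E (complex_point s x) in
  (forall s : cplx R, 0 < complex.Re s -> cintegrable (simplex v) (integrand s)) /\
  exists F : cplx R -> cplx R,
    [/\ meromorphic F,
        forall s : cplx R, 0 < complex.Re s -> F s = cintegral (simplex v) (integrand s),
        forall s m, pole_of_order m F s -> exists q : rat, s = ratr q
      & forall s m, pole_of_order m F s -> (m <= n)%N].
Proof.
move=> ai nz oU VU EU integrand.
have EV s x : simplex v x -> analytic_at E (complex_point s x) by move=> Vx; apply/EU/VU.
have af := affinely_independent_free ai.
have [sg sgP] := choice (vertex_signs ai nz).
pose c' j := sg j * c j; pose l' j := sg j *: l j; pose e := \prod_j sg j.
have lpE j x : linear_poly (c' j) (l' j) x = sg j * linear_poly (c j) (l j) x.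
  by rewrite /linear_poly mulrDr mulr_sumr; congr (_ + _); apply: eq_bigr => i _; rewrite mxE mulrA.
have e1 : e = 1 \/ e = -1.
  rewrite /e; elim/big_ind: _ => [|x y [->|->] [->|->]|j _]; rewrite ?mul1r ?mulN1r ?opprK; try by [left|right].
  by case: (sgP j).
have sg2 j : sg j * sg j = 1 by case: (sgP j) => -[] -> _ _; rewrite ?mul1r ?mulN1r ?opprK.
have nn j i : 0 <= linear_poly (c' j) (l' j) (v i) by rewrite lpE; case: (sgP j).
have IE s x : simplex v x -> integrand s x = sign_factor e s * power_integrand c' l' E s x.
  move=> [t [t0 t1 ->]]; rewrite /integrand /power_integrand mulrA -cpow_sign//; last first.
    apply: prodr_ge0 => j _; rewrite linear_poly_comb//; apply: sumr_ge0 => i _; exact: mulr_ge0.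
  congr (real_cpow _ _ * _); rewrite -big_split /=; apply: eq_bigr => j _.
  by rewrite lpE mulrA sg2 mul1r.
have [mV Vfin] : measurable (@row_of_tuple R n @^-1` simplex v) /\ (lebesgueT n (@row_of_tuple R n @^-1` simplex v) < +oo)%E.
  have [w wE _] := vertex_seq v; rewrite -wE; rewrite -wE in af.
  by split; [exact: measurable_simplex|exact: lebesgueT_simplex_fin].
have bp s : 0 < complex.Re s -> bmf (@row_of_tuple R n @^-1` simplex v) (fun u => power_integrand c' l' E s (row_of_tuple u)).
  by move=> s0; apply: bmf_power_integrand; [|exact: nn|move=> x; exact: EV|exact: ltW].
have bi s : 0 < complex.Re s -> bmf (@row_of_tuple R n @^-1` simplex v) (fun u => integrand s (row_of_tuple u)).
  move=> s0; apply: eq_bmf (bmfMl (sign_factor e s) (bp s s0)) => u Vu.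
  by rewrite IE.
split=> [s s0|].
  by split; [exact: (bmf_Re mV Vfin (bi s s0))|exact: (bmf_Im mV Vfin (bi s s0))].
have cont : continuable k (simplex v) (power_integrand c' l' E).
  apply: simplex_continuable => // j; case: (sgP j) => _ _ [i ji]; exists i.
  rewrite lpE mulf_neq0//; apply/eqP => z0; have := sg2 j.
  by rewrite z0 mul0r => /esym/eqP; rewrite oner_eq0.
pose I s := cintegral (simplex v) (integrand s).
have II s : 0 < complex.Re s -> I s = sign_factor e s * cintegral (simplex v) (power_integrand c' l' E s).
  move=> s0; rewrite -[RHS](cintMl mV Vfin _ (bp s s0)).
  by apply: eq_cint => u Vu; rewrite IE.
have ch M : exists h : cplx R -> cplx R, (forall s, half_plane M%:R s -> holat s h) /\
    forall s, 0 < complex.Re s -> h s = clearing n k M s * cintegral (simplex v) (power_integrand c' l' E s).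
  by have [h h1 h2] := cont M; exists h.
have [h hP] := choice ch.
pose h' M s := sign_factor e s * h M s.
have hol' M s : half_plane M%:R s -> holat s (h' M).
  by move=> hs; apply: holat_mul; [exact: holat_sign_factor|case: (hP M) => + _; exact].
have hI M s : 0 < complex.Re s -> h' M s = clearing n k M s * I s.
  by move=> s0; rewrite /h' II//; case: (hP M) => _ ->//; rewrite mulrCA.
have uB M : uniq (pole_list n k M) by exact: undup_uniq.
have B0 M q : q \in pole_list n k M -> q < 0.
  rewrite mem_undup => /allpairsP[[a m] /= []]; rewrite !mem_iota => /andP[a0 _] /andP[m0 _] ->.
  by rewrite oppr_lt0 divr_gt0 ?ltr0n.
exists (continuation n (pole_list n k) h'); split.
- exact: (continuation_meromorphic uB hol' hI).
- by move=> s s0; exact: (continuation_right uB B0 hol' hI).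
- move=> s m ps; have [m0 [mm0 _ m0q]] := pole_order_le uB hol' hI ps.
  by case: ps => m_gt0 _; apply: m0q; exact: leq_trans mm0.
- by move=> s m ps; have [m0 [mm0 m0n _]] := pole_order_le uB hol' hI ps; exact: leq_trans m0n.
Qed.
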